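(* Let $V_{\mathbb R}$ be a real vector space and let $\mathfrak g_{\mathbb R}\subset\mathfrak{sl}(V_{\mathbb R})$ be an irreducible compact linear Lie algebra of rank $r>1$ whose commutator subalgebra is simple. Let $V:=V_{\mathbb R}\otimes_{\mathbb R}\mathbb C$, $\mathfrak g:=\mathfrak g_{\mathbb R}\otimes_{\mathbb R}\mathbb C\subset\mathfrak{sl}(V)$, and let $R$ be a faithful irreducible representation of $\mathfrak g$ such that the tautological representation of $\mathfrak g$ on $V$ is $R$ or $R\oplus R'$ ($R'$ the dual of $R$). Suppose that the (simple) linear Lie algebra $R([\mathfrak g,\mathfrak g])$ is classical. Then there exists a vector $v\in V_{\mathbb R}$ with $\operatorname{rk}\bigl((\mathfrak g_{\mathbb R})_v\bigr)=1$ if and only if the linear algebra $\mathfrak g\subset\mathfrak{sl}(V)$ is reducible and the complex linear Lie algebra $\mathfrak g\subset\mathfrak{gl}_{\mathbb C}(V_{\mathbb R})$ coincides with one of the linear algebras $\mathfrak{so}_{2r-1}\oplus\mathbb C E$ ($r=2,3$), $\mathfrak{sl}_3$, $\mathfrak{gl}_2$ and $\mathfrak{sp}_4$.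
   Context: All spaces are finite-dimensional. A compact linear Lie algebra in $\mathfrak{gl}(V_{\mathbb R})$ is the Lie algebra of a compact subgroup of $GL(V_{\mathbb R})$. The rank of a compact Lie algebra is the dimension of a maximal commutative subalgebra. $(\mathfrak g_{\mathbb R})_v=\{x\in\mathfrak g_{\mathbb R}: xv=0\}$. If $\mathfrak g\subset\mathfrak{sl}(V)$ is reducible, then $V_{\mathbb R}$ has a $\mathfrak g_{\mathbb R}$-invariant complex structure, and one regards $\mathfrak g=\mathfrak g_{\mathbb R}\oplus i\mathfrak g_{\mathbb R}\subset\mathfrak{gl}_{\mathbb C}(V_{\mathbb R})$ as a complex linear Lie algebra on the complex space $V_{\mathbb R}$. Linear Lie algebras are considered up to isomorphism of linear Lie algebras (conjugation by a linear isomorphism of the underlying spaces). A simple complex linear Lie algebra is classical if it is one of $\mathfrak{sl}_n,\mathfrak{so}_n,\mathfrak{sp}_{2n}$ in its tautological representation (on $\mathbb C^n,\mathbb C^n,\mathbb C^{2n}$). The algebras $\mathfrak{so}_{2r-1}$, $\mathfrak{sl}_3$, $\mathfrak{gl}_2$, $\mathfrak{sp}_4$ are complex and taken in their tautological representations on $\mathbb C^{2r-1},\mathbb C^3,\mathbb C^2,\mathbb C^4$; $E$ is the identity operator. *)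

(* Defs.v *)
From HB Require Import structures.
From mathcomp Require Import all_boot all_order all_algebra.
From mathcomp Require Import complex.
From mathcomp Require Import all_classical all_reals all_analysis.

Set Implicit Arguments.
Unset Strict Implicit.
Unset Printing Implicit Defensive.

Import Order.TTheory GRing.Theory Num.Theory.
Import numFieldNormedType.Exports.

Local Open Scope classical_set_scope.
Local Open Scope ring_scope.

(* A finite-dimensional space over F is taken to be F^n, i.e. 'cV[F]_n, on
   which 'M[F]_n acts by left multiplication; a linear Lie algebra is a
   subspace of 'M[F]_n closed under the commutator bracket. *)

Section LinearLieAlgebras.
Variable F : fieldType.

Definition lie_bracket n (x y : 'M[F]_n) : 'M[F]_n := x *m y - y *m x.

Definition is_lie_algebra n (h : {vspace 'M[F]_n}) : Prop :=
  forall x y, x \in h -> y \in h -> lie_bracket x y \in h.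

Definition commutative n (h : {vspace 'M[F]_n}) : Prop :=
  forall x y, x \in h -> y \in h -> lie_bracket x y = 0.

(* By bilinearity the brackets of basis elements span [h, h]. *)
Definition derived n (h : {vspace 'M[F]_n}) : {vspace 'M[F]_n} :=
  <<[seq lie_bracket x y | x <- vbasis h, y <- vbasis h]>>%VS.

Definition is_ideal n (h I : {vspace 'M[F]_n}) : Prop :=
  (I <= h)%VS /\ forall x y, x \in h -> y \in I -> lie_bracket x y \in I.

Definition simple_lie n (h : {vspace 'M[F]_n}) : Prop :=
  ~ commutative h /\
  forall I : {vspace 'M[F]_n}, is_ideal h I -> I = 0%VS \/ I = h.

(* "Maximal" is with respect to inclusion; a subspace on which the bracket
   vanishes is automatically a subalgebra. *)
Definition maximal_commutative n (h t : {vspace 'M[F]_n}) : Prop :=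
  [/\ (t <= h)%VS, commutative t &
      forall t' : {vspace 'M[F]_n},
        (t <= t')%VS -> (t' <= h)%VS -> commutative t' -> t' = t].

(* For a compact Lie algebra the number r does not depend on the choice of
   the maximal commutative subalgebra t. *)
Definition lie_rank n (h : {vspace 'M[F]_n}) (r : nat) : Prop :=
  exists2 t : {vspace 'M[F]_n}, maximal_commutative h t & \dim t = r.

Definition stabilizer n (h : {vspace 'M[F]_n}) (v : 'cV[F]_n) :
    {vspace 'M[F]_n} :=
  (h :&: lker (linfun (mulmxr v : 'M[F]_n -> 'cV[F]_n)))%VS.

Definition invariant_subspace n (h : {vspace 'M[F]_n})
    (U : {vspace 'cV[F]_n}) : Prop :=
  forall x u, x \in h -> u \in U -> x *m u \in U.

Definition reducible n (h : {vspace 'M[F]_n}) : Prop :=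
  exists U : {vspace 'cV[F]_n},
    [/\ invariant_subspace h U, U <> 0%VS & U <> fullv].

Definition irreducible n (h : {vspace 'M[F]_n}) : Prop :=
  (0 < n)%N /\ ~ reducible h.

(* Representations of h on F^m are maps 'M[F]_n -> 'M[F]_m of which only the
   restriction to h matters; every linear map on h has a linear extension. *)
Definition is_representation n m (h : {vspace 'M[F]_n})
    (rho : 'Hom('M[F]_n, 'M[F]_m)) : Prop :=
  {in h &, forall x y, rho (lie_bracket x y) = lie_bracket (rho x) (rho y)}.

Definition faithful n m (h : {vspace 'M[F]_n})
    (rho : 'Hom('M[F]_n, 'M[F]_m)) : Prop :=
  {in h &, injective rho}.

Definition representations_isomorphic n m1 m2 (h : {vspace 'M[F]_n})
    (rho1 : 'M[F]_n -> 'M[F]_m1) (rho2 : 'M[F]_n -> 'M[F]_m2) : Prop :=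
  exists (P : 'M[F]_(m2, m1)) (Q : 'M[F]_(m1, m2)),
    [/\ P *m Q = 1%:M, Q *m P = 1%:M &
        {in h, forall x, P *m rho1 x = rho2 x *m P}].

Definition dual_representation n m (rho : 'M[F]_n -> 'M[F]_m)
  (x : 'M[F]_n) : 'M[F]_m := - (rho x)^T.

Definition representation_sum n m1 m2 (rho1 : 'M[F]_n -> 'M[F]_m1)
    (rho2 : 'M[F]_n -> 'M[F]_m2) (x : 'M[F]_n) : 'M[F]_(m1 + m2) :=
  block_mx (rho1 x) 0 0 (rho2 x).

Definition linear_isomorphic n1 n2 (h1 : {vspace 'M[F]_n1})
    (h2 : {vspace 'M[F]_n2}) : Prop :=
  exists (P : 'M[F]_(n2, n1)) (Q : 'M[F]_(n1, n2)),
    [/\ P *m Q = 1%:M, Q *m P = 1%:M &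
        forall x : 'M[F]_n1, x \in h1 <-> P *m x *m Q \in h2].

Definition sl_alg n : {vspace 'M[F]_n} :=
  lker (linfun (fun x : 'M[F]_n => \tr x : F^o)).

Definition so_alg n : {vspace 'M[F]_n} :=
  lker (linfun (fun x : 'M[F]_n => x + x^T)).

Definition symplectic_form n : 'M[F]_(n + n) := block_mx 0 1%:M (- 1%:M) 0.

(* The algebra sp_{2n}, acting on F^{n + n}. *)
Definition sp_alg n : {vspace 'M[F]_(n + n)} :=
  lker (linfun (fun x : 'M[F]_(n + n) =>
    x^T *m symplectic_form n + symplectic_form n *m x)).

Definition gl_alg n : {vspace 'M[F]_n} := fullv.

Definition classical n (h : {vspace 'M[F]_n}) : Prop :=
  simple_lie h /\
  exists k : nat, [\/ linear_isomorphic h (sl_alg k),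
                      linear_isomorphic h (so_alg k) |
                      linear_isomorphic h (sp_alg k)].

Lemma mem_stabilizer n (h : {vspace 'M[F]_n}) v x :
  (x \in stabilizer h v) = (x \in h) && (x *m v == 0).
Proof. by rewrite memv_cap memv_ker lfunE. Qed.

Lemma mem_sl_alg n (x : 'M[F]_n) : (x \in sl_alg n) = (\tr x == 0).
Proof.
have lin : linear (fun y : 'M[F]_n => \tr y : F^o).
  by move=> a u v; rewrite mxtraceD mxtraceZ.
pose lm := GRing.isLinear.Build _ _ _ _ _ lin.
pose f : {linear 'M[F]_n -> F^o} := HB.pack (fun y => \tr y : F^o) lm.
by rewrite memv_ker -[fun y => _]/(f : _ -> _) lfunE.
Qed.

Lemma mem_so_alg n (x : 'M[F]_n) : (x \in so_alg n) = (x + x^T == 0).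
Proof.
have lin : linear (fun y : 'M[F]_n => y + y^T).
  by move=> a u v; rewrite linearP scalerDr addrACA.
pose lm := GRing.isLinear.Build _ _ _ _ _ lin.
pose f : {linear 'M[F]_n -> 'M[F]_n} := HB.pack (fun y => y + y^T) lm.
by rewrite memv_ker -[fun y => _]/(f : _ -> _) lfunE.
Qed.

Lemma mem_sp_alg n (x : 'M[F]_(n + n)) : (x \in sp_alg n) =
  (x^T *m symplectic_form n + symplectic_form n *m x == 0).
Proof.
have lin : linear (fun y : 'M[F]_(n + n) =>
    y^T *m symplectic_form n + symplectic_form n *m y).
  move=> a u v; rewrite linearP /= mulmxDl mulmxDr -scalemxAl -scalemxAr.
  by rewrite scalerDr addrACA.
pose lm := GRing.isLinear.Build _ _ _ _ _ lin.
pose f : {linear 'M[F]_(n + n) -> 'M[F]_(n + n)} := HB.pack (fun y =>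
  y^T *m symplectic_form n + symplectic_form n *m y) lm.
by rewrite memv_ker -[fun y => _]/(f : _ -> _) lfunE.
Qed.

End LinearLieAlgebras.

Section RealLinearLieAlgebras.
Variable R : realType.

Definition expmx n (x : 'M[R]_n) : 'M[R]_n :=
  limn (series (fun k : nat => (k`!%:R)^-1 *: x ^+ k)).

Definition is_GL_subgroup n (G : set 'M[R]_n) : Prop :=
  [/\ G `<=` [set x | x \in unitmx], G 1%:M,
      (forall x y, G x -> G y -> G (x *m y)) &
      (forall x, G x -> G (invmx x))].

Definition compact_linear_lie_algebra n (h : {vspace 'M[R]_n}) : Prop :=
  is_lie_algebra h /\
  exists G : set 'M[R]_n,
    [/\ is_GL_subgroup G, compact G &
        forall x : 'M[R]_n, x \in h <-> forall t : R, G (expmx (t *: x))].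

(* The complexification, as a subspace of the complex n x n matrices, i.e. of
   gl(R^n (x) C); the tautological representation on C^n is the identity. *)
Definition complexification n (h : {vspace 'M[R]_n}) :
    {vspace 'M[R[i]]_n} :=
  <<[seq map_mx (real_complex R) x | x <- vbasis h]>>%VS.

Definition invariant_complex_structure n (h : {vspace 'M[R]_n})
    (J : 'M[R]_n) : Prop :=
  J *m J = - 1%:M /\ {in h, forall x, J *m x = x *m J}.

(* Multiplication by the scalar z on R^n with the complex structure J. *)
Definition complex_scale n (J : 'M[R]_n) (z : R[i]) (v : 'cV[R]_n) :
    'cV[R]_n :=
  complex.Re z *: v + complex.Im z *: (J *m v).

(* The real subspace h + J h of 'M[R]_n. *)
Definition complex_hull n (h : {vspace 'M[R]_n}) (J : 'M[R]_n) :
    {vspace 'M[R]_n} :=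
  (h + linfun (mulmx J : 'M[R]_n -> 'M[R]_n) @: h)%VS.

(* h + J h, acting on the complex space (R^n, J), is carried onto the linear
   Lie algebra a on C^m by the complex-linear isomorphism phi. *)
Definition complex_linear_isomorphic n m (h : {vspace 'M[R]_n})
    (J : 'M[R]_n) (a : {vspace 'M[R[i]]_m}) : Prop :=
  exists phi : 'cV[R]_n -> 'cV[R[i]]_m,
    [/\ bijective phi,
        (forall u v, phi (u + v) = phi u + phi v),
        (forall z v, phi (complex_scale J z v) = z *: phi v),
        (forall x, x \in complex_hull h J ->
           exists2 y, y \in a & forall v, phi (x *m v) = y *m phi v) &
        (forall y, y \in a ->
           exists2 x, x \in complex_hull h J &
             forall v, phi (x *m v) = y *m phi v)].

End RealLinearLieAlgebras.

(* Main.v *)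
Require Import Defs.
From HB Require Import structures.
From mathcomp Require Import all_boot all_order all_algebra.
From mathcomp Require Import complex ring lra zify.
From mathcomp Require Import all_classical all_reals all_analysis.

Set Implicit Arguments.
Unset Strict Implicit.
Unset Printing Implicit Defensive.
Import Order.TTheory GRing.Theory Num.Theory.
Local Open Scope ring_scope.
Local Open Scope sesquilinear_scope.

(* A compact linear Lie algebra preserves a positive definite quadratic form Q.
   If V is irreducible, g contains a conjugate of its classical algebra, which
   thus preserves a nondegenerate symmetric form.  An elementary matrix E_ij,
   i <> j, never does, which excludes sl and sp; for so_n the algebra gR is all of
   so(Q), where no stabilizer has rank 1 as soon as n > 4, while n <= 4
   contradicts r > 1 or simplicity.
     If V = R + R', then V_R maps isomorphically onto the space of R, the image
   of g is s or s + C with s classical, and in suitable coordinates gR consists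
   of the skew-hermitian elements of this image.  Let x kill v.  In large
   dimension, eigenvectors of x orthogonal to v yield two independent elements of
   gR that kill v and commute with x, so no stabilizer has rank 1.  In the small
   dimensions left over, explicit vectors work, or the rank of gR is too small. *)

(** * Hermitian matrices *)

(** The hard point is to normalize two structures at once: the hermitian form H that gR preserves
    and the bilinear form B of so or sp. Irreducibility of s (Schur's lemma, done with matrix units)
    makes them compatible up to a scalar; a positive square root of H then preserves B and
    straightens H.

    Schur's lemma also explains why the image of g is s or s + C: an element normalizing so or sp
    rescales B, so subtracting a scalar puts it into s. The case s = so without scalars disappears,
    since R^k in C^k would be invariant under gR.

    The invariant quadratic form is not an average over the group: it is the essentially unique
    minimizer of a supremum over the group, found by the parallelogram law.

    The thresholds on the dimension count the vectors that must be orthogonal to each other: v and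
    two eigenvectors for gl, a third eigenvector for sl to balance traces, quaternionic lines
    instead of vectors for sp, and v, its conjugate and up to three more vectors for so.

    Rank one is handled through a single x that spans its own centralizer; other ranks are bounded
    by splitting a commuting skew family into planes. *)

Section Hermitian.
Variable C : numClosedFieldType.

Lemma trmxCM m n p (A : 'M[C]_(m, n)) (B : 'M[C]_(n, p)) :
  (A *m B) ^t* = B ^t* *m A ^t*.
Proof. by rewrite trmx_mul map_mxM. Qed.

Lemma trmxCD m n (A B : 'M[C]_(m, n)) : (A + B) ^t* = A ^t* + B ^t*.
Proof. by rewrite linearD map_mxD. Qed.

Lemma trmxCZ m n a (A : 'M[C]_(m, n)) : (a *: A) ^t* = a^* *: A ^t*.
Proof. by rewrite linearZ /= map_mxZ. Qed.

Lemma trmxCN m n (A : 'M[C]_(m, n)) : (- A) ^t* = - A ^t*.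
Proof. by rewrite linearN map_mxN. Qed.

Lemma trmxC1 n : (1%:M : 'M[C]_n) ^t* = 1%:M.
Proof. by rewrite trmx1 map_mx1. Qed.

Lemma trmxC_inv n (A : 'M[C]_n) : (invmx A) ^t* = invmx (A ^t*).
Proof. by rewrite trmx_inv map_invmx. Qed.

Lemma unitmx_trmxC n (A : 'M[C]_n) : (A ^t* \in unitmx) = (A \in unitmx).
Proof. by rewrite map_unitmx unitmx_tr. Qed.

Lemma mx11_ext (A B : 'M[C]_1) : A 0 0 = B 0 0 -> A = B.
Proof. by move=> e; apply/matrixP=> i j; rewrite !ord1. Qed.

Lemma sqnorm_gt0 n (u : 'cV[C]_n) : u != 0 -> 0 < (u ^t* *m u) 0 0.
Proof.
move=> u_neq0; rewrite mxE.
have [i ui] : exists i, u i 0 != 0.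
  apply/existsP; apply: contraNT u_neq0; rewrite negb_exists => /forallP h.
  by apply/eqP/colP => j; rewrite mxE; apply/eqP; rewrite -[_ == _]negbK h.
have t j : u ^t* 0 j * u j 0 = u j 0 * (u j 0)^*.
  by rewrite !mxE mulrC.
rewrite (bigD1 i) //= ltr_wpDr //; last by rewrite t mul_conjC_gt0.
by rewrite sumr_ge0 // => j _; rewrite t mul_conjC_ge0.
Qed.

Lemma unit_vector n (w : 'cV[C]_n) : w != 0 ->
  exists s (u : 'cV[C]_n), [/\ 0 < s, w = s *: u & u ^t* *m u = 1%:M].
Proof.
move=> w0; have nw := sqnorm_gt0 w0; pose s := sqrtC ((w ^t* *m w) 0 0).
have s0 : 0 < s by rewrite sqrtC_gt0.
exists s, (s^-1 *: w); split=> //.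
  by rewrite scalerA divff ?scale1r // gt_eqF.
apply: mx11_ext; rewrite trmxCZ -scalemxAl -scalemxAr !scalerA mxE.
rewrite (CrealP _) ?rpredV ?gtr0_real // -invfM -expr2 sqrtCK.
by rewrite mulVf ?gt_eqF // mxE.
Qed.

Definition posdefmx n (H : 'M[C]_n) : Prop :=
  H ^t* = H /\ forall u : 'cV[C]_n, u != 0 -> 0 < (u ^t* *m H *m u) 0 0.

Lemma posdefmx_congr m n (H : 'M[C]_m) (A : 'M[C]_(m, n)) :
  posdefmx H -> (forall u : 'cV_n, A *m u = 0 -> u = 0) ->
  posdefmx (A ^t* *m H *m A).
Proof.
move=> [Hh Hp] Ainj; split=> [|u u0].
  by rewrite !trmxCM trmxCK Hh mulmxA.
have -> : u ^t* *m (A ^t* *m H *m A) *m u = (A *m u) ^t* *m H *m (A *m u).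
  by rewrite trmxCM !mulmxA.
by apply: Hp; apply: contra_neq u0 => /Ainj.
Qed.

Lemma unitmx_inj n (A : 'M[C]_n) (u : 'cV_n) : A \in unitmx -> A *m u = 0 -> u = 0.
Proof. by move=> Au /(congr1 (mulmx (invmx A))); rewrite mulKmx // mulmx0. Qed.

Lemma posdefmx_congr_unit n (H A : 'M[C]_n) : posdefmx H -> A \in unitmx ->
  posdefmx (A ^t* *m H *m A).
Proof. by move=> Hp Au; apply: posdefmx_congr => // u; apply: unitmx_inj. Qed.

Lemma posdefmx_unit n (H : 'M[C]_n) : posdefmx H -> H \in unitmx.
Proof.
move=> [Hh Hp]; rewrite -row_free_unit; apply: inj_row_free => v vH0.
have [//|v0] := eqVneq v 0.
have /Hp : v ^t* != 0.
  by apply: contra_neq v0 => /(congr1 (fun w => w ^t*)); rewrite trmxCK trmx0 map_mx0.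
by rewrite trmxCK vH0 mul0mx mxE ltxx.
Qed.

Lemma posdefmx_inv n (H : 'M[C]_n) : posdefmx H -> posdefmx (invmx H).
Proof.
move=> Hp; have Hu := posdefmx_unit Hp.
have := posdefmx_congr_unit Hp (_ : invmx H \in unitmx).
by rewrite trmxC_inv Hp.1 mulVmx // mul1mx; apply; rewrite unitmx_inv.
Qed.

Lemma posdefmx_conj n (H : 'M[C]_n) : posdefmx H -> posdefmx (map_mx Num.conj H).
Proof.
move=> [Hh Hp]; split=> [|u u0].
  by rewrite map_trmx Hh.
have u1 : map_mx Num.conj u != 0.
  by apply: contra_neq u0 => /(congr1 (map_mx Num.conj)); rewrite map_mxCK map_mx0.
have := Hp _ u1.
suff -> : (map_mx Num.conj u) ^t* *m H *m (map_mx Num.conj u)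
  = map_mx Num.conj (u ^t* *m map_mx Num.conj H *m u).
  by rewrite mxE !lt_def conjC_eq0 conjC_ge0.
by rewrite !map_mxM /= !map_trmx !map_mxCK.
Qed.

Lemma posdefmxZ n a (H : 'M[C]_n) : 0 < a -> posdefmx H -> posdefmx (a *: H).
Proof.
move=> a0 [Hh Hp]; split=> [|u u0].
  by rewrite trmxCZ Hh (CrealP _) // gtr0_real.
by rewrite -scalemxAr -scalemxAl mxE mulr_gt0 // Hp.
Qed.

(** By the spectral theorem H = P^* diag(d) P with P unitary, and positivity of H makes every d_i
    positive, so the root can be taken on the diagonal. *)
Lemma posdefmx_sqrt n (H : 'M[C]_n) : posdefmx H ->
  exists2 g : 'M[C]_n, posdefmx g & g *m g = H.
Proof.
move=> Hp; have Hn : H \is normalmx by apply/normalmxP; rewrite Hp.1.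
have /orthomx_spectralP HE := Hn.
set P := spectralmx H in HE; set d := spectral_diag H in HE.
have Pun : P \is unitarymx := spectral_unitarymx H.
have Pu : P \in unitmx := unitarymx_unit Pun.
have PPt : P *m P ^t* = 1%:M by apply/unitarymxP.
have PtP : P ^t* *m P = 1%:M by apply: mulmx1C.
rewrite (invmx_unitary Pun) in HE.
have dp : posdefmx (diag_mx d).
  have -> : diag_mx d = (P ^t*) ^t* *m H *m P ^t*.
    by rewrite HE trmxCK !mulmxA PPt mul1mx -mulmxA PPt mulmx1.
  by apply: posdefmx_congr_unit; rewrite ?unitmx_trmxC.
have d0 i : 0 < d 0 i.
  have e0 : delta_mx i 0 != 0 :> 'cV[C]_n.
    by apply/eqP=> /colP/(_ i); rewrite !mxE !eqxx /= => /eqP; rewrite oner_eq0.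
  have := dp.2 _ e0; rewrite trmx_delta map_delta_mx -rowE row_diag_mx.
  by rewrite -scalemxAl mul_delta_mx !mxE !eqxx /= mulr1.
pose s := map_mx sqrtC d.
have s0 i : 0 < s 0 i by rewrite mxE sqrtC_gt0.
have sh : (diag_mx s) ^t* = diag_mx s.
  rewrite tr_diag_mx map_diag_mx; congr diag_mx; apply/rowP=> i.
  by rewrite [LHS]mxE; apply/CrealP; rewrite gtr0_real.
have sp : posdefmx (diag_mx s).
  split=> // u u0.
  have [i ui] : exists i, u i 0 != 0.
    apply/existsP; apply: contraNT u0; rewrite negb_exists => /forallP h.
    by apply/eqP/colP => j; rewrite mxE; apply/eqP; rewrite -[_ == _]negbK h.
  have t j : u ^t* 0 j * (diag_mx s *m u) j 0 = s 0 j * (u j 0 * (u j 0)^*).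
    by rewrite mul_diag_mx 3!mxE mulrC -mulrA.
  rewrite -mulmxA mxE (bigD1 i) //= ltr_wpDr //; last first.
    by rewrite t mulr_gt0 // mul_conjC_gt0.
  by rewrite sumr_ge0 // => j _; rewrite t mulr_ge0 ?mul_conjC_ge0 // ltW.
exists (P ^t* *m diag_mx s *m P); first exact: posdefmx_congr_unit.
rewrite [RHS]HE !mulmxA -[_ *m P *m P ^t*]mulmxA PPt mulmx1.
rewrite -[_ *m diag_mx s *m diag_mx s]mulmxA mulmx_diag.
congr (_ *m diag_mx _ *m _); apply/rowP=> i.
by rewrite !mxE -expr2 sqrtCK.
Qed.

Lemma mxtrace_sqnorm_ge0 m n (X : 'M[C]_(m, n)) : 0 <= \tr (X ^t* *m X).
Proof.
apply: sumr_ge0 => i _; rewrite mxE; apply: sumr_ge0 => j _.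
by rewrite !mxE mulrC mul_conjC_ge0.
Qed.

Lemma mxtrace_sqnorm_eq0 m n (X : 'M[C]_(m, n)) : \tr (X ^t* *m X) = 0 -> X = 0.
Proof.
have t i k : 0 <= X ^t* i k * X k i by rewrite !mxE mulrC mul_conjC_ge0.
have t' i : 0 <= (X ^t* *m X) i i by rewrite mxE sumr_ge0.
move/eqP; rewrite /mxtrace psumr_eq0 => [/allP h|i _]; last exact: t'.
apply/matrixP => k i; have := h i (mem_index_enum _).
rewrite mxE psumr_eq0 // => /allP/(_ k (mem_index_enum _)).
by rewrite !mxE mulrC mul_conjC_eq0 => /eqP.
Qed.

(* D = A - B satisfies A D = - D B; with A = a a and B = b b this reads
   tr ((a D)^* (a D)) = - tr ((D b)^* (D b)). *)
Lemma posdefmx_sqrt_unique n (A B : 'M[C]_n) :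
  posdefmx A -> posdefmx B -> A *m A = B *m B -> A = B.
Proof.
move=> Ap Bp eAB; apply/eqP; rewrite -subr_eq0; set D := A - B.
have DE : A *m D = - (D *m B) by rewrite mulmxBr mulmxBl eAB opprB.
have Dh : D ^t* = D by rewrite trmxCD trmxCN Ap.1 Bp.1.
have [a ap aE] := posdefmx_sqrt Ap; have [b bp bE] := posdefmx_sqrt Bp.
have e : \tr ((a *m D) ^t* *m (a *m D)) = - \tr ((D *m b) ^t* *m (D *m b)).
  rewrite trmxCM ap.1 mulmxA -[_ *m a *m a]mulmxA aE -mulmxA DE.
  rewrite mulmxN linearN /= trmxCM bp.1 Dh -[b *m D *m _]mulmxA.
  by rewrite [in RHS]mxtrace_mulC -!mulmxA bE.
have /eqP : \tr ((D *m b) ^t* *m (D *m b)) = 0.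
  apply/eqP; rewrite eq_le mxtrace_sqnorm_ge0 andbT -oppr_ge0 -e.
  exact: mxtrace_sqnorm_ge0.
move=> /eqP/mxtrace_sqnorm_eq0/(congr1 (mulmx^~ (invmx b))).
by rewrite mulmxK ?posdefmx_unit // mul0mx => ->.
Qed.

(** The restrictions to V, written in the basis [row_base V], still commute, so the eigenvector
    theorem for a full space applies to them. *)
Lemma common_eigenvector_in n (As : seq 'M[C]_n) (V : 'M[C]_n) : V != 0 ->
  {in As &, forall A B, comm_mx A B} -> {in As, forall A, stablemx V A} ->
  exists2 v : 'rV_n, v != 0 & (v <= V)%MS /\ {in As, forall A, stablemx v A}.
Proof.
move=> V0 comm stab.
have [||v v0 /allP vP] :=
  @common_eigenvector _ _ [seq restrictmx V A | A <- As].
- by rewrite lt0n mxrank_eq0.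
- move=> _ _ /mapP[A Ain ->] /mapP[B Bin ->].
  rewrite /comm_mx -[LHS]conjmxM ?inE ?stablemx_row_base ?stab //.
  by rewrite -[RHS]conjmxM ?inE ?stablemx_row_base ?stab // (comm _ _ Ain Bin).
exists (v *m row_base V); first by rewrite mulmx_free_eq0 ?row_base_free.
split=> [|A Ain]; first by rewrite mulmx_sub // eq_row_base.
by rewrite -stablemx_restrict ?stab // vP //; apply/mapP; exists A.
Qed.

(* The columns orthogonal to the eigenvectors of the adjoints form a common
   invariant subspace. *)
Lemma common_eigenvector_orth n (As : seq 'M[C]_n) (K : seq 'cV[C]_n) :
  (size K < n)%N -> {in As &, forall A B, comm_mx A B} ->
  {in As & K, forall A u, exists c, A ^t* *m u = c *: u} ->
  exists e : 'cV[C]_n, [/\ (e ^t* *m e) 0 0 = 1,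
    {in K, forall u, u ^t* *m e = 0} &
    {in As, forall A, exists c, A *m e = c *: e}].
Proof.
move=> Kn comm eig.
(* Eigenvectors are found as rows, hence the transposes: the left kernel of [M] is the orthogonal
   complement of [K], nonzero because [M] has fewer than n columns. *)
pose M : 'M[C]_(n, size K) := \matrix_(i, j) ((nth 0 K j) i 0)^*.
have Min (v : 'rV_n) : v *m M = 0 <-> {in K, forall u, u ^t* *m v^T = 0}.
  have t j : (v *m M) 0 j = (nth 0 K j ^t* *m v^T) 0 0.
    by rewrite !mxE; apply: eq_bigr => k _; rewrite !mxE mulrC.
  split=> [vM u /(nthP 0)[j jK <-]|h].
    by apply: mx11_ext; rewrite -(t (Ordinal jK)) vM !mxE.
  by apply/rowP => j; rewrite t h ?mem_nth // !mxE.
have [||_ /mapP[A Ain ->]|v v0 [vM vs]] :=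
  @common_eigenvector_in n [seq A^T | A <- As] (kermx M).
- rewrite -mxrank_eq0 mxrank_ker subn_eq0 -ltnNge.
  by rewrite (leq_ltn_trans (rank_leq_col _)).
- move=> _ _ /mapP[A Ain ->] /mapP[B Bin ->].
  by rewrite /comm_mx -!trmx_mul (comm _ _ Ain Bin).
- apply/rV_subP => w /submxP[a ->]; apply/sub_kermxP.
  have /Min h : a *m kermx M *m M = 0 by rewrite -mulmxA mulmx_ker mulmx0.
  rewrite mulmxA; set b := a *m _ in h *.
  apply/Min => u uK; have [c cE] := eig _ _ Ain uK.
  rewrite trmx_mul trmxK mulmxA -[A]trmxCK -trmxCM cE trmxCZ -scalemxAl.
  by rewrite h // scaler0.
have w0 : v^T != 0 by rewrite trmx_eq0.
have [s [e [s0 wE e1]]] := unit_vector w0.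
have eE : e = s^-1 *: v^T by rewrite wE scalerA mulVf ?scale1r ?gt_eqF.
exists e; split.
- by rewrite e1 mxE.
- by move=> u uK; rewrite eE -scalemxAr (Min v).1 ?scaler0 //; apply/sub_kermxP.
- move=> A Ain; have /sub_rVP[c cE] := vs _ (map_f _ Ain).
  exists c; rewrite eE -scalemxAr -[A]trmxK -trmx_mul cE linearZ /=.
  by rewrite !scalerA mulrC.
Qed.
End Hermitian.

(** * Vectors whose stabilizer has rank one *)

Section RankOne.
Variable C : numClosedFieldType.

(* Normalized form of rk (g_R)_v = 1: the line of x is a maximal commutative
   subalgebra of the stabilizer of w. *)
Definition rank_one_at m (h : 'M[C]_m -> Prop) (w : 'cV[C]_m) : Prop :=
  exists x, [/\ h x, x != 0, x *m w = 0 &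
    forall y, h y -> y *m w = 0 -> x *m y = y *m x ->
      exists2 c : C, c \is Num.real & y = c *: x].

(** Independence is asked over [C] although [h] is only a real space. [K] is a list because the
    orthogonal case must kill a vector together with its conjugate. *)
Definition two_commuting m (h : 'M[C]_m -> Prop) (K : seq 'cV[C]_m) x : Prop :=
  exists y1 y2, [/\ h y1 /\ h y2, comm_mx x y1 /\ comm_mx x y2,
    {in K, forall u, y1 *m u = 0 /\ y2 *m u = 0} &
    forall a b, a *: y1 + b *: y2 = 0 -> a = 0 /\ b = 0].

(** If the centralizer of x in the stabilizer were the line of x, both elements would be multiples a
    x and b x, and b y1 - a y2 = 0 would contradict independence. *)
Lemma two_commutingP m (h : 'M[C]_m -> Prop) w :
  (forall x, h x -> x *m w = 0 -> two_commuting h [:: w] x) ->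
  ~ rank_one_at h w.
Proof.
move=> H [x [hx x0 xw xc]].
have [y1 [y2 [[h1 h2] [c1 c2] kill indep]]] := H x hx xw.
have [k1 k2] := kill w (mem_head _ _).
have [a _ e1] := xc _ h1 k1 c1; have [b _ e2] := xc _ h2 k2 c2.
have [|b0 /eqP] := indep b (- a).
  by rewrite e1 e2 !scalerA mulNr mulrC scaleNr subrr.
rewrite oppr_eq0 => /eqP a0; have [] := indep 1 0.
  by rewrite e1 a0 !scale0r scaler0 addr0.
by move=> /eqP; rewrite oner_eq0.
Qed.

Section Skew.
Variables (m : nat) (x : 'M[C]_m).
Hypothesis xs : x ^t* = - x.

Lemma skewherm_eigenvalue (e : 'cV_m) c : e ^t* *m e = 1%:M -> x *m e = c *: e -> c^* = - c.
Proof.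
move=> e1 xe; have h : e ^t* *m x *m e = c%:M.
  by rewrite -mulmxA xe -scalemxAr e1 scale_scalar_mx mulr1.
have := congr1 (fun z : 'M[C]_1 => (z ^t*) 0 0) h.
rewrite !trmxCM trmxCK xs mulNmx mulmxN mulmxA h.
by rewrite !mxE eqxx !mulr1n => ->.
Qed.

(** Eigenvectors of a skew-hermitian matrix are eigenvectors of its adjoint, so the orthogonal
    complement of [K] is stable and contains a further eigenvector. *)
Lemma skewherm_eigenvector (K : seq 'cV[C]_m) : (size K < m)%N ->
  {in K, forall u, exists c, x *m u = c *: u} ->
  exists (e : 'cV_m) c, [/\ e ^t* *m e = 1%:M, {in K, forall u, u ^t* *m e = 0},
    x *m e = c *: e & c^* = - c].
Proof.
move=> Km eig.
have [||e [e1 eK /(_ x)]] := @common_eigenvector_orth C m [:: x] K Km.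
- by move=> A B; rewrite !inE => /eqP-> /eqP->.
- move=> A u; rewrite inE => /eqP-> /eig[c cE].
  by exists (- c); rewrite xs mulNmx cE scaleNr.
rewrite mem_head => /(_ isT)[c xe].
have e1' : e ^t* *m e = 1%:M by apply: mx11_ext; rewrite e1 mxE.
by exists e, c; split=> //; apply: skewherm_eigenvalue xe.
Qed.

Lemma comm_skewherm_outer (e : 'cV_m) c : x *m e = c *: e -> c^* = - c ->
  comm_mx x (e *m e ^t*).
Proof.
move=> xe cs; rewrite /comm_mx mulmxA xe -[in RHS]mulmxA.
have -> : e ^t* *m x = c *: e ^t*.
  by rewrite -[x]trmxCK -trmxCM xs mulNmx xe -scaleNr trmxCZ rmorphN /= cs opprK.
by rewrite -scalemxAl -scalemxAr.
Qed.
End Skew.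

Lemma comm_mxZ m (x y : 'M[C]_m) a : comm_mx x y -> comm_mx x (a *: y).
Proof. by rewrite /comm_mx -scalemxAr -scalemxAl => ->. Qed.

Lemma orthC m (u v : 'cV[C]_m) : u ^t* *m v = 0 -> v ^t* *m u = 0.
Proof. by move/(congr1 (fun z => z ^t*)); rewrite trmxCM trmxCK trmx0 map_mx0. Qed.

Lemma skewherm_outer m (e : 'cV[C]_m) :
  ('i *: (e *m e ^t*)) ^t* = - ('i *: (e *m e ^t*)).
Proof. by rewrite trmxCZ trmxCM trmxCK conjCi scaleNr. Qed.

Lemma outer0 m (e u : 'cV[C]_m) : e ^t* *m u = 0 -> e *m e ^t* *m u = 0.
Proof. by move=> h; rewrite -mulmxA h mulmx0. Qed.

Lemma outer1 m (e : 'cV[C]_m) : e ^t* *m e = 1%:M -> e *m e ^t* *m e = e.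
Proof. by move=> h; rewrite -mulmxA h mulmx1. Qed.

Lemma unit_neq0 m (e : 'cV[C]_m) : e ^t* *m e = 1%:M -> e != 0.
Proof.
move=> h; apply/eqP => e0; move: h => /matrixP/(_ 0 0)/eqP.
by rewrite e0 mulmx0 !mxE eq_sym oner_eq0.
Qed.

Lemma scalei_eq0 m (a : C) (e : 'cV[C]_m) : e != 0 -> a *: ('i *: e) = 0 -> a = 0.
Proof.
move=> e0 /eqP; rewrite scalerA scaler_eq0 (negPf e0) orbF mulf_eq0.
by rewrite (negPf (neq0Ci C)) orbF => /eqP.
Qed.

(** Since x w = 0, w counts as an eigenvector. Two more eigenvectors e and f, orthogonal to w and to
    each other, give i times the projections onto their lines; finding f needs m > 2. *)
Lemma gl_two_commuting m (x : 'M[C]_m) w : (2 < m)%N ->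
  x ^t* = - x -> x *m w = 0 ->
  two_commuting (fun y => y ^t* = - y) [:: w] x.
Proof.
move=> m2 xs xw; have eigw : exists c, x *m w = c *: w by exists 0; rewrite scale0r.
have [||e [c [e1 ew xe cs]]] := @skewherm_eigenvector m x xs [:: w].
- exact: ltnW.
- by move=> u; rewrite inE => /eqP->.
have [|f [d [f1 fw xf ds]]] := @skewherm_eigenvector m x xs [:: w; e] m2.
  by move=> u; rewrite !inE => /orP[]/eqP-> //; exists c.
have fe : e ^t* *m f = 0 by apply: fw; rewrite !inE eqxx orbT.
exists ('i *: (e *m e ^t*)), ('i *: (f *m f ^t*)); split.
- by split; apply: skewherm_outer.
- by split; apply/comm_mxZ; apply: comm_skewherm_outer; eauto.
- move=> u; rewrite inE => /eqP->; rewrite -!scalemxAl.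
  by rewrite !outer0 ?scaler0 //; apply: orthC; [apply: fw|apply: ew]; rewrite !inE eqxx.
- move=> a b ab; have := congr1 (mulmx^~ e) ab; have := congr1 (mulmx^~ f) ab.
  rewrite !mulmxDl -!scalemxAl !outer1 // !outer0 ?(orthC fe) // !mul0mx !scaler0 add0r addr0.
  by move=> /(scalei_eq0 (unit_neq0 f1)) -> /(scalei_eq0 (unit_neq0 e1)) ->.
Qed.

(** A projection has trace 1, so differences of projections are used; two independent differences
    need three eigenvectors besides w. *)
Lemma sl_two_commuting m (x : 'M[C]_m) w : (3 < m)%N ->
  x ^t* = - x -> x *m w = 0 ->
  two_commuting (fun y => y ^t* = - y /\ \tr y = 0) [:: w] x.
Proof.
move=> m2 xs xw; have eigw : exists c, x *m w = c *: w by exists 0; rewrite scale0r.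
have [||e [c [e1 ew xe cs]]] := @skewherm_eigenvector m x xs [:: w].
- exact: ltnW (ltnW _).
- by move=> u; rewrite inE => /eqP->.
have [||f [d [f1 fw xf ds]]] := @skewherm_eigenvector m x xs [:: w; e].
- exact: ltnW.
- by move=> u; rewrite !inE => /orP[]/eqP-> //; exists c.
have [|g [b [g1 gw xg bs]]] := @skewherm_eigenvector m x xs [:: w; e; f] m2.
  by move=> u; rewrite !inE => /or3P[]/eqP-> //; [exists c|exists d].
have fe : e ^t* *m f = 0 by apply: fw; rewrite !inE eqxx orbT.
have ge : e ^t* *m g = 0 by apply: gw; rewrite !inE eqxx orbT.
have gf : f ^t* *m g = 0 by apply: gw; rewrite !inE eqxx !orbT.
have tr1 (u : 'cV[C]_m) : u ^t* *m u = 1%:M -> \tr (u *m u ^t*) = 1.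
  by move=> u1; rewrite mxtrace_mulC u1 mxtrace1.
have sk (u v : 'cV[C]_m) : ('i *: (u *m u ^t* - v *m v ^t*)) ^t* =
    - ('i *: (u *m u ^t* - v *m v ^t*)).
  by rewrite scalerBr trmxCD trmxCN !skewherm_outer opprK opprB addrC.
exists ('i *: (e *m e ^t* - f *m f ^t*)), ('i *: (e *m e ^t* - g *m g ^t*)); split.
- by split; split; rewrite ?sk // mxtraceZ linearB /= !tr1 // subrr mulr0.
- by split; apply/comm_mxZ/comm_mxB; apply: comm_skewherm_outer; eauto.
- move=> u; rewrite inE => /eqP->; rewrite -!scalemxAl !mulmxBl.
  by rewrite !outer0 ?subrr ?scaler0 //; apply: orthC;
     [apply: gw|apply: fw|apply: ew]; rewrite !inE eqxx.
- move=> a a' ab; have := congr1 (mulmx^~ f) ab; have := congr1 (mulmx^~ g) ab.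
  rewrite !mulmxDl -!scalemxAl !mulmxBl !outer1 // !(outer0 fe, outer0 ge, outer0 gf) ?(outer0 (orthC gf)) //.
  rewrite !mul0mx !sub0r !oppr0 !scaler0 add0r addr0 !scalerN -!scaleNr.
  move=> /(scalei_eq0 (unit_neq0 g1))/eqP + /(scalei_eq0 (unit_neq0 f1))/eqP.
  by rewrite !oppr_eq0 => /eqP-> /eqP->.
Qed.
End RankOne.

(** * Compact forms of so and sp, with and without scalars *)

Section FormAlgebras.
Variable C : numClosedFieldType.

Lemma lincomb_mulmx m n a b (y1 y2 : 'M[C]_m) (u : 'M[C]_(m, n)) :
  (a *: y1 + b *: y2) *m u = a *: (y1 *m u) + b *: (y2 *m u).
Proof. by rewrite mulmxDl -!scalemxAl. Qed.

Definition preserves_form m (B z : 'M[C]_m) : Prop := z^T *m B + B *m z = 0.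

Definition compact_form m (B y : 'M[C]_m) : Prop :=
  y ^t* = - y /\ preserves_form B y.

(** The scalar b is left arbitrary here; [compact_formCP] shows that skew-hermiticity makes it
    imaginary, so this is the compact form plus iR. *)
Definition compact_formC m (B y : 'M[C]_m) : Prop :=
  y ^t* = - y /\ exists b, preserves_form B (y - b%:M).

Section Form.
Variables (m : nat) (B : 'M[C]_m) (eps : C).
Hypotheses (Breal : map_mx Num.conj B = B) (BtB : B^T *m B = 1%:M).
Hypotheses (Bsym : B^T = eps *: B) (eps2 : eps * eps = 1).

Lemma form_BBt : B *m B^T = 1%:M. Proof. exact: mulmx1C. Qed.

(** The antilinear map commuting with the compact form. Its square is [eps]: a real structure for
    eps = 1, a quaternionic structure for eps = -1. *)
Definition formconj (u : 'cV[C]_m) : 'cV[C]_m := B^T *m map_mx Num.conj u.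

Lemma formconjZ c u : formconj (c *: u) = c^* *: formconj u.
Proof. by rewrite /formconj map_mxZ -scalemxAr. Qed.

Lemma formconjK u : formconj (formconj u) = eps *: u.
Proof.
rewrite /formconj map_mxM /= map_mxCK -map_trmx Breal mulmxA.
by rewrite {1}Bsym -scalemxAl form_BBt -scalemxAl mul1mx.
Qed.

Lemma formconj_adj u : (formconj u) ^t* = u^T *m B.
Proof. by rewrite trmxCM trmxK Breal map_trmx map_mxCK. Qed.

Lemma dot_formconj u v :
  (formconj u) ^t* *m formconj v = map_mx Num.conj (u ^t* *m v).
Proof.
rewrite formconj_adj mulmxA -[_ *m B *m B^T]mulmxA form_BBt mulmx1.
by rewrite map_mxM /= map_mxCK.
Qed.

Lemma orth_formconj u v : u ^t* *m formconj v = 0 -> (formconj u) ^t* *m v = 0.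
Proof.
move=> h; have := dot_formconj u (formconj v).
rewrite h map_mx0 formconjK -scalemxAr => /(congr1 ( *:%R eps)).
by rewrite scalerA eps2 scale1r scaler0.
Qed.

Lemma orth_formconj2 u v : u ^t* *m v = 0 -> (formconj u) ^t* *m formconj v = 0.
Proof. by move=> h; rewrite dot_formconj h map_mx0. Qed.

Lemma unit_formconj u : u ^t* *m u = 1%:M -> (formconj u) ^t* *m formconj u = 1%:M.
Proof. by move=> h; rewrite dot_formconj h map_mx1. Qed.

Lemma formconj_isotropic u : eps = - 1 -> u ^t* *m formconj u = 0.
Proof.
move=> eN; set s := _ *m _.
have sT : s^T = - s.
  rewrite /s /formconj -map_trmx; set w := map_mx _ u.
  rewrite !trmx_mul !trmxK Bsym eN scaleN1r mulNmx mulmxN opprK.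
  by rewrite mulmxA.
apply: mx11_ext; have /matrixP/(_ 0 0) := sT; rewrite !mxE => /eqP.
by rewrite -addr_eq0 -mulr2n mulrn_eq0 /= => /eqP.
Qed.

Lemma compact_form_formconj x u :
  compact_form B x -> x *m formconj u = formconj (x *m u).
Proof.
case=> xs xB; have xc : x^T = - map_mx Num.conj x.
  by rewrite -[x^T]map_mxCK xs map_mxN.
move: xB; rewrite /preserves_form xc mulNmx addrC => /eqP.
rewrite subr_eq0 => /eqP xB; rewrite /formconj map_mxM /= !mulmxA.
have -> // : x *m B^T = B^T *m map_mx Num.conj x.
rewrite -[x in LHS]mul1mx -BtB -[B^T *m B *m x]mulmxA xB -!mulmxA form_BBt.
by rewrite mulmx1.
Qed.

Lemma compact_form_eigen x u c :
  compact_form B x -> x *m u = c *: u -> x *m formconj u = c^* *: formconj u.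
Proof. by move=> hx xu; rewrite compact_form_formconj // xu formconjZ. Qed.

(** When e is a unit vector orthogonal to [formconj e], this acts as i on e, as -i on [formconj e]
    and as 0 on their complement: a generator of a circle in the compact form. *)
Definition rotation (e : 'cV[C]_m) : 'M[C]_m :=
  'i *: (e *m e ^t* - formconj e *m (formconj e) ^t*).

Lemma compact_form_rotation e : compact_form B (rotation e).
Proof.
split.
  by rewrite /rotation scalerBr trmxCD trmxCN !skewherm_outer opprK opprB addrC.
rewrite /preserves_form /rotation formconj_adj /formconj linearZ /= -scalemxAl -scalemxAr.
rewrite -scalerDr linearB /= mulmxBl mulmxBr !trmx_mul !trmxK.
have -> : B *m (B^T *m map_mx Num.conj e *m (e^T *m B)) = (map_mx Num.conj e *m e^T) *m B.
  by rewrite !mulmxA form_BBt mul1mx.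
have -> : B^T *m e *m ((map_mx Num.conj e)^T *m B) *m B = B *m (e *m e ^t*).
  rewrite map_trmx -!mulmxA [B *m B](_ : _ = eps%:M); last first.
    by rewrite -[LHS]scale1r -eps2 -scalerA scalemxAl -Bsym BtB scale_scalar_mx mulr1.
  by rewrite Bsym -scalemxAl mul_mx_scalar -!scalemxAr scalerA eps2 scale1r.
by rewrite map_trmx trmxK addrA subrK subrr scaler0.
Qed.

Lemma comm_rotation x e c : compact_form B x -> x *m e = c *: e -> c^* = - c ->
  comm_mx x (rotation e).
Proof.
move=> hx xe cs; have xf := compact_form_eigen hx xe.
apply: comm_mxZ; apply: comm_mxB.
  exact: (comm_skewherm_outer hx.1 xe cs).
by apply: (comm_skewherm_outer hx.1 xf); rewrite conjCK cs opprK.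
Qed.

Lemma rotation0 (e u : 'cV_m) : e ^t* *m u = 0 -> (formconj e) ^t* *m u = 0 ->
  rotation e *m u = 0.
Proof.
by move=> h1 h2; rewrite /rotation -scalemxAl mulmxBl !outer0 // subr0 scaler0.
Qed.

Lemma rotation1 (e : 'cV_m) : e ^t* *m e = 1%:M -> (formconj e) ^t* *m e = 0 ->
  rotation e *m e = 'i *: e.
Proof.
move=> e1 h; rewrite /rotation -scalemxAl mulmxBl outer1 //.
by rewrite outer0 // subr0.
Qed.

Lemma rotation_formconj (e : 'cV_m) : e ^t* *m e = 1%:M -> e ^t* *m formconj e = 0 ->
  rotation e *m formconj e = - ('i *: formconj e).
Proof.
move=> e1 h; rewrite /rotation -scalemxAl mulmxBl outer0 //.
by rewrite outer1 ?unit_formconj // sub0r scalerN.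
Qed.

Lemma preserves_form_tr z : preserves_form B z -> \tr z = 0.
Proof.
move=> h; have e : \tr z = - \tr z.
  rewrite -[z in LHS]mul1mx -BtB -mulmxA.
  have -> : B *m z = - (z^T *m B) by apply/eqP; rewrite -addr_eq0 addrC; apply/eqP.
  by rewrite mulmxN linearN /= mxtrace_mulC -mulmxA form_BBt mulmx1 mxtrace_tr.
by apply/eqP; move/eqP: e; rewrite -addr_eq0 -mulr2n mulrn_eq0 /= => /eqP ->.
Qed.

(** Elements preserving B are traceless, so tr y = m b; the trace of a skew-hermitian matrix is
    imaginary, and hence so is b. *)
Lemma compact_formCP y : (0 < m)%N -> compact_formC B y ->
  exists z b, [/\ compact_form B z, b^* = - b & y = z + b%:M].
Proof.
move=> m0 [ys [b h]]; exists (y - b%:M), b.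
have bs : b^* = - b.
  have tre : \tr y = b *+ m.
    by have := preserves_form_tr h; rewrite linearB /= mxtrace_scalar => /eqP;
       rewrite subr_eq0 => /eqP.
  have : (\tr y)^* = - \tr y.
    rewrite -[RHS]linearN /= -ys -map_trmx /mxtrace rmorph_sum /=.
    by apply: eq_bigr => i _; rewrite !mxE.
  rewrite tre rmorphMn /= -mulNrn => /eqP.
  by rewrite -subr_eq0 -mulrnBl mulrn_eq0 eqn0Ngt m0 /= subr_eq0 => /eqP.
split=> //; last by rewrite subrK.
by split=> //; rewrite trmxCD trmxCN ys tr_scalar_mx map_scalar_mx /= bs rmorphN /= opprB opprK addrC.
Qed.

Lemma compact_formC_add z b : compact_form B z -> b^* = - b ->
  compact_formC B (z + b%:M).
Proof.
move=> [zs zB] bs; split; last by exists b; rewrite addrK.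
by rewrite trmxCD zs tr_scalar_mx map_scalar_mx /= bs rmorphN /= opprD.
Qed.

Section Symplectic.
Hypothesis epsN : eps = - 1.

(** The eigenvector is taken orthogonal to [K] and to its image under [formconj], which consists of
    eigenvectors too. This doubles the cost in dimension but makes the rotation at e kill all of
    these vectors. *)
Lemma symplectic_eigenvector x K : compact_form B x ->
  (size K + size K < m)%N -> {in K, forall u, exists c, x *m u = c *: u} ->
  exists (e : 'cV_m) c, [/\ e ^t* *m e = 1%:M,
    {in K, forall u, rotation e *m u = 0 /\ rotation e *m formconj u = 0},
    {in K, forall u, u ^t* *m e = 0 /\ u ^t* *m formconj e = 0},
    x *m e = c *: e & c^* = - c].
Proof.
move=> hx Km eig.
have [||e [c [e1 eK xe cs]]] :=
  @skewherm_eigenvector C m x hx.1 (K ++ map formconj K).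
- by rewrite size_cat size_map.
- move=> u; rewrite mem_cat => /orP[/eig //|/mapP[v /eig[c xv] ->]].
  by exists c^*; apply: compact_form_eigen.
have o1 u : u \in K -> u ^t* *m e = 0 by move=> uK; rewrite eK // mem_cat uK.
have o2 u : u \in K -> (formconj u) ^t* *m e = 0.
  by move=> uK; rewrite eK // mem_cat map_f ?orbT.
have o3 u : u \in K -> u ^t* *m formconj e = 0.
  move=> uK; apply: orthC; apply: orth_formconj; apply: orthC; exact: o2.
exists e, c; split=> // u uK; split; try by [apply: o1|apply: o3].
  by apply: rotation0; apply: orthC; [apply: o1|apply: o3].
apply: rotation0; first by apply: orthC; apply: o2.
by apply: orthC; apply: orth_formconj2; apply: o1.
Qed.

(** Rotations in two quaternionic lines that are orthogonal to each other and to that of w. The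
    second line must avoid w, e and their images, four vectors in all. *)
Lemma sp_two_commuting x w : (4 < m)%N -> compact_form B x -> x *m w = 0 ->
  two_commuting (compact_form B) [:: w] x.
Proof.
move=> m4 hx xw; have eigw : exists c, x *m w = c *: w by exists 0; rewrite scale0r.
have [||e [c [e1 ew _ xe cs]]] := @symplectic_eigenvector x [:: w] hx.
- exact: ltnW (ltnW _).
- by move=> u; rewrite inE => /eqP->.
have [||f [d [f1 fw ef xf ds]]] := @symplectic_eigenvector x [:: w; e] hx.
- exact: m4.
- by move=> u; rewrite !inE => /orP[]/eqP-> //; exists c.
have [|fe _] := fw e; first by rewrite !inE eqxx orbT.
exists (rotation e), (rotation f); split.
- by split; apply: compact_form_rotation.
- by split; [apply: comm_rotation xe cs|apply: comm_rotation xf ds].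
- move=> u; rewrite inE => /eqP->.
  have [-> _] := ew w (mem_head _ _); by have [-> _] := fw w (mem_head _ _).
have iso u : (formconj u) ^t* *m u = 0 by apply: orthC; apply: formconj_isotropic.
move=> a b ab; have a0 : a = 0.
  have := congr1 (mulmx^~ e) ab.
  rewrite lincomb_mulmx fe rotation1 // scaler0 addr0 mul0mx.
  exact: scalei_eq0 (unit_neq0 e1).
split=> //; have := congr1 (mulmx^~ f) ab.
rewrite lincomb_mulmx a0 scale0r add0r rotation1 // mul0mx.
exact: scalei_eq0 (unit_neq0 f1).
Qed.

(* For w <> 0 the second element is the rotation in the quaternionic line of w
   followed by a scalar that brings its value at w back to 0. *)
Lemma spC_two_commuting x w : (2 < m)%N -> compact_formC B x -> x *m w = 0 ->
  two_commuting (compact_formC B) [:: w] x.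
Proof.
move=> m2 hx xw.
have [z [b [hz bs xE]]] := compact_formCP (ltnW (ltnW m2)) hx.
have zw : z *m w = - b *: w.
  by apply/eqP; rewrite scaleNr -addr_eq0 -mul_scalar_mx -mulmxDl -xE; apply/eqP.
have [|e [c [e1 ew we ze cs]]] := @symplectic_eigenvector z [:: w] hz m2.
  by move=> u; rewrite inE => /eqP->; exists (- b).
have [ew0 _] := ew w (mem_head _ _).
have [we0 we1] := we w (mem_head _ _).
have iso u : (formconj u) ^t* *m u = 0 by apply: orthC; apply: formconj_isotropic.
have [y [hy yz yw ye yf]] : exists y, [/\ compact_form B y, comm_mx z y,
    y *m w = 'i *: w, y *m e = 0 & y *m formconj e = 0].
  have [->|w0] := eqVneq w 0.
    exists 0; split; rewrite ?mulmx0 ?mul0mx ?scaler0 //.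
    - by split; rewrite /preserves_form ?trmx0 ?map_mx0 ?oppr0 // mul0mx mulmx0 addr0.
    - exact: comm_mx0.
  have [s [u [s0 wE u1]]] := unit_vector w0.
  have uE : u = s^-1 *: w by rewrite wE scalerA mulVf ?scale1r ?gt_eqF.
  have ue : u ^t* *m e = 0 by rewrite uE trmxCZ -scalemxAl we0 scaler0.
  have ue1 : u ^t* *m formconj e = 0 by rewrite uE trmxCZ -scalemxAl we1 scaler0.
  exists (rotation u); split.
  - exact: compact_form_rotation.
  - apply: (comm_rotation hz (c := - b)); last by rewrite rmorphN /= bs.
    by rewrite uE -scalemxAr zw !scalerA mulrC.
  - by rewrite wE -scalemxAr rotation1 // !scalerA mulrC.
  - apply: rotation0 => //; apply: orthC; apply: orthC; exact: orth_formconj.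
  - by apply: rotation0 => //; apply: orth_formconj2.
exists (rotation e), (y - 'i%:M); split.
- split; last by rewrite -raddfN; apply: compact_formC_add; rewrite // rmorphN /= conjCi.
  by rewrite -[rotation e]addr0 -(raddf0 (@scalar_mx C m)); apply: compact_formC_add;
     rewrite ?rmorph0 ?oppr0 //; apply: compact_form_rotation.
- have cx v : comm_mx z v -> comm_mx x v.
    by rewrite xE => h; apply: comm_mx_sym; apply: comm_mxD; [apply: comm_mx_sym|apply: comm_mx_scalar].
  split; apply: cx; first exact: comm_rotation ze cs.
  by apply: comm_mxB => //; apply: comm_mx_scalar.
- move=> v; rewrite inE => /eqP->; split=> //.
  by rewrite mulmxBl yw mul_scalar_mx subrr.
(* On e and [formconj e] the first element has eigenvalues i and -i, the second has -i on both; this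
   yields a - d = 0 and a + d = 0. *)
move=> a d ad; have f1 := unit_formconj e1.
have := congr1 (mulmx^~ e) ad; have := congr1 (mulmx^~ (formconj e)) ad.
rewrite !lincomb_mulmx !mulmxDl ye yf !mulNmx !mul_scalar_mx !mul0mx !add0r.
rewrite rotation1 // rotation_formconj //; last exact: formconj_isotropic.
rewrite !scalerN -!opprD -scalerDl => /eqP; rewrite oppr_eq0 => /eqP.
move=> /(scalei_eq0 (unit_neq0 f1)) ad0.
rewrite -scalerBl => /(scalei_eq0 (unit_neq0 e1)) ad1.
have a0 : a = 0.
  apply/eqP; have := congr2 +%R ad0 ad1; rewrite addr0 addrACA subrr addr0 => /eqP.
  by rewrite -mulr2n mulrn_eq0.
by split=> //; move: ad0; rewrite a0 add0r.
Qed.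
End Symplectic.
End Form.
End FormAlgebras.

(** * Commuting pairs in the real orthogonal algebra *)

Section Orthogonal.
Variables (C : numClosedFieldType) (m : nat).
Local Notation I := (1%:M : 'M[C]_m).
Local Notation conjmx := (map_mx Num.conj).

Lemma form1_real : conjmx I = I. Proof. by rewrite map_mx1. Qed.
Lemma form1_orth : I^T *m I = 1%:M. Proof. by rewrite trmx1 mulmx1. Qed.
Lemma form1_sym : I^T = 1 *: I. Proof. by rewrite trmx1 scale1r. Qed.

Lemma so_rotation (e : 'cV_m) : compact_form I (rotation I e).
Proof. exact: compact_form_rotation form1_real form1_orth form1_sym (mulr1 1) e. Qed.

Lemma formconj1 (u : 'cV_m) : formconj I u = conjmx u.
Proof. by rewrite /formconj trmx1 mul1mx. Qed.

Lemma compact_form1P z : compact_form I z <-> conjmx z = z /\ z^T = - z.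
Proof.
rewrite /compact_form /preserves_form mul1mx mulmx1; split.
  move=> [zs /eqP]; rewrite addr_eq0 => /eqP zT; split=> //.
  by move: zs; rewrite zT map_mxN => /oppr_inj.
by move=> [zc zT]; rewrite zT map_mxN zc addNr.
Qed.

Lemma conj_eigen x (e : 'cV_m) c : compact_form I x -> x *m e = c *: e ->
  x *m conjmx e = c^* *: conjmx e.
Proof.
by move=> hx /(compact_form_eigen form1_orth hx); rewrite formconj1.
Qed.

(** The conjugate of e has eigenvalue c^* = -c, which differs from c, and eigenvectors of a
    skew-hermitian matrix for distinct eigenvalues are orthogonal. *)
Lemma isotropic_eigenvector x (e : 'cV_m) c : compact_form I x ->
  x *m e = c *: e -> c^* = - c -> c != 0 -> (conjmx e) ^t* *m e = 0.
Proof.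
move=> hx xe cs c0; have xf := conj_eigen hx xe; set s := _ *m _.
have : c *: s = - (c *: s).
  have h : (conjmx e) ^t* *m x = - (c *: (conjmx e) ^t*).
    by rewrite -[x]trmxCK -trmxCM hx.1 mulNmx xf trmxCN trmxCZ conjCK.
  by rewrite [LHS]scalemxAr -xe [LHS]mulmxA h mulNmx -scalemxAl.
move=> /eqP; rewrite -addr_eq0 -mulr2n -scaler_nat scalerA scaler_eq0 mulf_eq0.
by rewrite pnatr_eq0 (negPf c0) /= => /eqP.
Qed.

Lemma conj_orth (u v : 'cV[C]_m) : (conjmx u) ^t* *m v = 0 -> u ^t* *m conjmx v = 0.
Proof.
move=> /(congr1 conjmx); rewrite map_mx0 map_mxM /= => <-.
by rewrite map_trmx map_mxCK.
Qed.

(** The infinitesimal rotation in the plane of two real vectors. It replaces [rotation] inside the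
    kernel of x, where eigenvectors need not be orthogonal to their conjugates. *)
Definition wedge (l1 l2 : 'cV[C]_m) : 'M[C]_m := l1 *m l2^T - l2 *m l1^T.

Lemma compact_form_wedge l1 l2 : conjmx l1 = l1 -> conjmx l2 = l2 ->
  compact_form I (wedge l1 l2).
Proof.
move=> r1 r2; apply/compact_form1P; rewrite /wedge; split.
  by rewrite map_mxB !map_mxM /= -!map_trmx r1 r2.
by rewrite linearB /= !trmx_mul !trmxK opprB.
Qed.

Lemma comm_wedge x l1 l2 : compact_form I x -> x *m l1 = 0 -> x *m l2 = 0 ->
  comm_mx x (wedge l1 l2).
Proof.
move=> /compact_form1P[_ xT] x1 x2.
have t (l : 'cV_m) : x *m l = 0 -> l^T *m x = 0.
  by move=> xl; rewrite -[x]trmxK -trmx_mul xT mulNmx xl oppr0 trmx0.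
by rewrite /comm_mx /wedge mulmxBl mulmxBr !mulmxA x1 x2 -!mulmxA !t // !mul0mx !mulmx0.
Qed.

Lemma wedge0 (l1 l2 u : 'cV_m) : conjmx l1 = l1 -> conjmx l2 = l2 ->
  l1 ^t* *m u = 0 -> l2 ^t* *m u = 0 -> wedge l1 l2 *m u = 0.
Proof.
rewrite -!map_trmx => -> -> h1 h2.
by rewrite /wedge mulmxBl -!mulmxA h1 h2 !mulmx0 subrr.
Qed.

Lemma wedge_l (l1 l2 : 'cV_m) : conjmx l1 = l1 -> conjmx l2 = l2 ->
  l1 ^t* *m l2 = 0 -> wedge l1 l2 *m l2 = (l2 ^t* *m l2) 0 0 *: l1.
Proof.
rewrite -!map_trmx => -> -> h1; rewrite /wedge mulmxBl -!mulmxA h1 mulmx0 subr0.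
by rewrite [l2^T *m l2]mx11_scalar mul_mx_scalar -mx11_scalar.
Qed.

Section Commutant.
Variable x : 'M[C]_m.
Hypothesis hx : compact_form I x.

(** Closure under conjugation makes the complement of [K] conjugation-stable, so that real vectors
    and rotation planes can be found in it. *)
Definition stable_system (K : seq 'cV[C]_m) : Prop :=
  {in K, forall u, exists c, x *m u = c *: u} /\ {in K, forall u, conjmx u \in K}.

(** The kernel of the real matrix x is stable under conjugation: take e + conj e, or i e when this
    sum vanishes. *)
Lemma real_kernel K (e : 'cV_m) : stable_system K -> e != 0 -> x *m e = 0 ->
  {in K, forall u, u ^t* *m e = 0} ->
  exists l : 'cV_m, [/\ conjmx l = l, l != 0, x *m l = 0 & {in K, forall u, u ^t* *m l = 0}].
Proof.
move=> [_ Kc] e0 xe eK.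
have xf : x *m conjmx e = 0.
  have := @conj_eigen x e 0 hx; rewrite scale0r xe => /(_ erefl) ->.
  by rewrite rmorph0 scale0r.
have fK u : u \in K -> u ^t* *m conjmx e = 0.
  by move=> uK; apply: conj_orth; apply: eK; apply: Kc.
have [s0|s0] := eqVneq (e + conjmx e) 0.
  exists ('i *: e); split.
  - rewrite map_mxZ /= conjCi; have -> : conjmx e = - e.
      by apply/eqP; rewrite -addr_eq0 addrC s0.
    by rewrite scalerN scaleNr opprK.
  - by rewrite scaler_eq0 (negPf (neq0Ci C)).
  - by rewrite -scalemxAr xe scaler0.
  - by move=> u uK; rewrite -scalemxAr eK ?scaler0.
exists (e + conjmx e); split=> //.
- by rewrite map_mxD map_mxCK addrC.
- by rewrite mulmxDr xe xf addr0.
- by move=> u uK; rewrite mulmxDr eK ?fK ?addr0.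
Qed.

Lemma stable_system_kernel K l : stable_system K -> conjmx l = l -> x *m l = 0 ->
  stable_system (l :: K).
Proof.
move=> [K1 K2] lr xl; split=> u; rewrite !inE => /orP[/eqP->|uK].
- by exists 0; rewrite scale0r.
- exact: K1.
- by rewrite lr eqxx.
- by rewrite K2 ?orbT.
Qed.

Lemma rotation_kills K (e : 'cV_m) : stable_system K ->
  {in K, forall u, u ^t* *m e = 0} -> {in K, forall u, rotation I e *m u = 0}.
Proof.
move=> [_ Kc] eK u uK; apply: rotation0; first by apply: orthC; apply: eK.
by rewrite formconj1; apply: orthC; apply: conj_orth; apply: eK; apply: Kc.
Qed.

(** Off [K] every eigenvalue is nonzero, so each eigenvector is orthogonal to its conjugate and
    spans a rotation plane with it. The second one must avoid [K], e and conj e, whence the + 2. *)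
Lemma nonkernel_two_commuting K : stable_system K -> (size K + 2 < m)%N ->
  (forall e : 'cV_m, e != 0 -> {in K, forall u, u ^t* *m e = 0} -> x *m e <> 0) ->
  two_commuting (compact_form I) K x.
Proof.
move=> KS Km nk.
have [||e [c [e1 eK xe cs]]] := @skewherm_eigenvector C m x hx.1 K.
- by rewrite (leq_ltn_trans _ Km) // leq_addr.
- exact: KS.1.
have c0 : c != 0.
  apply/eqP => c0; apply: (nk e _ eK); first exact: unit_neq0.
  by rewrite xe c0 scale0r.
have e2 := isotropic_eigenvector hx xe cs c0.
have [||f [d [f1 fK xf ds]]] := @skewherm_eigenvector C m x hx.1 (e :: conjmx e :: K).
- by rewrite /= -addn2.
- move=> u; rewrite !inE => /or3P[/eqP->|/eqP->|uK]; [by exists c| |exact: KS.1].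
  by exists (c^*); apply: conj_eigen.
have fK' : {in K, forall u, u ^t* *m f = 0}.
  by move=> u uK; apply: fK; rewrite !inE uK !orbT.
have d0 : d != 0.
  apply/eqP => d0; apply: (nk f _ fK'); first exact: unit_neq0.
  by rewrite xf d0 scale0r.
have f2 := isotropic_eigenvector hx xf ds d0.
exists (rotation I e), (rotation I f); split.
- by split; apply: so_rotation.
- by split; [apply: (comm_rotation form1_orth hx xe cs)|apply: (comm_rotation form1_orth hx xf ds)].
- by move=> u uK; rewrite !(rotation_kills KS).
have fe : rotation I f *m e = 0.
  apply: rotation0; first by apply: orthC; apply: fK; rewrite !inE eqxx.
  rewrite formconj1; apply: orthC; apply: conj_orth.
  by apply: fK; rewrite !inE eqxx orbT.
move=> a b ab; have a0 : a = 0.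
  have := congr1 (mulmx^~ e) ab.
  rewrite lincomb_mulmx fe rotation1 ?formconj1 // scaler0 addr0 mul0mx.
  exact: scalei_eq0 (unit_neq0 e1).
split=> //; have := congr1 (mulmx^~ f) ab.
rewrite lincomb_mulmx a0 scale0r add0r rotation1 ?formconj1 // mul0mx.
exact: scalei_eq0 (unit_neq0 f1).
Qed.

(* Either x is nondegenerate off a few kernel vectors, or there are enough
   real kernel vectors to build the second element by hand. *)
Lemma so_two_commuting K : stable_system K -> (size K + 3 < m)%N ->
  two_commuting (compact_form I) K x.
Proof.
move=> KS Km.
pose kernel (K' : seq 'cV[C]_m) (e : 'cV_m) := [/\ e != 0, {in K', forall u, u ^t* *m e = 0} & x *m e = 0].
have realk K' : stable_system K' -> (exists e, kernel K' e) -> exists l : 'cV_m,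
    [/\ conjmx l = l, l != 0, x *m l = 0 & {in K', forall u, u ^t* *m l = 0}].
  by move=> K'S [e [e0 eK xe]]; apply: real_kernel xe eK.
have nokernel K' : stable_system K' -> (size K' + 2 < m)%N ->
    ~ (exists e, kernel K' e) -> two_commuting (compact_form I) K' x.
  move=> K'S K'm nk; apply: nonkernel_two_commuting => // e e0 eK xe.
  by apply: nk; exists e.
have nn (l : 'cV[C]_m) : l != 0 -> (l ^t* *m l) 0 0 != 0.
  by move=> l0; rewrite gt_eqF // sqnorm_gt0.
have sc a (l l' : 'cV[C]_m) : l != 0 -> l' != 0 ->
    a *: ((l' ^t* *m l') 0 0 *: l) = 0 -> a = 0.
  move=> l0 l'0 /eqP; rewrite scalerA scaler_eq0 (negPf l0) orbF mulf_eq0.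
  by rewrite (negPf (nn _ l'0)) orbF => /eqP.
have [/(realk _ KS)[l1 [r1 n1 x1 o1]]|] := pselect (exists e, kernel K e); last first.
  apply: nokernel => //; apply: leq_ltn_trans Km; by rewrite leq_add2l.
have K1S := stable_system_kernel KS r1 x1.
(* If l1 exhausts the kernel off [K], adjoining it to [K] restores the nondegenerate case. The extra
   vector accounts for the bound with 3 instead of 2. *)
have [/(realk _ K1S)[l2 [r2 n2 x2 o2]]|nk] := pselect (exists e, kernel (l1 :: K) e); last first.
  have [|y1 [y2 [? ? kill ?]]] := nokernel _ K1S _ nk; first by rewrite /= addSnnS.
  by exists y1, y2; split=> // u uK; apply: kill; rewrite inE uK orbT.
have K2S := stable_system_kernel K1S r2 x2.
have o21 : l1 ^t* *m l2 = 0 by apply: o2; rewrite inE eqxx.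
have o2K u : u \in K -> l2 ^t* *m u = 0.
  by move=> uK; apply: orthC; apply: o2; rewrite inE uK orbT.
have o1K u : u \in K -> l1 ^t* *m u = 0 by move=> uK; apply: orthC; apply: o1.
have [||e [c [e1 eK xe cs]]] := @skewherm_eigenvector C m x hx.1 [:: l2, l1 & K].
- by rewrite /= -addn2 (leq_ltn_trans _ Km) // leq_add2l.
- exact: K2S.1.
have oe1 : l1 ^t* *m e = 0 by apply: eK; rewrite !inE eqxx orbT.
have oe2 : l2 ^t* *m e = 0 by apply: eK; rewrite !inE eqxx.
have oeK : {in K, forall u, u ^t* *m e = 0}.
  by move=> u uK; apply: eK; rewrite !inE uK !orbT.
(* Real kernel vectors l1 and l2 are at hand. A nonzero eigenvalue gives a rotation to go with
   [wedge l1 l2]; a zero one gives a third real kernel vector l3, and [wedge l1 l3] is the second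
   element. *)
have [c0|c0] := eqVneq c 0; last first.
  have e2 := isotropic_eigenvector hx xe cs c0.
  exists (rotation I e), (wedge l1 l2); split.
  - by split; [apply: so_rotation|apply: compact_form_wedge].
  - by split; [apply: (comm_rotation form1_orth hx xe cs)|apply: comm_wedge].
  - by move=> u uK; rewrite (rotation_kills KS) // wedge0 ?o1K ?o2K.
  move=> a b ab; have a0 : a = 0.
    have := congr1 (mulmx^~ e) ab; rewrite lincomb_mulmx wedge0 // rotation1 ?formconj1 //.
    by rewrite scaler0 addr0 mul0mx; apply: scalei_eq0 (unit_neq0 e1).
  split=> //; have := congr1 (mulmx^~ l2) ab.
  rewrite lincomb_mulmx a0 scale0r add0r wedge_l // mul0mx; exact: sc.
have [|l3 [r3 n3 x3 o3]] := realk _ K2S.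
  exists e; split=> //; first exact: unit_neq0.
  by rewrite xe c0 scale0r.
have o31 : l1 ^t* *m l3 = 0 by apply: o3; rewrite !inE eqxx orbT.
have o32 : l2 ^t* *m l3 = 0 by apply: o3; rewrite !inE eqxx.
have o3K u : u \in K -> l3 ^t* *m u = 0.
  by move=> uK; apply: orthC; apply: o3; rewrite !inE uK !orbT.
exists (wedge l1 l2), (wedge l1 l3); split.
- by split; apply: compact_form_wedge.
- by split; apply: comm_wedge.
- by move=> u uK; rewrite !wedge0 ?o1K ?o2K ?o3K.
move=> a b ab; split.
  have := congr1 (mulmx^~ l2) ab.
  rewrite lincomb_mulmx wedge_l // wedge0 ?(orthC o32) // scaler0 addr0 mul0mx.
  exact: sc.
have := congr1 (mulmx^~ l3) ab.
rewrite lincomb_mulmx [wedge l1 l3 *m _]wedge_l // wedge0 // scaler0 add0r mul0mx.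
exact: sc.
Qed.
End Commutant.

(** For the orthogonal part z of x, the vector w is an eigenvector with eigenvalue -b, possibly
    nonzero, so conj w has to be adjoined. Elements of so_m killing both suffice, and 2 + 3 < m is
    the bound. *)
Lemma soC_two_commuting x (w : 'cV_m) : (5 < m)%N -> compact_formC I x ->
  x *m w = 0 -> two_commuting (compact_formC I) [:: w] x.
Proof.
move=> m5 hx xw; have m0 : (0 < m)%N by case: (m) m5.
have [z [b [hz bs xE]]] := compact_formCP form1_orth m0 hx.
have zw : z *m w = - b *: w.
  by apply/eqP; rewrite scaleNr -addr_eq0 -mul_scalar_mx -mulmxDl -xE; apply/eqP.
have KS : stable_system z [:: w; conjmx w].
  split=> u; rewrite !inE => /orP[]/eqP->.
  - by exists (- b).
  - by exists (- b)^*; apply: conj_eigen.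
  - by rewrite eqxx orbT.
  - by rewrite map_mxCK eqxx.
have [y1 [y2 [[h1 h2] [c1 c2] kill indep]]] := so_two_commuting hz KS m5.
have inC y : compact_form I y -> compact_formC I y.
  move=> hy; rewrite -[y]addr0 -(raddf0 (@scalar_mx C m)).
  by apply: compact_formC_add; rewrite ?rmorph0 ?oppr0.
have cx y : comm_mx z y -> comm_mx x y.
  rewrite xE => h; apply: comm_mx_sym; apply: comm_mxD; first exact: comm_mx_sym.
  exact: comm_mx_scalar.
exists y1, y2; split=> //; first by split; apply: inC.
  by split; apply: cx.
by move=> u; rewrite inE => /eqP->; apply: kill; rewrite inE eqxx.
Qed.
End Orthogonal.

(** * Explicit vectors with stabilizers of rank one *)

Section Positive.
Variable C : numClosedFieldType.

Lemma imaginary_divi (c : C) : c^* = - c -> c / 'i \is Num.real.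
Proof.
move=> cs; apply/CrealP; rewrite rmorphM fmorphV /= conjCi cs.
by rewrite invrN mulrNN.
Qed.

Lemma skewherm_entry m (y : 'M[C]_m) i j : y ^t* = - y -> y j i = - (y i j)^*.
Proof. by move/matrixP/(_ j i); rewrite !mxE => ->; rewrite opprK. Qed.

Lemma skewherm_diag m (y : 'M[C]_m) i : y ^t* = - y -> (y i i)^* = - y i i.
Proof. by move=> ys; rewrite [y i i in RHS](skewherm_entry i i ys) opprK. Qed.

Lemma comm_diag_entry m (d : 'rV[C]_m) y i j : diag_mx d *m y = y *m diag_mx d ->
  d 0 i != d 0 j -> y i j = 0.
Proof.
move=> /matrixP/(_ i j); rewrite mul_diag_mx mul_mx_diag !mxE => /eqP.
rewrite [y i j * _]mulrC -subr_eq0 -mulrBl mulf_eq0 subr_eq0.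
by case/orP=> [->|/eqP].
Qed.

Lemma mulmx_delta_col m (y : 'M[C]_m) i j : (y *m delta_mx j 0 : 'cV_m) i 0 = y i j.
Proof. by rewrite -colE mxE. Qed.

Lemma diag_skewherm m (d : 'rV[C]_m) : (forall i, (d 0 i)^* = - d 0 i) ->
  (diag_mx d) ^t* = - diag_mx d.
Proof.
move=> ds; rewrite tr_diag_mx map_diag_mx -linearN /=; congr diag_mx.
by apply/rowP => i; rewrite !mxE ds.
Qed.

Lemma neq0Nii : 'i != - 'i :> C.
Proof. by rewrite -addr_eq0 -mulr2n mulrn_eq0 /= (negPf (neq0Ci C)). Qed.

(** The stabilizer of the first basis vector is su_2 on the other two coordinates, and x = diag(0,
    i, -i) spans a torus of it. *)
Lemma sl3_rank_one : exists w, rank_one_at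
  (fun y : 'M[C]_3 => y ^t* = - y /\ \tr y = 0) w.
Proof.
pose i0 : 'I_3 := @Ordinal 3 0 isT; pose i1 : 'I_3 := @Ordinal 3 1 isT.
pose i2 : 'I_3 := @Ordinal 3 2 isT.
have all3 (P : 'I_3 -> Prop) : P i0 -> P i1 -> P i2 -> forall i, P i.
  move=> p0 p1 p2 [[|[|[|//]]] h].
  - by rewrite (_ : Ordinal h = i0) //; apply: val_inj.
  - by rewrite (_ : Ordinal h = i1) //; apply: val_inj.
  - by rewrite (_ : Ordinal h = i2) //; apply: val_inj.
pose d : 'rV[C]_3 := \row_i (if i == i1 then 'i else if i == i2 then - 'i else 0).
have d0 : d 0 i0 = 0 by rewrite mxE.
have d1 : d 0 i1 = 'i by rewrite mxE.
have d2 : d 0 i2 = - 'i by rewrite mxE.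
have i0' := neq0Ci C; have tr3 (y : 'M[C]_3) : \tr y = y i0 i0 + y i1 i1 + y i2 i2.
  rewrite /mxtrace !big_ord_recl big_ord0 addr0 addrA.
  by do !congr (_ + _); congr (y _ _); apply: val_inj.
exists (delta_mx i0 0), (diag_mx d); split.
- split.
    apply: diag_skewherm; apply: (all3 _); rewrite ?d0 ?d1 ?d2 ?rmorphN /= ?conjCi //.
    by rewrite rmorph0 oppr0.
  by rewrite tr3 !mxE /= !mulr1n add0r subrr.
- by apply/eqP => /matrixP/(_ i1 i1); rewrite !mxE /= mulr1n => /eqP; rewrite (negPf i0').
- apply/colP; apply: (all3 _); rewrite mulmx_delta_col !mxE /= ?mulr0n //.
- move=> y [ys ty] yw yx.
  have y0 i : y i i0 = 0 by rewrite -mulmx_delta_col yw mxE.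
  have y0' i : y i0 i = 0 by rewrite (skewherm_entry i i0 ys) y0 rmorph0 oppr0.
  have y12 : y i1 i2 = 0 by apply: (comm_diag_entry yx); rewrite d1 d2 neq0Nii.
  have y21 : y i2 i1 = 0 by rewrite (skewherm_entry i1 i2 ys) y12 rmorph0 oppr0.
  have y22 : y i2 i2 = - y i1 i1.
    by apply/eqP; rewrite -addr_eq0 addrC; move: ty; rewrite tr3 y0 add0r => ->.
  exists (y i1 i1 / 'i); first by apply: imaginary_divi; apply: skewherm_diag.
  apply/matrixP; apply: (all3 _) => [j|j|j].
  - by rewrite y0'; move: j; apply: (all3 _); rewrite !mxE /= ?mulr0n ?mulr0.
  - move: j; apply: (all3 _); rewrite ?y0 ?y12 !mxE /= ?mulr0n ?mulr1n ?mulr0 //.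
    by rewrite divfK.
  - move: j; apply: (all3 _); rewrite ?y0 ?y21 ?y22 !mxE /= ?mulr0n ?mulr1n ?mulr0 //.
    by rewrite mulrN divfK.
Qed.

Lemma gl2_rank_one : exists w, rank_one_at (fun y : 'M[C]_2 => y ^t* = - y) w.
Proof.
pose i0 : 'I_2 := @Ordinal 2 0 isT; pose i1 : 'I_2 := @Ordinal 2 1 isT.
have all2 (P : 'I_2 -> Prop) : P i0 -> P i1 -> forall i, P i.
  move=> p0 p1 [[|[|//]] h].
  - by rewrite (_ : Ordinal h = i0) //; apply: val_inj.
  - by rewrite (_ : Ordinal h = i1) //; apply: val_inj.
pose x : 'M[C]_2 := 'i *: delta_mx i1 i1.
exists (delta_mx i0 0), x; split.
- by rewrite trmxCZ trmx_delta map_delta_mx conjCi scaleNr.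
- by apply/eqP => /matrixP/(_ i1 i1); rewrite !mxE /= mulr1 => /eqP; rewrite (negPf (neq0Ci C)).
- by apply/colP; apply: (all2 _); rewrite mulmx_delta_col !mxE /= ?mulr0.
- move=> y ys yw _.
  have y0 i : y i i0 = 0 by rewrite -mulmx_delta_col yw mxE.
  have y0' i : y i0 i = 0 by rewrite (skewherm_entry i i0 ys) y0 rmorph0 oppr0.
  exists (y i1 i1 / 'i); first by apply: imaginary_divi; apply: skewherm_diag.
  apply/matrixP; apply: (all2 _) => [j|].
    by rewrite y0' !mxE /= !mulr0.
  by apply: (all2 _); rewrite ?y0 !mxE /= ?mulr0 // mulr1 divfK // neq0Ci.
Qed.

(** At a real basis vector the scalar part must vanish, because a real skew matrix has zero
    diagonal; the stabilizer is then so_2 on the remaining plane. *)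
Lemma so3C_rank_one : exists w, rank_one_at (compact_formC (1%:M : 'M[C]_3)) w.
Proof.
pose i0 : 'I_3 := @Ordinal 3 0 isT; pose i1 : 'I_3 := @Ordinal 3 1 isT.
pose i2 : 'I_3 := @Ordinal 3 2 isT.
have all3 (P : 'I_3 -> Prop) : P i0 -> P i1 -> P i2 -> forall i, P i.
  move=> p0 p1 p2 [[|[|[|//]]] h].
  - by rewrite (_ : Ordinal h = i0) //; apply: val_inj.
  - by rewrite (_ : Ordinal h = i1) //; apply: val_inj.
  - by rewrite (_ : Ordinal h = i2) //; apply: val_inj.
pose x : 'M[C]_3 := delta_mx i1 i2 - delta_mx i2 i1.
exists (delta_mx i0 0), x; split.
- rewrite -[x]addr0 -(raddf0 (@scalar_mx C 3)).
  apply: compact_formC_add; last by rewrite rmorph0 oppr0.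
  apply/compact_form1P; rewrite /x; split.
    by rewrite map_mxB !map_delta_mx.
  by rewrite linearB /= !trmx_delta opprB.
- by apply/eqP => /matrixP/(_ i1 i2)/eqP; rewrite !mxE /= subr0 oner_eq0.
- by apply/colP; apply: (all3 _); rewrite mulmx_delta_col !mxE /= subr0.
- move=> y /(compact_formCP (form1_orth C 3) isT)[z [b [/compact_form1P[zc zT] bs ->]]] yw _.
  have zt i j : z j i = - z i j by rewrite -[z in LHS]trmxK zT !mxE.
  have zd i : z i i = 0.
    by apply/eqP; have /eqP := zt i i; rewrite -addr_eq0 -mulr2n mulrn_eq0.
  have e i : (z + b%:M) i i0 = 0 by rewrite -mulmx_delta_col yw mxE.
  have b0 : b = 0 by have := e i0; rewrite !mxE zd add0r mulr1n.
  have z1 i : z i i0 = 0 by have := e i; rewrite !mxE b0 mul0rn addr0.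
  have z1' i : z i0 i = 0 by rewrite zt z1 oppr0.
  exists (z i1 i2).
    by apply/CrealP; move/matrixP/(_ i1 i2): zc; rewrite mxE.
  rewrite b0 raddf0 addr0; apply/matrixP; apply: (all3 _); apply: (all3 _);
    rewrite ?z1 ?z1' ?zd !mxE /= ?subrr ?subr0 ?sub0r ?mulr0 ?mulr1 //.
  by rewrite mulrN mulr1 zt.
Qed.

Lemma so5C_rank_one : exists w, rank_one_at (compact_formC (1%:M : 'M[C]_5)) w.
Proof.
pose i0 : 'I_5 := @Ordinal 5 0 isT; pose i1 : 'I_5 := @Ordinal 5 1 isT.
pose i2 : 'I_5 := @Ordinal 5 2 isT; pose i3 : 'I_5 := @Ordinal 5 3 isT.
pose i4 : 'I_5 := @Ordinal 5 4 isT.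
have all5 (P : 'I_5 -> Prop) : P i0 -> P i1 -> P i2 -> P i3 -> P i4 -> forall i, P i.
  move=> p0 p1 p2 p3 p4 [[|[|[|[|[|//]]]]] h].
  - by rewrite (_ : Ordinal h = i0) //; apply: val_inj.
  - by rewrite (_ : Ordinal h = i1) //; apply: val_inj.
  - by rewrite (_ : Ordinal h = i2) //; apply: val_inj.
  - by rewrite (_ : Ordinal h = i3) //; apply: val_inj.
  - by rewrite (_ : Ordinal h = i4) //; apply: val_inj.
pose x : 'M[C]_5 := delta_mx i2 i3 - delta_mx i3 i2.
(* The factor 2 makes the real and imaginary parts of w have different lengths,
   so that 'i w is not in so_5 w and the stabilizer is a copy of so_3. *)
pose w : 'cV[C]_5 := delta_mx i0 0 + (2 * 'i) *: delta_mx i1 0.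
have mw (y : 'M[C]_5) i : (y *m w) i 0 = y i i0 + 2 * 'i * y i i1.
  by rewrite mulmxDr -scalemxAr mxE mulmx_delta_col [X in _ + X]mxE mulmx_delta_col.
have ii : 'i * 'i = -1 :> C by rewrite -expr2 sqrCi.
exists w, x; split.
- rewrite -[x]addr0 -(raddf0 (@scalar_mx C 5)).
  apply: compact_formC_add; last by rewrite rmorph0 oppr0.
  apply/compact_form1P; rewrite /x; split.
    by rewrite map_mxB !map_delta_mx.
  by rewrite linearB /= !trmx_delta opprB.
- by apply/eqP => /matrixP/(_ i2 i3)/eqP; rewrite !mxE /= subr0 oner_eq0.
- by apply/colP; apply: (all5 _); rewrite mw !mxE /= subr0 ?mulr0 addr0.
- move=> y /(compact_formCP (form1_orth C 5) isT)[z [b [/compact_form1P[zc zT] bs ->]]] yw yx.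
  have zt i j : z j i = - z i j by rewrite -[z in LHS]trmxK zT !mxE.
  have zd i : z i i = 0.
    by apply/eqP; have /eqP := zt i i; rewrite -addr_eq0 -mulr2n mulrn_eq0.
  have zr i j : (z i j)^* = z i j by move/matrixP/(_ i j): zc; rewrite mxE.
  have e i : (z + b%:M) i i0 + 2 * 'i * (z + b%:M) i i1 = 0 by rewrite -mw yw mxE.
  have e0 := e i0; have e1 := e i1.
  rewrite !mxE zd /= mulr1n mulr0n addr0 add0r in e0.
  rewrite !mxE zd /= mulr1n mulr0n addr0 add0r (zt i0 i1) in e1.
  have z01 : z i0 i1 = 0.
    (* Eliminating b from e0 and e1 leaves (k^2 - 1) z01 = 0, where k = 2 is the factor in w; k = 1
       would give nothing. *)
    apply/eqP; have : 3 * z i0 i1 = 0.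
      transitivity (- z i0 i1 + 2 * 'i * b - 2 * 'i * (b + 2 * 'i * z i0 i1)
         + (4 * z i0 i1 + 4 * ('i * 'i) * z i0 i1)); first by ring.
      by rewrite e0 e1 ii; ring.
    by move/eqP; rewrite mulf_eq0 pnatr_eq0.
  have b0 : b = 0 by move: e0; rewrite z01 mulr0 addr0.
  (* As b = 0 and z is real, z kills the real and imaginary parts of w separately; only the so_3 on
     the last three coordinates is left. *)
  have zz i : z i i0 = 0 /\ z i i1 = 0.
    have ei : z i i0 + 2 * 'i * z i i1 = 0.
      by have := e i; rewrite b0 raddf0 addr0.
    have eic : z i i0 - 2 * 'i * z i i1 = 0.
      have := congr1 Num.conj ei; rewrite rmorph0 rmorphD !rmorphM /= conjCi !zr conjC_nat => <-.
      by ring.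
    have h0 : 2 * z i i0 = 0.
      transitivity ((z i i0 + 2 * 'i * z i i1) + (z i i0 - 2 * 'i * z i i1)); first by ring.
      by rewrite ei eic addr0.
    have z0 : z i i0 = 0 by move/eqP: h0; rewrite mulf_eq0 pnatr_eq0 => /eqP.
    split=> //; move/eqP: ei; rewrite z0 add0r !mulf_eq0 pnatr_eq0 /=.
    by rewrite (negPf (neq0Ci C)) => /eqP.
  have za i : z i i0 = 0 := (zz i).1.
  have zb i : z i i1 = 0 := (zz i).2.
  have za' i : z i0 i = 0 by rewrite zt za oppr0.
  have zb' i : z i1 i = 0 by rewrite zt zb oppr0.
  rewrite b0 raddf0 addr0 in yx *.
  (* The last column of z x vanishes, while that of x z contains z34 and -z24. *)
  have zx i : (z *m x) i i4 = 0.
    by rewrite mxE big1 // => k _; rewrite !mxE /= !andbF subr0 mulr0.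
  have z34 : z i3 i4 = 0.
    have := zx i2; rewrite -yx mxE (bigD1 i3) //= big1 => [|k /negPf k3].
      by rewrite !mxE /= subr0 mul1r addr0.
    by rewrite !mxE /= k3 subr0 mul0r.
  have z24 : z i2 i4 = 0.
    have := zx i3; rewrite -yx mxE (bigD1 i2) //= big1 => [|k /negPf k3].
      by rewrite !mxE /= sub0r mulN1r addr0 => /eqP; rewrite oppr_eq0 => /eqP.
    by rewrite !mxE /= k3 subr0 mul0r.
  have z43 : z i4 i3 = 0 by rewrite zt z34 oppr0.
  have z42 : z i4 i2 = 0 by rewrite zt z24 oppr0.
  exists (z i2 i3); first by apply/CrealP.
  apply/matrixP; apply: (all5 _) => [j|j|j|j|j]; rewrite ?za' ?zb'; move: j;
    apply: (all5 _); rewrite ?za ?zb ?zd ?z34 ?z24 ?z43 ?z42 !mxE /=;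
    rewrite ?subrr ?subr0 ?sub0r ?mulr0 ?mulr1 //.
  by rewrite mulrN mulr1 zt.
Qed.

(** The stabilizer of a basis vector is the compact sp_2 on the complementary quaternionic line, and
    x = diag(0, i, 0, -i) spans a torus of it. *)
Lemma sp4_rank_one : exists w,
  rank_one_at (compact_form (block_mx 0 1%:M (- 1%:M) 0 : 'M[C]_(2 + 2))) w.
Proof.
pose i0 : 'I_2 := @Ordinal 2 0 isT; pose i1 : 'I_2 := @Ordinal 2 1 isT.
have all2 (P : 'I_2 -> Prop) : P i0 -> P i1 -> forall i, P i.
  move=> p0 p1 [[|[|//]] h].
  - by rewrite (_ : Ordinal h = i0) //; apply: val_inj.
  - by rewrite (_ : Ordinal h = i1) //; apply: val_inj.
pose X : 'M[C]_2 := 'i *: delta_mx i1 i1.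
have XT : X^T = X by rewrite linearZ /= trmx_delta.
have NXT : (- X)^T = - X by rewrite linearN /= XT.
have Xs : X ^t* = - X by rewrite XT map_mxZ map_delta_mx /= conjCi scaleNr.
have Xc (m : nat) (i : 'I_2) (A : 'M[C]_(2, m)) j : (X *m A) i j = 'i * (i == i1)%:R * A i1 j.
  rewrite mxE (bigD1 i1) //= big1 ?addr0 => [|k /negPf k1]; rewrite !mxE ?eqxx ?andbT //.
  by rewrite k1 andbF mulr0 mul0r.
have cX (m : nat) (i : 'I_m) (A : 'M[C]_(m, 2)) j : (A *m X) i j = A i i1 * ('i * (j == i1)%:R).
  rewrite mxE (bigD1 i1) //= big1 ?addr0 => [|k /negPf k1]; rewrite !mxE ?eqxx //.
  by rewrite k1 !mulr0.
pose x : 'M[C]_(2 + 2) := block_mx X 0 0 (- X).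
pose w : 'cV[C]_(2 + 2) := col_mx (delta_mx i0 0) 0.
have Xd : X *m delta_mx i0 0 = 0 :> 'cV_2.
  by apply/colP => i; rewrite Xc !mxE /= mulr0.
have X0 : X != 0.
  by apply/eqP => /matrixP/(_ i1 i1)/eqP; rewrite !mxE /= mulr1 (negPf (neq0Ci C)).
exists w, x; split.
- split.
    rewrite tr_block_mx map_block_mx !trmx0 !map_mx0 opp_block_mx !oppr0.
    by rewrite trmxCN Xs.
  rewrite /preserves_form tr_block_mx !mulmx_block !trmx0 NXT XT.
  by rewrite !(mulmx0, mul0mx, mulmx1, mul1mx, addr0, add0r, mulNmx, mulmxN, opprK)
     add_block_mx !(addr0, subrr, addNr) block_mx0.
- apply: contra_neq X0 => /(congr1 ulsubmx); rewrite block_mxKul => ->.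
  by apply/matrixP => i j; rewrite !mxE.
- by rewrite mul_block_col Xd !mulmx0 mul0mx !addr0 col_mx0.
move=> y [ys yB] yw yx.
move: ys yB yw yx; rewrite -[y]submxK; set A := ulsubmx y; set B := ursubmx y.
set D := drsubmx y; set G := dlsubmx y.
clearbody A B D G.
rewrite tr_block_mx map_block_mx opp_block_mx => /eq_block_mx[As GB _ _].
rewrite /preserves_form tr_block_mx !mulmx_block.
rewrite !(mulmx0, mul0mx, mulmx1, mul1mx, addr0, add0r, mulNmx, mulmxN) add_block_mx.
rewrite -[RHS]block_mx0 => /eq_block_mx[e1 e2 _ _].
rewrite mul_block_col -[RHS]col_mx0 !mulmx0 !addr0 => /eq_col_mx[Aw Gw].
move=> /eq_block_mx[_ _ XG _].
have A0 i : A i i0 = 0 by rewrite -mulmx_delta_col Aw mxE.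
have A0' i : A i0 i = 0 by rewrite (skewherm_entry i i0 As) A0 rmorph0 oppr0.
have G0 i : G i i0 = 0 by rewrite -mulmx_delta_col Gw mxE.
have GT : G^T = G by apply/eqP; rewrite eq_sym -subr_eq0 addrC; apply/eqP.
have G0' i : G i0 i = 0 by rewrite -GT mxE G0.
(* The lower left block of x y = y x reads -X G = G X; at this entry the two sides are -i g and i
   g. *)
have G11 : G i1 i1 = 0.
  have /matrixP/(_ i1 i1)/eqP := XG; rewrite mxE Xc cX eqxx !mulr1 mulrC eq_sym -addr_eq0.
  by rewrite -mulr2n mulrn_eq0 mulf_eq0 /= (negPf (neq0Ci C)) orbF => /eqP.
have GE : G = 0 by apply/matrixP; do 2!apply: (all2 _); rewrite ?G0 ?G0' ?G11 mxE.
have BE : B = 0.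
  by apply/eqP; rewrite -oppr_eq0 -GB GE trmx0 map_mx0.
have DE : D = - A^T by apply/eqP; rewrite -addr_eq0 addrC e2.
have AE : A = (A i1 i1 / 'i) *: X.
  apply/matrixP; apply: (all2 _) => [j|].
    by rewrite A0' !mxE /= !mulr0.
  by apply: (all2 _); rewrite ?A0 !mxE /= ?mulr0 // mulr1 divfK // neq0Ci.
exists (A i1 i1 / 'i); first by apply: imaginary_divi; apply: skewherm_diag.
rewrite GE BE DE scale_block_mx !scaler0 scalerN -AE; congr (block_mx _ _ _ (- _)).
by rewrite AE linearZ /= XT -AE.
Qed.
End Positive.

(** * Real and imaginary parts; tori of skew-symmetric matrices *)

Section RealComplexMatrices.
Variable R : rcfType.
Local Notation C := R[i].
Local Notation emb := (map_mx (real_complex R)).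
Local Notation Remx := (map_mx (@complex.Re R)).
Local Notation Immx := (map_mx (@complex.Im R)).

Lemma ReC_sum I (r : seq I) (P : pred I) (F : I -> C) :
  complex.Re (\sum_(i <- r | P i) F i) = \sum_(i <- r | P i) complex.Re (F i).
Proof. by apply: (big_morph (@complex.Re R)) => // -[a b] [c d]. Qed.

Lemma ImC_sum I (r : seq I) (P : pred I) (F : I -> C) :
  complex.Im (\sum_(i <- r | P i) F i) = \sum_(i <- r | P i) complex.Im (F i).
Proof. by apply: (big_morph (@complex.Im R)) => // -[a b] [c d]. Qed.

Lemma ReC_scale (a : R) (z : C) : complex.Re (a%:C%C * z) = a * complex.Re z.
Proof. by case: z => x y /=; rewrite mul0r subr0. Qed.

Lemma ImC_scale (a : R) (z : C) : complex.Im (a%:C%C * z) = a * complex.Im z.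
Proof. by case: z => x y /=; rewrite mul0r addr0. Qed.

Lemma complex_rect (z : C) : z = (complex.Re z)%:C%C + 'i * (complex.Im z)%:C%C.
Proof. by rewrite [LHS]complexE complexiE. Qed.

Lemma conj_realC (a : R) : (a%:C%C)^* = a%:C%C :> C.
Proof. by apply/CrealP/complex_realP; exists a. Qed.

Lemma realC_Re (c : C) : c \is Num.real -> c = (complex.Re c)%:C%C.
Proof. by move/RRe_real->. Qed.

Lemma ReC_conj (z : C) : complex.Re (z^*) = complex.Re z. Proof. by case: z. Qed.
Section Mx.
Variables m n : nat.

Lemma emb_inj : injective (emb : 'M[R]_(m, n) -> 'M[C]_(m, n)).
Proof. exact: map_mx_inj. Qed.

Lemma embZ a (A : 'M[R]_(m, n)) : emb (a *: A) = a%:C%C *: emb A.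
Proof. exact: map_mxZ. Qed.

Lemma embK (A : 'M[R]_(m, n)) : Remx (emb A) = A.
Proof. by apply/matrixP => i j; rewrite !mxE. Qed.

Lemma Immx_emb (A : 'M[R]_(m, n)) : Immx (emb A) = 0.
Proof. by apply/matrixP => i j; rewrite !mxE. Qed.

Lemma emb_rect (A : 'M[C]_(m, n)) : A = emb (Remx A) + 'i *: emb (Immx A).
Proof. by apply/matrixP => i j; rewrite !mxE -complex_rect. Qed.

Lemma RemxD (A B : 'M[C]_(m, n)) : Remx (A + B) = Remx A + Remx B.
Proof. by apply/matrixP => i j; rewrite !mxE; case: (A i j) (B i j) => ? ? []. Qed.

Lemma ImmxD (A B : 'M[C]_(m, n)) : Immx (A + B) = Immx A + Immx B.
Proof. by apply/matrixP => i j; rewrite !mxE; case: (A i j) (B i j) => ? ? []. Qed.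

Lemma RemxZ a (A : 'M[C]_(m, n)) : Remx (a%:C%C *: A) = a *: Remx A.
Proof. by apply/matrixP => i j; rewrite !mxE ReC_scale. Qed.

Lemma Remx_i (A : 'M[R]_(m, n)) : Remx ('i *: emb A) = 0.
Proof. by apply/matrixP => i j; rewrite !mxE /= !(mul0r, mulr0) subrr. Qed.

Lemma Immx_i (A : 'M[R]_(m, n)) : Immx ('i *: emb A) = A.
Proof. by apply/matrixP => i j; rewrite !mxE /= mul0r mul1r add0r. Qed.

Lemma emb_rect_inj (A B A' B' : 'M[R]_(m, n)) :
  emb A + 'i *: emb B = emb A' + 'i *: emb B' -> A = A' /\ B = B'.
Proof.
move=> e; split.
  by have := congr1 Remx e; rewrite !RemxD !Remx_i !embK !addr0.
by have := congr1 Immx e; rewrite !ImmxD !Immx_i !Immx_emb !add0r.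
Qed.

Lemma conj_emb (A : 'M[R]_(m, n)) : map_mx Num.conj (emb A) = emb A.
Proof. by apply/matrixP => i j; rewrite !mxE conj_realC. Qed.

Lemma conj_fixed (A : 'M[C]_(m, n)) : map_mx Num.conj A = A -> A = emb (Remx A).
Proof.
move=> /matrixP h; apply/matrixP => i j; rewrite !mxE; apply: realC_Re.
by apply/CrealP; have := h i j; rewrite mxE.
Qed.

Lemma trmxC_emb (A : 'M[R]_(m, n)) : (emb A) ^t* = emb (A^T).
Proof. by apply/matrixP => i j; rewrite !mxE conj_realC. Qed.
End Mx.

Lemma Remx_mull m n p (A : 'M[R]_(m, n)) (B : 'M[C]_(n, p)) :
  Remx (emb A *m B) = A *m Remx B.
Proof.
apply/matrixP => i j; rewrite !mxE ReC_sum; apply: eq_bigr => k _.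
by rewrite !mxE ReC_scale.
Qed.

Lemma Immx_mull m n p (A : 'M[R]_(m, n)) (B : 'M[C]_(n, p)) :
  Immx (emb A *m B) = A *m Immx B.
Proof.
apply/matrixP => i j; rewrite !mxE ImC_sum; apply: eq_bigr => k _.
by rewrite !mxE ImC_scale.
Qed.

Lemma compact_form1_emb m (z : 'M[R]_m) :
  compact_form (1%:M : 'M[C]_m) (emb z) <-> z^T = - z.
Proof.
rewrite compact_form1P conj_emb map_trmx -map_mxN; split=> [[_ /emb_inj] //|->].
by [].
Qed.

Lemma compact_form1_real m (z : 'M[C]_m) : compact_form (1%:M : 'M[C]_m) z ->
  exists2 z0 : 'M[R]_m, z = emb z0 & z0^T = - z0.
Proof.
move=> hz; have /compact_form1P[zc _] := hz.
exists (Remx z); first exact: conj_fixed.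
by apply/compact_form1_emb; rewrite -conj_fixed.
Qed.

Section Torus.
Variable m : nat.
Implicit Types t : {vspace 'M[R]_m}.

Definition skew_torus t : Prop :=
  {in t, forall x, x^T = - x} /\ {in t &, forall x y, x *m y = y *m x}.

(** Here a and b are the real and imaginary parts of a joint complex eigenvector. It is sought in
    the image of x, which commutation makes stable, so that its x-eigenvalue i mu is not 0. *)
Lemma skew_torus_plane t x : skew_torus t -> x \in t -> x != 0 ->
  exists (a b : 'cV[R]_m), exists2 mu : R, [/\ a != 0, mu != 0, x *m a = - mu *: b & x *m b = mu *: a] &
    {in t, forall z, exists c, z *m a = - c *: b /\ z *m b = c *: a}.
Proof.
move=> [sk cm] xt x0.
have skC z : z \in t -> (emb z)^T = - emb z by move=> zt; rewrite map_trmx sk // map_mxN.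
pose As := [seq (emb z)^T | z <- vbasis t].
have Ast A : A \in As -> exists2 z, z \in t & A = (emb z)^T.
  by move=> /mapP[z /vbasis_mem zt ->]; exists z.
have [|A B /Ast[z zt ->] /Ast[z' zt' ->]|A /Ast[z zt ->]|v v0 [vx vs]] :=
    @common_eigenvector_in _ m As (emb x).
- by apply: contra_neq x0 => h; apply: (@emb_inj m m); rewrite h map_mx0.
- by rewrite /comm_mx -!trmx_mul -!map_mxM cm.
- rewrite skC // mulmxN -map_mxM cm // map_mxM -mulNmx.
  exact: submxMl.
pose e := v^T.
have e0 : e != 0 by rewrite trmx_eq0.
have eigb z : z \in vbasis t -> exists c, emb z *m e = c *: e.
  move=> zt; have /vs/sub_rVP[c cE] : (emb z)^T \in As by apply: map_f.
  by exists c; rewrite -[emb z]trmxK -trmx_mul cE linearZ.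
have eig z : z \in t -> exists c, emb z *m e = c *: e.
  move=> /coord_vbasis ->; set k := coord _.
  pose E (w : 'M[R]_m) := exists c, emb w *m e = c *: e.
  apply: (big_ind E); rewrite /E.
  - by exists 0; rewrite map_mx0 mul0mx scale0r.
  - move=> w w' [c cE] [d dE]; exists (c + d).
    by rewrite map_mxD mulmxDl cE dE scalerDl.
  - move=> i _; have [|c cE] := eigb ((vbasis t)`_i); first by rewrite mem_nth ?size_tuple.
    by exists ((k i z)%:C%C * c); rewrite embZ -scalemxAl cE scalerA.
have eigi z : z \in t -> exists c : R, emb z *m e = ('i * c%:C%C) *: e.
  move=> zt; have [c cE] := eig z zt; exists (complex.Im c).
  have zs : (emb z) ^t* = - emb z by rewrite trmxC_emb sk // map_mxN.
  have [s [u [s0 eE u1]]] := unit_vector e0.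
  have uc : emb z *m u = c *: u.
    have uE : u = s^-1 *: e by rewrite eE scalerA mulVf ?scale1r ?gt_eqF.
    by rewrite uE -scalemxAr cE !scalerA mulrC.
  have cs := skewherm_eigenvalue zs u1 uc.
  rewrite cE {1}(complex_rect c); have -> : complex.Re c = 0.
    apply/eqP; have := congr1 (@complex.Re R) cs.
    rewrite ReC_conj; case: (c) => a b /= /eqP.
    by rewrite -addr_eq0 -mulr2n mulrn_eq0.
  by rewrite add0r.
have ab z (c : R) : emb z *m e = ('i * c%:C%C) *: e ->
    z *m Remx e = - c *: Immx e /\ z *m Immx e = c *: Remx e.
  move=> h; have := emb_rect (emb z *m e); rewrite Remx_mull Immx_mull h.
  rewrite {1}(emb_rect e) scalerDr !scalerA mulrAC -expr2 sqrCi mulN1r -rmorphN -scalerA -!embZ /=.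
  by rewrite addrC => /emb_rect_inj[-> ->].
have [mu xe] := eigi x xt.
exists (Remx e), (Immx e), mu; last first.
  by move=> z zt; have [c /ab] := eigi z zt; exists c.
have mu0 : mu != 0; last first.
  have [xa xb] := ab _ _ xe; split=> //.
  apply: contra_neq e0 => a0; rewrite (emb_rect e) a0 map_mx0 add0r.
  move/eqP: xa; rewrite a0 mulmx0 eq_sym scaler_eq0 oppr_eq0 (negPf mu0) /= => /eqP->.
  by rewrite map_mx0 scaler0.
apply/eqP => mu0; move: xe; rewrite mu0 mulr0 scale0r => xe.
(* With mu = 0 the vector e would lie in both the image and the kernel of the skew matrix x, hence
   be orthogonal to itself. *)
have [u vE] := submxP vx.
have : e ^t* *m e = 0.
  have eE : e = - (emb x *m u^T) by rewrite /e vE trmx_mul skC // mulNmx.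
  rewrite {1}eE trmxCN trmxCM trmxC_emb sk // map_mxN mulmxN opprK -mulmxA xe.
  by rewrite mulmx0.
by move=> h; have := sqnorm_gt0 e0; rewrite h mxE ltxx.
Qed.

(* Splitting off joint eigenplanes one at a time: W is the sum of the planes
   found so far, which the remaining subspace t kills. *)
Lemma skew_torus_killing t (W : {vspace 'cV[R]_m}) : skew_torus t ->
  {in t & W, forall z w, z *m w = 0} -> (2 * \dim t + \dim W <= m)%N.
Proof.
have [d] := ubnP (\dim t); elim: d => // d IHd in t W *; rewrite ltnS => td st kW.
have [t0|t0] := eqVneq t 0%VS.
  by rewrite t0 dimv0 muln0 add0n (leq_trans (dimvS (subvf W))) // dimvf /dim /= muln1.
pose x := vpick t.
have xt : x \in t := memv_pick t; have x0 : x != 0 by rewrite vpick0.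
have [a [b [mu [a0 mu0 xa xb] eig]]] := skew_torus_plane st xt x0.
(* [f] records the action on the plane of a and b. Every element of t acts there by a multiple of
   one rotation, so the image of t is a line and the kernel loses exactly one dimension. *)
pose f : 'Hom('M[R]_m, 'M[R]_(m, 1 + 1)) := linfun (mulmxr (row_mx a b)).
have fE z : f z = row_mx (z *m a) (z *m b) by rewrite lfunE /= mul_mx_row.
have inj al be : x *m (al *: a + be *: b) = 0 -> al = 0 /\ be = 0.
  rewrite mulmxDr -!scalemxAr xa xb !scalerA mulrN scaleNr => e1.
  have {}e1 : be *: a = al *: b.
    apply: (scalerI mu0); rewrite !scalerA [mu * be]mulrC [mu * al]mulrC.
    by apply/eqP; rewrite -subr_eq0 addrC; apply/eqP.
  have e2 : al *: a = - be *: b.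
    have := congr1 (mulmx x) e1; rewrite -!scalemxAr xa xb !scalerA mulrN scaleNr => e2.
    apply: (scalerI mu0); rewrite !scalerA [mu * al]mulrC -e2.
    by rewrite mulrN scaleNr [mu * be]mulrC.
  have : (al * al + be * be) *: a = 0.
    rewrite scalerDl -!scalerA e2 [be *: a]e1 !scalerA -scalerDl mulrN mulrC.
    by rewrite addNr scale0r.
  move=> /eqP; rewrite scaler_eq0 (negPf a0) orbF paddr_eq0 -?expr2 ?sqr_ge0 //.
  by rewrite !sqrf_eq0 => /andP[/eqP-> /eqP->].
have fx : f x != 0.
  rewrite fE; apply: contra_neq a0; rewrite -[0]row_mx0 => /eq_row_mx[xa0 xb0].
  have [|/eqP] := inj 1 0; last by rewrite oner_eq0.
  by rewrite mulmxDr -!scalemxAr xa0 xb0 !scaler0 addr0.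
have dimf : (\dim (f @: t) <= 1)%N.
  have : (f @: t <= <[row_mx (- b) a]>)%VS.
    apply/subvP => w /memv_imgP[z /eig[c [za zb]] ->]; apply/vlineP; exists c.
    by rewrite fE za zb scale_row_mx scalerN scaleNr.
  by move/dimvS/leq_trans; apply; rewrite dim_vline leq_b1.
have dimf1 : (0 < \dim (f @: t))%N.
  by rewrite lt0n dimv_eq0; apply/eqP => h; move: (memv_img f xt); rewrite h memv0 (negPf fx).
pose t' := (t :&: lker f)%VS.
have dt : (\dim t' + \dim (f @: t) = \dim t)%N := limg_ker_dim f t.
have t't : (t' <= t)%VS by apply: capvSl.
pose P := <<[:: a; b]>>%VS.
have memP w : w \in P -> exists al be, w = al *: a + be *: b.
  rewrite /P span_cons span_seq1 => /memv_addP[_ /vlineP[al ->] [_ /vlineP[be ->] ->]].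
  by exists al, be.
have dP : \dim P = 2%N.
  have /eqP -> // : free [:: a; b].
  rewrite free_cons span_seq1 seq1_free; apply/andP; split.
    apply/vlineP => -[k ak]; have [|/eqP] := inj 1 (- k); last by rewrite oner_eq0.
    by rewrite scale1r {1}ak scaleNr subrr mulmx0.
  apply/eqP => b0; have [|_ /eqP] := inj 0 1; last by rewrite oner_eq0.
  by rewrite b0 scaler0 scale0r addr0 mulmx0.
have WP : (W :&: P = 0)%VS.
  apply/eqP; rewrite -subv0; apply/subvP => w; rewrite memv_cap => /andP[wW /memP[al [be wE]]].
  have [|al0 be0] := inj al be; first by rewrite -wE kW.
  by rewrite wE al0 be0 !scale0r addr0 mem0v.
have := IHd t' (W + P)%VS; rewrite dimv_disjoint_sum // dP => IH.
have : (2 * \dim t' + (\dim W + 2) <= m)%N.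
  apply: IH => //.
  - by rewrite (leq_trans _ td) // -dt -[X in (X <= _)%N]addn1 leq_add2l.
  - split; first by move=> z /(subvP t't)/st.1.
    by move=> z z' /(subvP t't) zt /(subvP t't) zt'; apply: st.2.
  - move=> z _ zt' /memv_addP[w wW [_ /memP[al [be ->]] ->]].
    move: zt'; rewrite memv_cap memv_ker fE => /andP[zt].
    rewrite -[0]row_mx0 => /eqP/eq_row_mx[za zb].
    by rewrite !mulmxDr kW // -!scalemxAr za zb !scaler0 !addr0.
apply: leq_trans; rewrite addnA addnAC leq_add2r -dt.
by rewrite mulnDr leq_add2l -[leqRHS]muln1 leq_mul2l dimf.
Qed.

Lemma skew_torus_dim t : skew_torus t -> (2 * \dim t <= m)%N.
Proof.
move=> st; have := @skew_torus_killing t 0%VS st; rewrite dimv0 addn0; apply.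
by move=> z w _; rewrite memv0 => /eqP->; rewrite mulmx0.
Qed.
End Torus.
End RealComplexMatrices.

(** * Quadratic forms invariant under a compact group *)

Section Exponential.
Import numFieldNormedType.Exports.
Local Open Scope classical_set_scope.
Local Open Scope ring_scope.
Variables (R : realType) (n : nat).
Implicit Types x : 'M[R]_n.

(** A bound for the operator norm attached to the sup norm; unlike a bound on entries it is
    submultiplicative, which gives b^k for the entries of x^k. *)
Definition rowsum_bound x (b : R) : Prop := 0 <= b /\ forall i, \sum_j `|x i j| <= b.

Lemma rowsum_bound_exists x : exists b, rowsum_bound x b.
Proof.
exists (\sum_i \sum_j `|x i j|); split.
  by apply: sumr_ge0 => i _; apply: sumr_ge0.
move=> i; rewrite [leRHS](bigD1 i) //= lerDl; apply: sumr_ge0 => k _.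
exact: sumr_ge0.
Qed.

Lemma rowsum_exp x b k i j : rowsum_bound x b -> `|(x ^+ k) i j| <= b ^+ k.
Proof.
move=> [b0 hb]; elim: k i j => [|k IH] i j.
  by rewrite expr0 mxE; case: eqP => _; rewrite /= ?normr1 ?normr0.
rewrite exprS mxE (le_trans (ler_norm_sum _ _ _)) // exprS.
rewrite (le_trans _ (ler_wpM2r (exprn_ge0 k b0) (hb i))) // mulr_suml.
by apply: ler_sum => l _; rewrite normrM ler_wpM2l.
Qed.

Definition expmx_term x (k : nat) : 'M[R]_n := (k`!%:R)^-1 *: x ^+ k.

Lemma exprZmx t x k : (t *: x) ^+ k = t ^+ k *: x ^+ k.
Proof.
elim: k => [|k IH]; first by rewrite !expr0 scale1r.
by rewrite !exprS IH -[_ * _]/(_ *m _) -scalemxAl -scalemxAr scalerA.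
Qed.

Lemma expmx_term_le x t b k i j : rowsum_bound x b ->
  `|expmx_term (t *: x) k i j| <= exp_coeff (`|t| * b) k.
Proof.
move=> hb; rewrite mxE exprZmx mxE !normrM normrX normfV normr_nat.
rewrite /exp_coeff /= exprMn mulrC ler_wpM2r ?invr_ge0 ?ler0n //.
by rewrite ler_wpM2l ?exprn_ge0 // rowsum_exp.
Qed.

Definition expmx_partial x N : 'M[R]_n := series (expmx_term x) N.

Lemma expmx_partialE x N i j :
  expmx_partial x N i j = series (fun k => expmx_term x k i j) N.
Proof. by rewrite /expmx_partial /series /= summxE. Qed.

(** Each entry is dominated by the scalar series of exp b. There are finitely many entries, so the
    matrices converge and the limit defining [expmx] is the entrywise one. *)
Lemma expmx_entry_cvg x i j : (fun N => expmx_partial x N i j) @ \oo --> expmx x i j.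
Proof.
have [b hb] := rowsum_bound_exists x.
have cvij k l : cvgn (fun N => expmx_partial x N k l).
  rewrite (_ : (fun N => _) = series (fun p => expmx_term x p k l)); last first.
    by apply/funext => N; rewrite expmx_partialE.
  apply: normed_cvg; apply: (@series_le_cvg _ _ (exp_coeff b)) => //.
  - by move=> p; apply: normr_ge0.
  - by move=> p; apply: exp_coeff_ge0; case: hb.
  - by move=> p; have := expmx_term_le 1 p k l hb; rewrite scale1r normr1 mul1r.
  - exact: is_cvg_series_exp_coeff.
pose L : 'M[R]_n := \matrix_(k, l) limn (fun N => expmx_partial x N k l).
have cL : expmx_partial x @ \oo --> L.
  apply/cvgrPdist_le => e e0; near=> N.
  rewrite [leLHS]/Num.Def.normr /= mx_normrE (bigmax_le _ (ltW e0)) //= => -[k l] _.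
  rewrite !mxE /=; move: (k) (l); near: N.
  apply: filter_forall => k'; apply: filter_forall => l'.
  by have /cvgrPdist_le/(_ e e0) := cvij k' l'.
have -> : expmx x = L by apply: cvg_lim.
rewrite mxE; exact: cvij.
Unshelve. all: by end_near. Qed.

(** The first two terms of the series cancel, and t^2 factors out of the others because |t|^k is at
    most t^2 for k > 1. *)
Lemma expmx_dist1 x (t b : R) i j : rowsum_bound x b -> `|t| <= 1 ->
  `|expmx (t *: x) i j - ((i == j)%:R + t * x i j)| <= t ^+ 2 * expR b.
Proof.
move=> hb t1; have b0 := hb.1.
have cv := @expmx_entry_cvg (t *: x) i j.
set c := (_ + t * _).
have cv' : (fun N => `|expmx_partial (t *: x) N i j - c|) @ \oo -->
    `|expmx (t *: x) i j - c| by apply: cvg_norm; apply: cvgB => //; apply: cvg_cst.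
rewrite -(cvg_lim _ cv') //; apply: limr_le; first by apply/cvg_ex; eexists; exact: cv'.
near=> N; have N2 : (2 <= N)%N by near: N; exists 2%N.
rewrite expmx_partialE /series /= big_ltn 1?ltnW // big_ltn // addrA.
have -> : expmx_term (t *: x) 0 i j + expmx_term (t *: x) 1 i j = c.
  by rewrite /c /expmx_term expr0 expr1 invr1 !scale1r !mxE.
rewrite addrAC subrr add0r (le_trans (ler_norm_sum _ _ _)) //.
have := nondecreasing_cvgn_le _ (is_cvg_series_exp_coeff b) N.
rewrite -/(expR b) => le_exp.
have : t ^+ 2 * series (exp_coeff b) N <= t ^+ 2 * expR b.
  apply: ler_wpM2l; rewrite ?sqr_ge0 // le_exp //.
  by apply: nondecreasing_series => k _ _; apply: exp_coeff_ge0.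
apply: le_trans; rewrite mulr_sumr [leRHS](@big_cat_nat _ _ _ 2) //= -[leLHS]add0r lerD //.
  by apply: sumr_ge0 => k _; rewrite mulr_ge0 ?sqr_ge0 ?exp_coeff_ge0.
rewrite !big_nat; apply: ler_sum => k /andP[k2 _].
rewrite (le_trans (expmx_term_le _ _ _ _ hb)) // /exp_coeff /= exprMn.
rewrite [leRHS]mulrA ler_wpM2r ?invr_ge0 ?ler0n // ler_wpM2r ?exprn_ge0 //.
rewrite -[t ^+ 2]ger0_norm ?sqr_ge0 // normrX -(subnKC k2) exprD.
by rewrite ler_piMr ?exprn_ge0 // exprn_ile1.
Unshelve. all: by end_near. Qed.
End Exponential.

Section InvariantForm.
Import numFieldNormedType.Exports.
Local Open Scope classical_set_scope.
Local Open Scope ring_scope.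
Variable R : realType.

Definition frob m p (A : 'M[R]_(m, p)) : R := \sum_i \sum_j A i j ^+ 2.

Definition mxbound m p (A : 'M[R]_(m, p)) (a : R) : Prop := forall i j, `|A i j| <= a.

Lemma mxboundM m p q (A : 'M[R]_(m, p)) (B : 'M[R]_(p, q)) a b :
  0 <= a -> mxbound A a -> mxbound B b -> mxbound (A *m B) (p%:R * (a * b)).
Proof.
move=> a0 hA hB i j; rewrite mxE (le_trans (ler_norm_sum _ _ _)) //.
rewrite [leRHS]mulr_natl -[X in _ *+ X]card_ord -sumr_const; apply: ler_sum => k _.
by rewrite normrM ler_pM.
Qed.

Lemma mxboundD m p (A B : 'M[R]_(m, p)) a b :
  mxbound A a -> mxbound B b -> mxbound (A + B) (a + b).
Proof. by move=> hA hB i j; rewrite mxE (le_trans (ler_normD _ _)) // lerD. Qed.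

Lemma mxbound_tr m p (A : 'M[R]_(m, p)) a : mxbound A a -> mxbound A^T a.
Proof. by move=> hA i j; rewrite mxE. Qed.

Lemma mxbound_exists m p (A : 'M[R]_(m, p)) : exists2 a, 0 <= a & mxbound A a.
Proof.
exists (\sum_i \sum_j `|A i j|).
  by apply: sumr_ge0 => i _; apply: sumr_ge0.
move=> i j; rewrite (bigD1 i) //= (bigD1 j) //= -addrA lerDl addr_ge0 ?sumr_ge0 //.
by move=> k _; apply: sumr_ge0.
Qed.

Lemma frob_ge0 m p (A : 'M[R]_(m, p)) : 0 <= frob A.
Proof. by apply: sumr_ge0 => i _; apply: sumr_ge0 => j _; apply: sqr_ge0. Qed.

Lemma frob_entry m p (A : 'M[R]_(m, p)) i j : A i j ^+ 2 <= frob A.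
Proof.
rewrite /frob (bigD1 i) //= (bigD1 j) //= -addrA lerDl addr_ge0 //.
  by apply: sumr_ge0 => k _; apply: sqr_ge0.
by apply: sumr_ge0 => k _; apply: sumr_ge0 => l _; apply: sqr_ge0.
Qed.

Lemma frob_mxbound m p (A : 'M[R]_(m, p)) a : 0 <= a -> mxbound A a ->
  frob A <= (m * p)%:R * a ^+ 2.
Proof.
move=> a0 hA; rewrite /frob natrM -mulrA mulr_natl -[X in _ *+ X]card_ord -sumr_const.
apply: ler_sum => i _; rewrite mulr_natl -[X in _ *+ X]card_ord -sumr_const.
by apply: ler_sum => j _; rewrite -real_normK ?num_real // lerXn2r ?nnegrE.
Qed.

Lemma mxbound_frob m p (A : 'M[R]_(m, p)) : mxbound A (Num.sqrt (frob A)).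
Proof. by move=> i j; rewrite -sqrtr_sqr ler_sqrt ?frob_ge0 // frob_entry. Qed.

Lemma frob_tr m p (A : 'M[R]_(m, p)) : frob A^T = frob A.
Proof.
rewrite /frob exchange_big; apply: eq_bigr => i _; apply: eq_bigr => j _.
by rewrite mxE.
Qed.

Lemma frob_mull n p (g : 'M[R]_n) (A : 'M[R]_(n, p)) M : 0 <= M -> mxbound g M ->
  frob (g *m A) <= ((n * p)%:R * (n%:R * M) ^+ 2) * frob A.
Proof.
move=> M0 hg; have h := mxboundM M0 hg (@mxbound_frob _ _ A).
apply: le_trans (frob_mxbound _ h) _; first by rewrite !mulr_ge0 ?sqrtr_ge0.
by rewrite !exprMn sqr_sqrtr ?frob_ge0 // !mulrA.
Qed.

Lemma frob_parallelogram m p (A B : 'M[R]_(m, p)) :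
  frob (2^-1 *: (A + B)) + frob (2^-1 *: (A - B)) = 2^-1 * (frob A + frob B).
Proof.
rewrite /frob -!big_split /= mulr_sumr; apply: eq_bigr => i _.
rewrite -!big_split /= mulr_sumr; apply: eq_bigr => j _; rewrite !mxE.
by field.
Qed.

Lemma frobZ m p t (A : 'M[R]_(m, p)) : frob (t *: A) = t ^+ 2 * frob A.
Proof.
rewrite /frob mulr_sumr; apply: eq_bigr => i _; rewrite mulr_sumr.
by apply: eq_bigr => j _; rewrite mxE exprMn.
Qed.

Lemma frob_col n (v : 'cV[R]_n) : (v^T *m v) 0 0 = frob v.
Proof.
rewrite /frob mxE; apply: eq_bigr => i _; rewrite big_ord1 !mxE -expr2.
by [].
Qed.

Lemma eq0_small (a k : R) : 0 <= k -> (forall d, 0 < d -> `|a| <= k * d) -> a = 0.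
Proof.
move=> k0 h; apply/eqP; rewrite -normr_le0; apply/ler_addgt0Pl => e e0.
rewrite addr0; have k1 : 0 < k + 1 by rewrite ltr_wpDl.
have := h (e / (k + 1)) (divr_gt0 e0 k1); move/le_trans; apply.
rewrite mulrA ler_pdivrMr // mulrC ler_wpM2l ?lerDl //; exact: ltW.
Qed.

(** * An invariant form by minimization over a bounded group *)

Section Averaging.
Variables (n : nat) (G : set 'M[R]_n) (M : R).
Hypotheses (M0 : 0 <= M) (Gbound : forall g, G g -> mxbound g M).
Hypotheses (G1 : G 1%:M) (GM : forall x y, G x -> G y -> G (x *m y)).
Hypotheses (GV : forall x, G x -> G (invmx x)) (Gu : forall x, G x -> x \in unitmx).

Definition congr_act (g Q : 'M[R]_n) := g^T *m Q *m g.

Lemma congr_actM g g' Q : congr_act g' (congr_act g Q) = congr_act (g *m g') Q.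
Proof. by rewrite /congr_act trmx_mul !mulmxA. Qed.

Lemma congr_actD g Q Q' : congr_act g (Q + Q') = congr_act g Q + congr_act g Q'.
Proof. by rewrite /congr_act mulmxDr mulmxDl. Qed.

Lemma congr_actZ g t Q : congr_act g (t *: Q) = t *: congr_act g Q.
Proof. by rewrite /congr_act -scalemxAr -scalemxAl. Qed.

(** [C0] controls the effect on [frob] of multiplying by one group element, and [C0 * C0] that of
    the two-sided action; the added 1 keeps [C] positive, since it is divided by. *)
Let C0 : R := (n * n)%:R * (n%:R * M) ^+ 2.
Let C : R := C0 * C0 + 1.

Let C_gt0 : 0 < C. Proof. by rewrite ltr_wpDl // -expr2 sqr_ge0. Qed.

Lemma frob_congr_act g Q : G g -> frob (congr_act g Q) <= C * frob Q.
Proof.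
move=> Gg; rewrite /congr_act -mulmxA.
have gT := mxbound_tr (Gbound Gg).
apply: le_trans (frob_mull _ M0 gT) _.
rewrite -frob_tr trmx_mul.
have C00 : 0 <= C0 by rewrite mulr_ge0 ?sqr_ge0.
apply: le_trans (ler_wpM2l C00 (frob_mull _ M0 gT)) _.
by rewrite frob_tr mulrA mulrDl mul1r lerDl frob_ge0.
Qed.

Lemma frob_congr_act_ge g Q : G g -> frob Q <= C * frob (congr_act g Q).
Proof.
move=> Gg; have := frob_congr_act (congr_act g Q) (GV Gg).
rewrite congr_actM mulmxV ?Gu //.
by rewrite {1}/congr_act trmx1 mul1mx mulmx1.
Qed.

(** This constraint is stable under midpoints and under G, and it bounds the minimizer below by the
    standard form, which makes it positive definite. *)
Definition dominates Q := forall g, G g -> forall v : 'cV_n,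
  (v^T *m v) 0 0 <= (v^T *m congr_act g Q *m v) 0 0.

Definition supnorm_le Q s := forall g, G g -> frob (congr_act g Q) <= s.

Let S : set R := [set s | exists2 Q, dominates Q & supnorm_le Q s].

Let S_nonempty : S !=set0.
Proof.
pose c := (n * 1)%:R * (n%:R * M) ^+ 2.
exists (C * frob (c%:M : 'M[R]_n)); exists c%:M; last by move=> g Gg; apply: frob_congr_act.
move=> g Gg v; have -> : v^T *m congr_act g c%:M *m v = c *: ((g *m v)^T *m (g *m v)).
  by rewrite /congr_act mul_mx_scalar -!scalemxAl -!scalemxAr -scalemxAl trmx_mul !mulmxA.
rewrite [leRHS]mxE !frob_col -{1}[v](mulKmx (Gu Gg)); apply: frob_mull => //.
by apply: Gbound; apply: GV.
Qed.

Let S_lb : has_inf S.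
Proof.
split; first exact: S_nonempty.
by exists 0 => s [Q _ /(_ _ G1)]; apply: le_trans; apply: frob_ge0.
Qed.

Let m0 := inf S.

(** The tolerance is tuned so that two such Q differ by at most d: halving the difference divides
    its squared norm by 4, and moving along the orbit costs at most the factor C. *)
Let near_min d Q := dominates Q /\ supnorm_le Q (m0 + d ^+ 2 / (4 * C)).

Let near_min_exists d : 0 < d -> exists Q, near_min d Q.
Proof.
move=> d0; have e0 : 0 < d ^+ 2 / (4 * C) by rewrite divr_gt0 ?exprn_gt0 // mulr_gt0.
have [s [Q Qd Qs] sm] := inf_adherent e0 S_lb.
by exists Q; split=> // g Gg; apply: le_trans (Qs g Gg) (ltW sm).
Qed.

Let near_min_mono d d' Q : 0 < d -> d <= d' -> near_min d Q -> near_min d' Q.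
Proof.
move=> d0 dd' [Qd Qs]; split=> // g Gg; apply: le_trans (Qs g Gg) _.
rewrite lerD2l ler_wpM2r ?invr_ge0 ?(ltW (mulr_gt0 _ _)) // lerXn2r ?nnegrE ?(ltW d0) //.
exact: le_trans (ltW d0) dd'.
Qed.

Let near_min_act d g Q : G g -> near_min d Q -> near_min d (congr_act g Q).
Proof.
by move=> Gg [Qd Qs]; split=> g' Gg' *; rewrite congr_actM; [apply: Qd|apply: Qs]; apply: GM.
Qed.

(* By the parallelogram law two approximate minimizers are close: their
   midpoint would otherwise beat the infimum. *)
Let near_min_close d Q Q' : 0 < d -> near_min d Q -> near_min d Q' ->
  mxbound (Q - Q') d.
Proof.
move=> d0 [Qd Qs] [Qd' Qs'].
set e := d ^+ 2 / (4 * C) in Qs Qs'.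
pose D := 2^-1 *: (Q - Q').
have Smid : S (m0 + e - frob D / C).
  exists (2^-1 *: (Q + Q')) => g Gg.
    move=> v; rewrite congr_actZ congr_actD -scalemxAr -scalemxAl mulmxDr mulmxDl.
    rewrite [leRHS]mxE [X in _ * X]mxE.
    have := Qd g Gg v; have := Qd' g Gg v.
    set a := (v^T *m _) 0 0; set b := (_ *m _ *m _) 0 0; set c := (_ *m _ *m _) 0 0.
    by move=> ab ac; lra.
  have := frob_parallelogram (congr_act g Q) (congr_act g Q').
  have -> : congr_act g Q - congr_act g Q' = congr_act g (Q - Q').
    by rewrite -scaleN1r -congr_actZ -congr_actD scaleN1r.
  rewrite -congr_actD -!congr_actZ -/D => par.
  have := Qs g Gg; have := Qs' g Gg; have := frob_congr_act_ge D Gg.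
  rewrite mulrC -ler_pdivrMr // => h1 h2 h3.
  have -> : frob (congr_act g (2^-1 *: (Q + Q'))) =
     2^-1 * (frob (congr_act g Q) + frob (congr_act g Q')) - frob (congr_act g D).
    by rewrite -par addrK.
  lra.
have := ge_inf S_lb.2 Smid; rewrite -/m0 => le_m0.
have DC : frob D <= e * C by rewrite -ler_pdivrMr //; lra.
have QQ : frob (Q - Q') <= d ^+ 2.
  have eC : e * C = d ^+ 2 / 4 by rewrite /e; field; rewrite gt_eqF.
  by move: DC; rewrite frobZ eC exprVn -natrX; lra.
move=> i j; apply: le_trans (mxbound_frob _ _ _) _.
by rewrite [leRHS](_ : d = Num.sqrt (d ^+ 2)) ?ler_wsqrtr // sqrtr_sqr gtr0_norm.
Qed.

(** The limit of the approximate minimizers as d tends to 0, taken entrywise as a supremum of lower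
    bounds; near-minimality of any precision d' bounds these above by Q' i j + d'. *)
Let center : 'M[R]_n :=
  \matrix_(i, j) sup [set x | exists d Q, [/\ 0 < d, near_min d Q & x = Q i j - d]].

Let center_close d Q : 0 < d -> near_min d Q -> mxbound (Q - center) d.
Proof.
move=> d0 hQ i j; rewrite !mxE.
set E : set R := (X in sup X).
have ub d' Q' : 0 < d' -> near_min d' Q' -> ubound E (Q' i j + d').
  move=> d'0 hQ' _ [d'' [Q'' [d''0 hQ'' ->]]].
  have [Q3 hQ3] : exists Q3, near_min (Num.min d' d'') Q3.
    by apply: near_min_exists; rewrite lt_min d'0.
  have m0' : 0 < Num.min d' d'' by rewrite lt_min d'0.
  have h1 : near_min d' Q3 by apply: near_min_mono hQ3; rewrite ?ge_min ?lexx.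
  have h2 : near_min d'' Q3 by apply: near_min_mono hQ3; rewrite ?ge_min ?lexx ?orbT.
  have := near_min_close d'0 hQ' h1 i j; have := near_min_close d''0 hQ'' h2 i j.
  by rewrite !mxE !ler_norml => /andP[? ?] /andP[? ?]; lra.
have inE : E (Q i j - d) by exists d, Q.
have hs : has_sup E by split; [exists (Q i j - d)|exists (Q i j + d); apply: ub].
have := sup_upper_bound hs inE.
have := ge_sup (ex_intro _ _ inE : E !=set0) (ub d Q d0 hQ).
by rewrite ler_norml => ? ?; apply/andP; split; lra.
Qed.

(** G permutes the approximate minimizers of each precision, so the translate of such a Q is close
    to [center] and to the translate of [center] at once. *)
Let center_invariant g : G g -> congr_act g center = center.
Proof.
move=> Gg; apply/matrixP => i j; apply/eqP; rewrite -subr_eq0; apply/eqP.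
pose k := n%:R * ((n%:R * (M * 1)) * M) + 1.
have k0 : 0 <= n%:R * ((n%:R * (M * 1)) * M) by rewrite !mulr_ge0.
apply: (@eq0_small _ k); first by rewrite addr_ge0.
move=> d d0; have [Q hQ] := near_min_exists d0.
have c1 : mxbound (center - Q) d.
  by move=> a b; have := center_close d0 hQ a b; rewrite !mxE distrC.
have c2 := center_close d0 (near_min_act Gg hQ) i j.
have c3 : mxbound (congr_act g (center - Q)) (n%:R * ((n%:R * (M * d)) * M)).
  apply: mxboundM; [by rewrite !mulr_ge0 // ltW| |exact: Gbound].
  by apply: mxboundM => //; apply: mxbound_tr; apply: Gbound.
have := c3 i j; move: c2.
have -> : congr_act g (center - Q) = congr_act g center - congr_act g Q.
  by rewrite -[- Q]scaleN1r congr_actD congr_actZ scaleN1r.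
have sub (A B : 'M[R]_n) : (A - B) i j = A i j - B i j by rewrite !mxE.
rewrite !sub /k => c2 {}c3.
rewrite -(subrKA (congr_act g Q i j)) (le_trans (ler_normD _ _)) // mulrDl mul1r lerD //.
by apply: le_trans c3 _; rewrite -!mulrA !mul1r [M * d]mulrC mulrCA [d * M]mulrC !mulrA.
Qed.

Let center_pos (v : 'cV_n) : (v^T *m v) 0 0 <= (v^T *m center *m v) 0 0.
Proof.
have [b b0 hb] := mxbound_exists v.
pose k := n%:R * ((n%:R * (b * 1)) * b).
have k0 : 0 <= k by rewrite !mulr_ge0.
apply/ler_addgt0Pl => e e0; pose d := e / (k + 1).
have k1 : 0 < k + 1 by rewrite ltr_wpDl.
have d0 : 0 < d by rewrite divr_gt0.
have [Q hQ] := near_min_exists d0.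
have := hQ.1 _ G1 v; rewrite {1}/congr_act trmx1 mul1mx mulmx1 => h1.
have c3 : mxbound (v^T *m (Q - center) *m v) (n%:R * ((n%:R * (b * d)) * b)).
  have bd0 : 0 <= n%:R * (b * d) by rewrite mulr_ge0 // mulr_ge0 // ltW.
  exact: mxboundM bd0 (mxboundM b0 (mxbound_tr hb) (center_close d0 hQ)) hb.
have := c3 0 0; rewrite mulmxBr mulmxBl.
have sub (A B : 'M[R]_1) : (A - B) 0 0 = A 0 0 - B 0 0 by rewrite !mxE.
rewrite sub => c4.
have kd : n%:R * ((n%:R * (b * d)) * b) <= e.
  have -> : n%:R * ((n%:R * (b * d)) * b) = k * d by rewrite /k; ring.
  rewrite /d mulrA ler_pdivrMr // mulrC ler_wpM2l ?lerDl //; exact: ltW.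
move: c4; rewrite ler_norml => /andP[_ c4]; lra.
Qed.

Lemma invariant_form_exists : exists Q : 'M[R]_n, [/\ Q^T = Q,
  forall v : 'cV_n, v != 0 -> 0 < (v^T *m Q *m v) 0 0 &
  forall g, G g -> g^T *m Q *m g = Q].
Proof.
(* Symmetry was not imposed in the minimization; adding the transpose provides it and keeps
   invariance and positivity. *)
exists (center + center^T); split.
- by rewrite linearD /= trmxK addrC.
- move=> v v0; rewrite mulmxDr mulmxDl [X in _ < X]mxE.
  have -> : v^T *m center^T *m v = (v^T *m center *m v)^T.
    by rewrite !trmx_mul trmxK mulmxA.
  rewrite [X in _ + X]mxE; have := center_pos v.
  suff : 0 < (v^T *m v) 0 0 by lra.
  rewrite frob_col lt_def frob_ge0 andbT; apply: contra_neq v0 => f0.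
  apply/colP => i; rewrite mxE; apply/eqP; rewrite -sqrf_eq0 eq_le sqr_ge0 andbT.
  by rewrite -f0 frob_entry.
- move=> g Gg; have cg := center_invariant Gg.
  rewrite mulmxDr mulmxDl; congr (_ + _); first exact: cg.
  by rewrite -[in RHS]cg /congr_act !trmx_mul trmxK mulmxA.
Qed.
End Averaging.

(** Invariance under exp(t x) is differentiated at 0 by estimates. Put exp(t x) = 1 + t Y and Y = x
    + t W, with W bounded uniformly by [expmx_dist1]; dividing the invariance equation by t leaves
    x^T Q + Q x = O(t). *)
Lemma compact_lie_invariant_form n (h : {vspace 'M[R]_n}) :
  compact_linear_lie_algebra h -> exists Q : 'M[R]_n, [/\ Q^T = Q,
    forall v : 'cV_n, v != 0 -> 0 < (v^T *m Q *m v) 0 0 &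
    {in h, forall x, x^T *m Q + Q *m x = 0}].
Proof.
move=> [_ [G [[Gu G1 GM GV] cG hG]]].
have [M M0 Gb] : exists2 M, 0 <= M & forall g, G g -> mxbound g M.
  have [M0 [_ hM]] := compact_bounded cG.
  exists (`|M0| + 1); first by rewrite addr_ge0.
  move=> g Gg i j; have M01 : M0 < `|M0| + 1.
    by rewrite (le_lt_trans (ler_norm _)) // ltrDl.
  apply: le_trans (hM _ M01 g Gg).
  rewrite [leRHS]/Num.Def.normr /= mx_normrE.
  exact: (le_bigmax _ (fun ij => `|g ij.1 ij.2|) (i, j)).
have [Q [Qs Qp Qi]] := invariant_form_exists M0 Gb G1 GM GV Gu.
exists Q; split=> // x xh.
have [b hb] := rowsum_bound_exists x.
have [cx cx0 hx] := mxbound_exists x; have [cq cq0 hq] := mxbound_exists Q.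
apply/matrixP => i j; rewrite [RHS]mxE.
pose w := expR b; have w0 : 0 <= w := expR_ge0 b.
pose y := cx + w.
pose k := n%:R * (w * cq) + n%:R * (cq * w) + n%:R * (n%:R * (y * cq) * y).
have y0 : 0 <= y by rewrite addr_ge0.
have k0 : 0 <= k by rewrite !addr_ge0 ?mulr_ge0.
suff small t : 0 < t -> t <= 1 -> `|(x^T *m Q + Q *m x) i j| <= k * t.
  apply: (@eq0_small _ k k0) => d d0; have [d1|d1] := leP d 1; first exact: small.
  by apply: le_trans (small 1 _ _) _ => //; rewrite ler_wpM2l // ltW.
move=> t0 t1; set E := expmx (t *: x).
have GE : G E by apply: (hG x).1.
pose W := (t ^+ 2)^-1 *: (E - (1%:M + t *: x)).
have t2 : t ^+ 2 != 0 by rewrite expf_neq0 // gt_eqF.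
have Wb : mxbound W w.
  move=> k' l; have := @expmx_dist1 _ _ x t b k' l hb; rewrite gtr0_norm // => /(_ t1).
  rewrite -/E !mxE => hE; rewrite normrM ger0_norm ?invr_ge0 ?sqr_ge0 //.
  by rewrite ler_pdivrMl ?exprn_gt0.
pose Y := x + t *: W.
have EE : E = 1%:M + t *: Y.
  rewrite /Y scalerDr scalerA -expr2 /W scalerA divff // scale1r addrA.
  by rewrite [RHS]addrC subrK.
have Yb : mxbound Y y.
  apply: mxboundD => // k' l; rewrite mxE normrM gtr0_norm //.
  by rewrite -[leRHS]mul1r; apply: ler_pM; [exact: ltW|exact: normr_ge0|exact: t1|exact: Wb].
have YE : Y = x + t *: W by [].
clearbody Y W E.
have key : Y^T *m Q + Q *m Y + t *: (Y^T *m Q *m Y) = 0.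
  set P := (_ + _ + _); have : Q + t *: P = Q.
    have ET : (1%:M + t *: Y)^T = 1%:M + t *: Y^T by rewrite linearD /= linearZ /= trmx1.
    rewrite -[RHS](Qi E GE) EE ET /P.
    rewrite !mulmxDl !mulmxDr !mul1mx !mulmx1 -!scalemxAl -!scalemxAr !scalerDr.
    by rewrite -!addrA; congr (_ + _); rewrite addrCA.
  move=> /eqP; rewrite -subr_eq0 addrAC subrr add0r scaler_eq0 gt_eqF //=.
  by move=> /eqP.
have -> : x^T *m Q + Q *m x = - t *: (W^T *m Q + Q *m W + Y^T *m Q *m Y).
  have xE : x = Y - t *: W by rewrite YE addrK.
  have {}key : Y^T *m Q + Q *m Y = - (t *: (Y^T *m Q *m Y)).
    by apply/eqP; rewrite -addr_eq0 key.
  rewrite {1 2}xE linearB /= linearZ /= mulmxBl mulmxBr -scalemxAl -scalemxAr.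
  rewrite addrACA key -opprD -opprD -!scalerDr scaleNr; congr (- (_ *: _)).
  by rewrite addrC.
rewrite mxE normrM normrN (gtr0_norm t0) [leRHS]mulrC.
apply: ler_wpM2l; first exact: ltW.
have QY := mxboundM y0 (mxbound_tr Yb) hq.
have yq : 0 <= n%:R * (y * cq) by rewrite !mulr_ge0.
apply: mxboundD (mxboundM yq QY Yb) i j.
exact: mxboundD (mxboundM w0 (mxbound_tr Wb) hq) (mxboundM cq0 hq Wb).
Qed.
End InvariantForm.

(** * Commutants and normal forms *)

Section NormalForms.
Variable C : numClosedFieldType.

Lemma mulmx_deltaE m (s : 'M[C]_m) (i j k l : 'I_m) : (s *m delta_mx i j) k l = s k i * (l == j)%:R.
Proof.
rewrite mxE (bigD1 i) //= big1 => [|p /negPf pi]; rewrite !mxE ?eqxx ?pi ?addr0 //.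
by rewrite /= mulr0.
Qed.

Lemma delta_mulmxE m (s : 'M[C]_m) (i j k l : 'I_m) : (delta_mx i j *m s) k l = (k == i)%:R * s j l.
Proof.
rewrite mxE (bigD1 j) //= big1 => [|p /negPf pi]; rewrite !mxE ?eqxx ?pi ?addr0 ?andbT //.
by rewrite andbF mul0r.
Qed.

Lemma invmx_mul m (A B : 'M[C]_m) : A \in unitmx -> B \in unitmx ->
  invmx (A *m B) = invmx B *m invmx A.
Proof.
move=> Au Bu; have ABu : A *m B \in unitmx by rewrite unitmx_mul Au.
apply: (can_inj (mulKmx ABu)).
by rewrite mulmxV // -mulmxA mulKVmx // mulmxV.
Qed.

Lemma commutant_gl m (s : 'M[C]_m) : (forall z, s *m z = z *m s) ->
  exists c, s = c%:M.
Proof.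
case: m s => [|m] s h; first by exists 0; apply/matrixP => -[].
exists (s ord0 ord0); apply/matrixP => i j; rewrite mxE.
have /matrixP/(_ i ord0) := h (delta_mx j ord0).
rewrite mulmx_deltaE delta_mulmxE eqxx mulr1 => ->.
by case: eqP; rewrite ?mul1r ?mul0r.
Qed.

(** The conclusion of Schur's lemma for the tautological representation, isolated so that so and sp
    can share the arguments below. *)
Definition form_commutant_scalar m (B : 'M[C]_m) : Prop :=
  forall s, (forall z, preserves_form B z -> s *m z = z *m s) -> exists c, s = c%:M.

(** Commutation is tested on E_ij - E_ji. Killing an off-diagonal entry uses a third index, hence m
    > 2; the commutative so_2 is its own commutant up to scalars. *)
Lemma commutant_so m : (2 < m)%N -> form_commutant_scalar (1%:M : 'M[C]_m).
Proof.
move=> m2 s h.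
have sub (A B : 'M[C]_m) i j : (A - B) i j = A i j - B i j by rewrite !mxE.
have hij (i j k l : 'I_m) : s k i * (l == j)%:R - s k j * (l == i)%:R =
    (k == i)%:R * s j l - (k == j)%:R * s i l.
  have /h/matrixP/(_ k l) : preserves_form (1%:M : 'M[C]_m) (delta_mx i j - delta_mx j i).
    by rewrite /preserves_form mul1mx mulmx1 linearB /= !trmx_delta addrC subrKA subrr.
  by rewrite mulmxBr mulmxBl !sub !mulmx_deltaE !delta_mulmxE.
have third (i j : 'I_m) : exists k : 'I_m, (k != i) && (k != j).
  have : (0 < #|~: [set i; j]|)%N.
    rewrite cardsCs finset.setCK subn_gt0 card_ord (leq_ltn_trans _ m2) //.
    by rewrite cards2; case: eqP.
  by move=> /card_gt0P[k]; rewrite !inE negb_or => ?; exists k.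
have off k i : k != i -> s k i = 0.
  move=> ki; have [j /andP[jk ji]] := third k i.
  have := hij i j k j; rewrite eqxx (negPf ji) (negPf ki) eq_sym in jk *.
  by rewrite (negPf jk) !mul0r mulr1 mulr0 !subr0.
have diag i j : i != j -> s i i = s j j.
  move=> ij; have ji : j != i by rewrite eq_sym.
  have := hij i j i j; rewrite !eqxx (negPf ij) (negPf ji).
  by rewrite !mul0r mulr0 mulr1 mul1r !subr0.
have m0 : (0 < m)%N by case: (m) m2.
exists (s (Ordinal m0) (Ordinal m0)); apply/matrixP => i j; rewrite mxE.
have [<-|ij] := eqVneq i j; last by rewrite off.
by rewrite mulr1n; have [->|/diag] := eqVneq i (Ordinal m0).
Qed.

Definition sympl m : 'M[C]_(m + m) := block_mx 0 1%:M (- 1%:M) 0.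

(** Three kinds of test elements: the nilpotent blocks (0 1; 0 0) and (0 0; 1 0) reduce s to diag(a,
    a), and then diag(z, -z^T) shows that a commutes with every z. *)
Lemma commutant_sp m : form_commutant_scalar (sympl m).
Proof.
move=> s; rewrite -[s]submxK; set a := ulsubmx s; set b := ursubmx s.
set c := dlsubmx s; set d := drsubmx s; clearbody a b c d => h.
have /eq_block_mx[_ ad _ c0] : block_mx (a *m 0 + b *m 0) (a *m 1%:M + b *m 0)
   (c *m 0 + d *m 0) (c *m 1%:M + d *m 0) =
   block_mx (0 *m a + 1%:M *m c) (0 *m b + 1%:M *m d)
   (0 *m a + 0 *m c) (0 *m b + 0 *m d).
  rewrite -!mulmx_block; apply: h; rewrite /preserves_form tr_block_mx !mulmx_block.
  rewrite !(trmx0, trmx1, mulmx0, mul0mx, mulmx1, mul1mx, addr0, add0r, mulmxN, mulNmx, oppr0).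
  by rewrite add_block_mx !(addr0, add0r, addNr, subrr) block_mx0.
have /eq_block_mx[b0 _ _ _] : block_mx (a *m 0 + b *m 1%:M) (a *m 0 + b *m 0)
   (c *m 0 + d *m 1%:M) (c *m 0 + d *m 0) =
   block_mx (0 *m a + 0 *m c) (0 *m b + 0 *m d)
   (1%:M *m a + 0 *m c) (1%:M *m b + 0 *m d).
  rewrite -!mulmx_block; apply: h; rewrite /preserves_form tr_block_mx !mulmx_block.
  rewrite !(trmx0, trmx1, mulmx0, mul0mx, mulmx1, mul1mx, addr0, add0r, mulmxN, mulNmx, oppr0).
  by rewrite add_block_mx !(addr0, add0r, addNr, subrr) block_mx0.
rewrite !(mulmx0, mul0mx, mulmx1, mul1mx, addr0, add0r) in ad c0 b0.
have [k aE] : exists k, a = k%:M.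
  apply: commutant_gl => z.
  have /eq_block_mx[az _ _ _] : block_mx (a *m z + b *m 0) (a *m 0 + b *m - z^T)
     (c *m z + d *m 0) (c *m 0 + d *m - z^T) =
     block_mx (z *m a + 0 *m c) (z *m b + 0 *m d)
     (0 *m a + - z^T *m c) (0 *m b + - z^T *m d).
    rewrite -!mulmx_block; apply: h; rewrite /preserves_form tr_block_mx !mulmx_block.
    have zT : (- z^T)^T = - z by rewrite linearN /= trmxK.
    rewrite !(trmx0, zT, mulmx0, mul0mx, mulmx1, mul1mx, addr0, add0r, mulmxN, mulNmx, opprK, oppr0).
    by rewrite add_block_mx !(addr0, add0r, addNr, subrr) block_mx0.
  by move: az; rewrite mulmx0 mul0mx !addr0.
by exists k; rewrite b0 c0 -ad aE -scalar_mx_block.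
Qed.

(** Both T and B intertwine the representation with its dual, so B^-1 T = B^T T commutes with the
    algebra: an invariant bilinear form is unique up to a scalar. *)
Lemma form_intertwiner m (B T : 'M[C]_m) : B^T *m B = 1%:M ->
  form_commutant_scalar B ->
  (forall z, preserves_form B z -> z^T *m T + T *m z = 0) ->
  exists c, T = c *: B.
Proof.
move=> BtB cB h; have BBt : B *m B^T = 1%:M by apply: mulmx1C.
have [|c sE] := cB (B^T *m T).
  move=> z hz; have e1 : T *m z = - (z^T *m T).
    by apply/eqP; rewrite -addr_eq0 addrC h.
  have e2 : B^T *m z^T = - (z *m B^T).
    have zB : z^T *m B = - (B *m z) by apply/eqP; rewrite -addr_eq0; apply/eqP.
    rewrite -[z^T]mulmx1 -BBt [z^T *m (B *m _)]mulmxA zB mulNmx mulmxN !mulmxA BtB.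
    by rewrite mul1mx.
  by rewrite -mulmxA e1 mulmxN !mulmxA e2 mulNmx opprK.
exists c; rewrite -[T]mul1mx -BBt -mulmxA sE mul_mx_scalar.
by [].
Qed.

(** If y normalizes the algebra, y^T B + B y is again an invariant form, hence c B; subtracting c/2
    from y makes it vanish. *)
Lemma form_normalizer m (B y : 'M[C]_m) : B^T *m B = 1%:M ->
  form_commutant_scalar B ->
  (forall z, preserves_form B z -> preserves_form B (y *m z - z *m y)) ->
  exists c, preserves_form B (y - c%:M).
Proof.
move=> BtB cB h; have [|c TE] := @form_intertwiner _ B (y^T *m B + B *m y) BtB cB.
  move=> z hz; have := h z hz; rewrite /preserves_form in hz *.
  have zB : z^T *m B = - (B *m z) by apply/eqP; rewrite -addr_eq0; apply/eqP.
  rewrite linearB /= !trmx_mul mulmxBl mulmxBr !mulmxDr !mulmxDl => <-.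
  rewrite -(mulmxA y^T z^T B) zB mulmxN opprK !mulmxA.
  by rewrite zB mulNmx -!addrA; congr (_ + _); rewrite addrC -addrA.
exists (2^-1 * c); rewrite /preserves_form linearB /= tr_scalar_mx mulmxBl mulmxBr.
rewrite addrACA TE mul_scalar_mx mul_mx_scalar -opprD -scalerDl -mulrDl.
rewrite -[2^-1]mul1r -mulrDl [_ / _](_ : _ = 1) ?mul1r ?subrr //.
by rewrite -[1 + 1]/(2%:R) divff // pnatr_eq0.
Qed.

(** H is a form on the dual space, hence the shape y H + H y^*. A factor mu is allowed because a
    change of coordinates preserving B can straighten H only up to scale. *)
Lemma trmxC_congr_skew m (g y H : 'M[C]_m) mu : g \in unitmx -> mu != 0 ->
  g *m H *m g ^t* = mu%:M ->
  (y *m H + H *m y ^t* = 0 <-> (g *m y *m invmx g) ^t* = - (g *m y *m invmx g)).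
Proof.
move=> gu mu0 gH; set Y := g *m y *m invmx g.
have gtu : g ^t* \in unitmx by rewrite unitmx_trmxC.
have e : mu *: (Y + Y ^t*) = g *m (y *m H + H *m y ^t*) *m g ^t*.
  have e1 : mu *: Y = g *m y *m H *m g ^t*.
    by rewrite -mul_mx_scalar -gH /Y !mulmxA mulmxKV.
  have e2 : mu *: Y ^t* = g *m H *m y ^t* *m g ^t*.
    by rewrite -mul_scalar_mx -gH /Y !trmxCM trmxC_inv !mulmxA mulmxK.
  by rewrite scalerDr e1 e2 mulmxDr mulmxDl !mulmxA.
split=> [h|h].
  apply/eqP; rewrite -addr_eq0 addrC; apply/eqP/(scalerI mu0).
  by rewrite e h mulmx0 mul0mx scaler0.
have : g *m (y *m H + H *m y ^t*) *m g ^t* = 0 by rewrite -e h subrr scaler0.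
move=> /(congr1 (mulmx (invmx g))); rewrite mulmx0 -mulmxA mulKmx //.
by move=> /(congr1 (mulmx^~ (invmx (g ^t*)))); rewrite mulmxK // mul0mx.
Qed.

Lemma posdefmx_normal_form m (H : 'M[C]_m) : posdefmx H ->
  exists2 g, g \in unitmx & g *m H *m g ^t* = 1%:M.
Proof.
move=> Hp; have [p pp pE] := posdefmx_sqrt Hp; have pu := posdefmx_unit pp.
exists (invmx p); first by rewrite unitmx_inv.
by rewrite trmxC_inv pp.1 -pE mulmxA mulVmx // mul1mx mulmxV.
Qed.

(* Compatibility of the hermitian form H with the bilinear form B says
   (B^T conj(H) B) H is scalar; after rescaling, uniqueness of positive square
   roots shows that sqrt H preserves B. *)
Lemma form_normal_form m (B H : 'M[C]_m) : map_mx Num.conj B = B -> B^T *m B = 1%:M ->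
  form_commutant_scalar B -> (0 < m)%N -> posdefmx H ->
  (forall z, preserves_form B z -> preserves_form B (H *m z ^t* *m invmx H)) ->
  exists g mu, [/\ g \in unitmx, mu != 0, g *m H *m g ^t* = mu%:M &
    g^T *m B *m g = B].
Proof.
move=> Br BtB cB m0 Hp adj; have BBt : B *m B^T = 1%:M by apply: mulmx1C.
have Bu : B \in unitmx by case/mulmx1_unit: BtB.
have Hu := posdefmx_unit Hp.
have HT : H^T = map_mx Num.conj H by rewrite -[in RHS]Hp.1 map_mxCK.
have BtC : B ^t* = B^T by rewrite -map_trmx Br.
(* With K = H B, the hypothesis applied to conj w says that K w K^-1 preserves B, that is, w
   preserves the form K^T B K. *)
have [lam lamE] : exists lam, (H *m B)^T *m B *m (H *m B) = lam *: B.
  apply: form_intertwiner => // w hw.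
  have wc : preserves_form B (map_mx Num.conj w).
    have := congr1 (map_mx Num.conj) hw.
    by rewrite map_mx0 map_mxD !map_mxM /= Br -map_trmx.
  have wT : w^T = - (B *m w *m B^T).
    have wB : w^T *m B = - (B *m w) by apply/eqP; rewrite -addr_eq0; apply/eqP.
    by rewrite -[w^T]mulmx1 -BBt mulmxA wB mulNmx.
  have h := adj _ wc; rewrite map_trmx map_mxCK wT mulmxN mulNmx /preserves_form in h.
  set K := H *m B; have KE : H *m (B *m w *m B^T) *m invmx H = K *m w *m invmx K.
    rewrite /K invmx_mul // (_ : invmx B = B^T) ?mulmxA //.
    by apply: (can_inj (mulKmx Bu)); rewrite mulmxV.
  have Ku : K \in unitmx by rewrite unitmx_mul Hu.
  clearbody K.
  rewrite KE linearN /= mulNmx mulmxN -opprD in h.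
  move/eqP: h; rewrite oppr_eq0 => /eqP.
  rewrite !trmx_mul trmx_inv => /(congr1 (fun X => K^T *m X *m K)).
  rewrite mulmx0 mul0mx mulmxDr mulmxDl !mulmxA mulmxV ?unitmx_tr // mul1mx.
  by rewrite mulmxKV.
pose N := B ^t* *m map_mx Num.conj H *m B.
have Np : posdefmx N by apply: posdefmx_congr_unit => //; apply: posdefmx_conj.
have NH : N *m H = lam%:M.
  have : N *m H *m B = lam *: B by rewrite -lamE /N BtC trmx_mul HT !mulmxA.
  by move=> /(congr1 (mulmx^~ B^T)); rewrite -mulmxA BBt mulmx1 -scalemxAl BBt scalemx1.
(* N = lam H^-1 with N and H^-1 both positive definite; a diagonal entry, which exists as m > 0,
   shows the sign of lam. *)
have lam0 : 0 < lam.
  have NE : N = lam *: invmx H by rewrite -[N]mulmx1 -(mulmxV Hu) mulmxA NH mul_scalar_mx.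
  have e0 : delta_mx (Ordinal m0) 0 != 0 :> 'cV[C]_m.
    by apply/eqP=> /colP/(_ (Ordinal m0)); rewrite !mxE !eqxx /= => /eqP; rewrite oner_eq0.
  have := Np.2 _ e0; rewrite NE -scalemxAr -scalemxAl mxE pmulr_lgt0 //.
  exact: (posdefmx_inv Hp).2.
pose mu := sqrtC lam; have mu0 : 0 < mu by rewrite sqrtC_gt0.
have mu1 : mu^-1 != 0 by rewrite invr_eq0 gt_eqF.
pose H1 := mu^-1 *: H; have H1p : posdefmx H1 by apply: posdefmxZ; rewrite ?invr_gt0.
have [p pp pE] := posdefmx_sqrt H1p; have pu := posdefmx_unit pp.
have ipp := posdefmx_inv pp.
pose q := B ^t* *m map_mx Num.conj p *m B.
have qp : posdefmx q by apply: posdefmx_congr_unit => //; apply: posdefmx_conj.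
(* Both are positive square roots of the inverse of [H1]; the factor mu = sqrt(lam) was chosen for
   this. The equality means p^T B p = B. *)
have qE : q = invmx p.
  apply: posdefmx_sqrt_unique => //.
  have -> : invmx p *m invmx p = invmx H1 by rewrite -invmx_mul ?pE.
  have -> : q *m q = mu^-1 *: N.
    rewrite /q BtC -!mulmxA [B *m (B^T *m _)]mulmxA BBt mul1mx [map_mx _ p *m (map_mx _ p *m _)]mulmxA.
    rewrite -map_mxM pE /H1 map_mxZ /= -scalemxAl -scalemxAr /N BtC mulmxA.
    by rewrite (CrealP _) // realV gtr0_real.
  have H1u := posdefmx_unit H1p.
  rewrite -[LHS]mulmx1 -(mulmxV H1u) mulmxA /H1 -scalemxAl -scalemxAr NH scalerA.
  rewrite -invfM -expr2 sqrtCK scale_scalar_mx mulVf ?gt_eqF //.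
  by rewrite mul1mx.
have pT : p^T = map_mx Num.conj p by rewrite -[in RHS]pp.1 map_mxCK.
have pB : p^T *m B *m p = B.
  have : q *m p = 1%:M by rewrite qE mulVmx.
  rewrite /q BtC -pT -!mulmxA => /(congr1 (mulmx B)).
  by rewrite mulmxA BBt mul1mx mulmx1 mulmxA.
exists (invmx p), mu; split; rewrite ?unitmx_inv ?gt_eqF //.
  have HE : H = mu *: (p *m p) by rewrite pE scalerA divff ?scale1r ?gt_eqF.
  rewrite trmxC_inv pp.1 HE -scalemxAr -scalemxAl mulmxA mulVmx // mul1mx mulmxV //.
  by rewrite scalemx1.
rewrite -[in LHS]pB trmx_inv !mulmxA mulVmx ?unitmx_tr // mul1mx -mulmxA mulmxV //.
by rewrite mulmx1.
Qed.

Lemma preserves_form_conj m (B g y : 'M[C]_m) : g \in unitmx ->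
  g^T *m B *m g = B ->
  (preserves_form B y <-> preserves_form B (g *m y *m invmx g)).
Proof.
move=> gu gB; rewrite /preserves_form; set Y := g *m y *m invmx g.
have e : g^T *m (Y^T *m B + B *m Y) *m g = y^T *m B + B *m y.
  rewrite /Y !trmx_mul trmx_inv mulmxDr mulmxDl !mulmxA mulmxV ?unitmx_tr // mul1mx.
  rewrite mulmxKV // gB -!mulmxA [g^T *m (B *m g)]mulmxA gB.
  by [].
split=> h; last by rewrite -e h mulmx0 mul0mx.
move: e; rewrite h => /(congr1 (mulmx^~ (invmx g))); rewrite mul0mx mulmxK //.
move=> /(congr1 (mulmx (invmx g^T))); rewrite mulmx0 mulKmx ?unitmx_tr //.
Qed.

(** Comparing entries, skewness of E_ij for the symmetric form S forces S e_i = 0, so S is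
    degenerate. *)
Lemma no_rank_one_form m (S : 'M[C]_m) (i j : 'I_m) : S^T = S -> i != j ->
  (delta_mx i j)^T *m S + S *m delta_mx i j = 0 -> S \notin unitmx.
Proof.
move=> sS ij h.
have e k l : (k == j)%:R * S i l + S k i * (l == j)%:R = 0.
  move/matrixP/(_ k l): h; rewrite trmx_delta mxE delta_mulmxE mulmx_deltaE => ->.
  by rewrite mxE.
have sym k l : S k l = S l k by rewrite -[in LHS]sS mxE.
have Sij : S j i = 0.
  have := e j j; rewrite eqxx mul1r mulr1 (sym i j) => /eqP.
  by rewrite -mulr2n mulrn_eq0 => /eqP.
have Ski k : S k i = 0.
  have [->//|kj] := eqVneq k j.
  by have := e k j; rewrite (negPf kj) mul0r add0r eqxx mulr1.
apply/negP => Su; have : S *m (delta_mx i 0 : 'cV_m) = 0.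
  by apply/colP => k; rewrite -colE !mxE Ski.
move=> /(unitmx_inj Su)/colP/(_ i); rewrite !mxE !eqxx => /eqP.
by rewrite oner_eq0.
Qed.
End NormalForms.

(** * Linear Lie algebras and complexifications *)

Section LieAlgebras.
Variable F : fieldType.

Lemma lie_bracket0P n (x y : 'M[F]_n) : lie_bracket x y = 0 <-> x *m y = y *m x.
Proof. by rewrite /lie_bracket; split=> [/subr0_eq|->]; rewrite ?subrr. Qed.

Lemma lie_bracket_suml n I (r : seq I) (f : I -> 'M[F]_n) (y : 'M[F]_n) :
  lie_bracket (\sum_(i <- r) f i) y = \sum_(i <- r) lie_bracket (f i) y.
Proof. by rewrite /lie_bracket mulmx_suml mulmx_sumr sumrB. Qed.

Lemma lie_bracket_sumr n I (r : seq I) (f : I -> 'M[F]_n) (y : 'M[F]_n) :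
  lie_bracket y (\sum_(i <- r) f i) = \sum_(i <- r) lie_bracket y (f i).
Proof. by rewrite /lie_bracket mulmx_suml mulmx_sumr sumrB. Qed.

Lemma lie_bracketZl n a (x y : 'M[F]_n) : lie_bracket (a *: x) y = a *: lie_bracket x y.
Proof. by rewrite /lie_bracket -scalemxAl -scalemxAr scalerBr. Qed.

Lemma lie_bracketZr n a (x y : 'M[F]_n) : lie_bracket x (a *: y) = a *: lie_bracket x y.
Proof. by rewrite /lie_bracket -scalemxAl -scalemxAr scalerBr. Qed.

Lemma lie_bracketDl n (x x' y : 'M[F]_n) :
  lie_bracket (x + x') y = lie_bracket x y + lie_bracket x' y.
Proof. by rewrite /lie_bracket mulmxDl mulmxDr opprD addrACA. Qed.

Lemma lie_bracketDr n (x y y' : 'M[F]_n) :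
  lie_bracket x (y + y') = lie_bracket x y + lie_bracket x y'.
Proof. by rewrite /lie_bracket mulmxDl mulmxDr opprD addrACA. Qed.

Lemma lie_bracket_scalar n (x y : 'M[F]_n) a b :
  lie_bracket (x + a%:M) (y + b%:M) = lie_bracket x y.
Proof.
rewrite lie_bracketDl !lie_bracketDr.
have c z d : lie_bracket z d%:M = 0 :> 'M[F]_n by rewrite /lie_bracket scalar_mxC subrr.
have c' z d : lie_bracket d%:M z = 0 :> 'M[F]_n by rewrite /lie_bracket scalar_mxC subrr.
by rewrite !c c' !addr0.
Qed.

Lemma lie_bracket_derived n (h : {vspace 'M[F]_n}) x y :
  x \in h -> y \in h -> lie_bracket x y \in derived h.
Proof.
move=> /coord_vbasis-> /coord_vbasis->; rewrite lie_bracket_suml; apply: memv_suml => i _.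
rewrite lie_bracket_sumr; apply: memv_suml => j _.
rewrite lie_bracketZl lie_bracketZr !memvZ // memv_span //.
by apply/allpairsP; exists ((vbasis h)`_i, (vbasis h)`_j); rewrite !mem_nth ?size_tuple.
Qed.

Lemma derived_sub n (h : {vspace 'M[F]_n}) : is_lie_algebra h -> (derived h <= h)%VS.
Proof.
move=> hL; apply/span_subvP => _ /allpairsP[[x y] /= [/vbasis_mem xh /vbasis_mem yh ->]].
exact: hL.
Qed.

(** Adding the line of x to t keeps it commutative, so maximality absorbs x: t is its own
    centralizer in h. *)
Lemma maximal_commutative_mem n (h t : {vspace 'M[F]_n}) x :
  maximal_commutative h t -> x \in h -> {in t, forall y, x *m y = y *m x} -> x \in t.
Proof.
move=> [th tc tmax] xh xt; have <- : (t + <[x]>)%VS = t.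
  apply: tmax; first exact: addvSl.
    by rewrite subv_add th -memvE.
  have c : forall y k, y \in t -> lie_bracket y (k *: x) = 0.
    by move=> y k yt; apply/lie_bracket0P; rewrite -scalemxAl -scalemxAr xt.
  move=> _ _ /memv_addP[y yt [_ /vlineP[k ->] ->]] /memv_addP[z zt [_ /vlineP[l ->] ->]].
  rewrite lie_bracketDl !lie_bracketDr tc // c // add0r lie_bracketZr.
  have -> : lie_bracket (k *: x) z = - lie_bracket z (k *: x) by rewrite /lie_bracket opprB.
  by rewrite c // lie_bracketZl /lie_bracket subrr !scaler0 oppr0 !addr0.
by apply: (subvP (addvSr _ _)); apply: memv_line.
Qed.

(** A line is maximal commutative exactly when it equals the centralizer of its generator; this
    trades subspaces for a single element. *)
Lemma lie_rank1P n (s : {vspace 'M[F]_n}) : lie_rank s 1 <->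
  exists x, [/\ x \in s, x != 0 & {in s, forall y, x *m y = y *m x -> exists c, y = c *: x}].
Proof.
split.
  move=> [t tmax dt]; pose x := vpick t; have xt : x \in t := memv_pick t.
  have x0 : x != 0 by rewrite vpick0 -dimv_eq0 dt.
  have tE : (<[x]> = t)%VS by apply/eqP; rewrite eqEdim dim_vline x0 dt -memvE xt.
  have [ts tc _] := tmax; exists x; split=> //; first exact: (subvP ts).
  move=> y ys xy; apply/vlineP; rewrite tE.
  apply: (maximal_commutative_mem tmax) => // z; rewrite -tE => /vlineP[k ->].
  by rewrite -scalemxAl -scalemxAr xy.
move=> [x [xs x0 xc]]; exists <[x]>%VS; last by rewrite dim_vline x0.
split; first by rewrite -memvE.
  move=> _ _ /vlineP[k ->] /vlineP[l ->].
  by rewrite lie_bracketZl lie_bracketZr /lie_bracket subrr !scaler0.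
move=> t' xt' t's t'c; apply/eqP; rewrite eqEsubv xt' andbT.
apply/subvP => y yt'; apply/vlineP; apply: xc; first exact: (subvP t's).
by apply/lie_bracket0P/t'c => //; rewrite memvE.
Qed.

Lemma sandwich_linear m n p q (P : 'M[F]_(m, n)) (Q : 'M[F]_(p, q)) :
  linear (fun x : 'M[F]_(n, p) => P *m x *m Q).
Proof. by move=> a u v; rewrite mulmxDr mulmxDl -scalemxAr -scalemxAl. Qed.

Definition sandwich m n p q (P : 'M[F]_(m, n)) (Q : 'M[F]_(p, q)) :
  'Hom('M[F]_(n, p), 'M[F]_(m, q)) :=
  linfun (HB.pack (fun x : 'M[F]_(n, p) => P *m x *m Q)
    (GRing.isLinear.Build _ _ _ _ _ (sandwich_linear P Q)) : {linear _ -> _}).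

Lemma sandwichE m n p q (P : 'M[F]_(m, n)) (Q : 'M[F]_(p, q)) x :
  sandwich P Q x = P *m x *m Q.
Proof. by rewrite lfunE. Qed.

Lemma simple_lie_iso n1 n2 (h1 : {vspace 'M[F]_n1}) (h2 : {vspace 'M[F]_n2}) :
  linear_isomorphic h1 h2 -> simple_lie h1 -> simple_lie h2.
Proof.
move=> [P [Q [PQ QP h12]]] [nc ideals].
have br1 x y : P *m lie_bracket x y *m Q = lie_bracket (P *m x *m Q) (P *m y *m Q).
  by rewrite /lie_bracket mulmxBr mulmxBl !mulmxA -!(mulmxA _ Q P) QP !mulmx1.
have br2 x y : Q *m lie_bracket x y *m P = lie_bracket (Q *m x *m P) (Q *m y *m P).
  by rewrite /lie_bracket mulmxBr mulmxBl !mulmxA -!(mulmxA _ P Q) PQ !mulmx1.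
have K1 x : Q *m (P *m x *m Q) *m P = x by rewrite !mulmxA QP mul1mx -mulmxA QP mulmx1.
have K2 x : P *m (Q *m x *m P) *m Q = x by rewrite !mulmxA PQ mul1mx -mulmxA PQ mulmx1.
have h21 y : y \in h2 -> Q *m y *m P \in h1 by move=> yh; apply/h12; rewrite K2.
split=> [c2|I [Ih Ii]].
  apply: nc => x y xh yh; rewrite -[lie_bracket x y]K1 br1 c2 ?mulmx0 ?mul0mx //; exact/h12.
have mem y : (Q *m y *m P \in (sandwich Q P @: I)%VS) = (y \in I).
  apply/idP/idP => [/memv_imgP[z zI]|yI]; last by rewrite -sandwichE memv_img.
  by rewrite sandwichE => /(congr1 (fun w => P *m w *m Q)); rewrite !K2 => ->.
have [|I0|Ih1] := ideals (sandwich Q P @: I)%VS.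
- split; first by apply/subvP => _ /memv_imgP[z zI ->]; rewrite sandwichE h21 // (subvP Ih).
  move=> x y xh; rewrite -[x]K1 -[y]K1 -br2 !mem; apply: Ii; exact/h12.
- left; apply/eqP; rewrite -subv0; apply/subvP => y; rewrite -mem I0 !memv0 => /eqP h.
  by rewrite -[y]K2 h mulmx0 mul0mx.
- right; apply/eqP; rewrite eqEsubv Ih /=; apply/subvP => y yh.
  by rewrite -mem Ih1 h21.
Qed.
End LieAlgebras.

(** * Complexification and transport to complex coordinates *)

Section Complexification.
Variable R : realType.
Local Notation C := R[i].
Local Notation emb := (map_mx (real_complex R)).
Local Notation Remx := (map_mx (@complex.Re R)).
Local Notation Immx := (map_mx (@complex.Im R)).

Lemma emb_complexification n (h : {vspace 'M[R]_n}) x :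
  x \in h -> emb x \in complexification h.
Proof.
move=> /coord_vbasis->; rewrite raddf_sum; apply: memv_suml => i _.
rewrite /= embZ memvZ // memv_span // map_f // mem_nth // size_tuple.
by [].
Qed.

Lemma complexificationP n (h : {vspace 'M[R]_n}) z :
  z \in complexification h <->
  exists x1 x2, [/\ x1 \in h, x2 \in h & z = emb x1 + 'i *: emb x2].
Proof.
split; last first.
  by move=> [x1 [x2 [h1 h2 ->]]]; rewrite memvD ?memvZ ?emb_complexification.
pose E (w : 'M[C]_n) := exists x1 x2, [/\ x1 \in h, x2 \in h & w = emb x1 + 'i *: emb x2].
rewrite /complexification => /coord_span->; apply: (big_ind E).
- by exists 0, 0; rewrite !mem0v map_mx0 scaler0 addr0.
- move=> _ _ [x1 [x2 [h1 h2 ->]]] [y1 [y2 [k1 k2 ->]]].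
  by exists (x1 + y1), (x2 + y2); rewrite !memvD // !map_mxD scalerDr addrACA.
move=> i _; set c := coord _ _ _.
have xh : (vbasis h)`_i \in h by rewrite vbasis_mem // mem_nth ?size_tuple.
rewrite /= (nth_map 0) ?size_tuple //; set x := (vbasis h)`_i in xh *.
exists (complex.Re c *: x), (complex.Im c *: x); rewrite !memvZ //; split=> //.
by rewrite !embZ scalerA -scalerDl -complex_rect.
Qed.

Lemma complexification_lie n (h : {vspace 'M[R]_n}) :
  is_lie_algebra h -> is_lie_algebra (complexification h).
Proof.
move=> hL _ _ /complexificationP[x1 [x2 [h1 h2 ->]]] /complexificationP[y1 [y2 [k1 k2 ->]]].
have mem x y : x \in h -> y \in h -> lie_bracket (emb x) (emb y) \in complexification h.
  by move=> xh yh; rewrite /lie_bracket -!map_mxM -map_mxB; apply/emb_complexification/hL.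
rewrite lie_bracketDl !lie_bracketDr !lie_bracketZl !lie_bracketZr.
have [m11 m12 m21 m22] := And4 (mem _ _ h1 k1) (mem _ _ h1 k2) (mem _ _ h2 k1) (mem _ _ h2 k2).
exact (memvD (memvD m11 (memvZ _ m12)) (memvD (memvZ _ m21) (memvZ _ (memvZ _ m22)))).
Qed.

Lemma complexification_real n (h : {vspace 'M[R]_n}) x :
  emb x \in complexification h -> x \in h.
Proof.
move=> /complexificationP[x1 [x2 [h1 h2 e]]].
have e' : emb x + 'i *: emb 0 = emb x1 + 'i *: emb x2 by rewrite map_mx0 scaler0 addr0.
by have [-> _] := emb_rect_inj e'.
Qed.

Lemma real_skew_complexification n (h : {vspace 'M[R]_n}) (Q : 'M[R]_n) z :
  {in h, forall x, x^T *m Q + Q *m x = 0} -> z \in complexification h ->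
  z^T *m emb Q + emb Q *m z = 0.
Proof.
move=> hQ /complexificationP[x1 [x2 [/hQ h1 /hQ h2 ->]]].
rewrite linearD linearZ /= mulmxDl mulmxDr -scalemxAl -scalemxAr addrACA -scalerDr.
by rewrite !map_trmx -!map_mxM -!map_mxD h1 h2 map_mx0 scaler0 addr0.
Qed.

Lemma emb_posdefmx n (Q : 'M[R]_n) : Q^T = Q ->
  (forall v : 'cV_n, v != 0 -> 0 < (v^T *m Q *m v) 0 0) -> posdefmx (emb Q).
Proof.
move=> QT Qp; split; first by rewrite trmxC_emb QT.
move=> u u0; set a := Remx u; set b := Immx u.
have uE : u = emb a + 'i *: emb b := emb_rect u.
have sym : b^T *m Q *m a = a^T *m Q *m b.
  have tr1 (M : 'M[R]_1) : M^T = M by apply/matrixP => i j; rewrite mxE !ord1.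
  by rewrite -[LHS]tr1 !trmx_mul trmxK QT mulmxA.
have -> : u ^t* *m emb Q *m u = emb (a^T *m Q *m a + b^T *m Q *m b).
  have -> : u ^t* = emb a^T - 'i *: emb b^T.
    by rewrite {1}uE trmxCD trmxCZ !trmxC_emb conjCi scaleNr.
  rewrite {1}uE mulmxBl mulmxDr !mulmxBl -!scalemxAl -!scalemxAr -!map_mxM sym.
  rewrite scalerA -expr2 sqrCi scaleN1r opprK map_mxD.
  by rewrite addrA subrK.
rewrite mxE ltcR mxE; have [a0|a0] := eqVneq a 0.
  rewrite a0 mulmx0 mxE add0r; apply: Qp; apply: contra_neq u0 => b0.
  by rewrite uE a0 b0 !map_mx0 scaler0 addr0.
rewrite ltr_wpDr ?Qp //; have [->|b0] := eqVneq b 0; first by rewrite mulmx0 mxE.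
exact/ltW/Qp.
Qed.

Definition realification_iso m n (Phi : 'M[C]_(m, n)) : Prop :=
  (forall w : 'cV[C]_m, exists v : 'cV[R]_n, Phi *m emb v = w) /\
  (forall v : 'cV[R]_n, Phi *m emb v = 0 -> v = 0).

Section Realification.
Variables (m n : nat) (Phi : 'M[C]_(m, n)).
Hypothesis PhiI : realification_iso Phi.

Lemma realify_inj p (x x' : 'M[R]_(n, p)) : Phi *m emb x = Phi *m emb x' -> x = x'.
Proof.
move=> e; apply/eqP; rewrite -subr_eq0; apply/eqP/matrixP => i j.
have /colP/(_ i) : col j (x - x') = 0.
  by apply: PhiI.2; rewrite colE map_mxM mulmxA map_mxB mulmxBr e subrr mul0mx.
by rewrite !mxE.
Qed.

Lemma realify_mx p (w : 'M[C]_(m, p)) : exists x : 'M[R]_(n, p), Phi *m emb x = w.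
Proof.
have h j : {v : 'cV[R]_n | Phi *m emb v = col j w} by apply: cid; apply: PhiI.1.
exists (\matrix_(i, j) (sval (h j)) i 0); apply/matrixP => i j.
have /colP/(_ i) := svalP (h j); rewrite [in X in _ = X -> _]mxE => <-.
by rewrite !mxE; apply: eq_bigr => k _; rewrite !mxE.
Qed.

Lemma realify_unique (y y' : 'M[C]_m) : y *m Phi = y' *m Phi -> y = y'.
Proof.
have [V VE] := realify_mx 1%:M => e.
by rewrite -[y]mulmx1 -[y']mulmx1 -VE !mulmxA e.
Qed.

Lemma complex_structure_exists : exists J : 'M[R]_n, Phi *m emb J = 'i *: Phi.
Proof. exact: realify_mx. Qed.
End Realification.

Lemma realification_iso_mul m n (g : 'M[C]_m) (Phi : 'M[C]_(m, n)) :
  g \in unitmx -> realification_iso Phi -> realification_iso (g *m Phi).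
Proof.
move=> gu [surj inj]; split=> [w|v].
  by have [v vE] := surj (invmx g *m w); exists v; rewrite -mulmxA vE mulKVmx.
by rewrite -mulmxA => /(unitmx_inj gu)/inj.
Qed.

(** [h] is a predicate and not a subspace because the compact algebras in question are only real
    subspaces of the complex matrices. *)
Definition realizes m n (gR : {vspace 'M[R]_n}) (Phi : 'M[C]_(m, n))
    (h : 'M[C]_m -> Prop) : Prop :=
  realification_iso Phi /\
  forall x, x \in gR <-> exists2 y, h y & Phi *m emb x = y *m Phi.

Lemma lie_rank_stabilizer1P n (gR : {vspace 'M[R]_n}) v :
  lie_rank (stabilizer gR v) 1 <->
  exists x, [/\ x \in gR, x != 0, x *m v = 0 &
    forall y, y \in gR -> y *m v = 0 -> x *m y = y *m x -> exists c, y = c *: x].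
Proof.
rewrite lie_rank1P; split=> [[x []]|[x [xg x0 xv xc]]].
  rewrite mem_stabilizer => /andP[xg /eqP xv] x0 xc; exists x; split=> // y yg yv.
  by apply: xc; rewrite mem_stabilizer yg yv eqxx.
exists x; split=> //; first by rewrite mem_stabilizer xg xv eqxx.
by move=> y; rewrite mem_stabilizer => /andP[yg /eqP yv]; apply: xc.
Qed.

Lemma realizes_rank_one m n (gR : {vspace 'M[R]_n}) (Phi : 'M[C]_(m, n)) h :
  realizes gR Phi h ->
  (exists v, lie_rank (stabilizer gR v) 1) <-> (exists w, rank_one_at h w).
Proof.
move=> [PhiI gRE].
have kill x y (v : 'cV[R]_n) : Phi *m emb x = y *m Phi -> x *m v = 0 <-> y *m (Phi *m emb v) = 0.
  move=> e; rewrite mulmxA -e -mulmxA -map_mxM; split=> [->|/PhiI.2 //].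
  by rewrite map_mx0 mulmx0.
have comm x y x' y' : Phi *m emb x = y *m Phi -> Phi *m emb x' = y' *m Phi ->
    x *m x' = x' *m x <-> y *m y' = y' *m y.
  move=> e e'; have e1 : Phi *m emb (x *m x') = y *m y' *m Phi.
    by rewrite map_mxM mulmxA e -mulmxA e' mulmxA.
  have e2 : Phi *m emb (x' *m x) = y' *m y *m Phi.
    by rewrite map_mxM mulmxA e' -mulmxA e mulmxA.
  split=> h'; first by apply: (realify_unique PhiI); rewrite -e1 -e2 h'.
  by apply: (realify_inj PhiI); rewrite e1 e2 h'.
have scale x y x' y' c : Phi *m emb x = y *m Phi -> Phi *m emb x' = y' *m Phi ->
    x' = c *: x <-> y' = c%:C%C *: y.
  move=> e e'; split=> [xE|yE].
    by apply: (realify_unique PhiI); rewrite -e' xE embZ -scalemxAr e scalemxAl.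
  by apply: (realify_inj PhiI); rewrite embZ -scalemxAr e e' yE scalemxAl.
split=> [[v /lie_rank_stabilizer1P[x [xg x0 xv xc]]]|[w [y [hy y0 yw yc]]]].
  have [y hy xy] := (gRE x).1 xg.
  exists (Phi *m emb v), y; split=> //; last 1 first.
  - move=> y' hy' y'v yy'; have [x' x'E] := realify_mx PhiI (y' *m Phi).
    have x'g : x' \in gR by apply/gRE; exists y'.
    have [c cE] := xc x' x'g ((kill _ _ _ x'E).2 y'v) ((comm _ _ _ _ xy x'E).2 yy').
    exists c%:C%C; first by apply/complex_realP; exists c.
    exact/(scale _ _ _ _ _ xy x'E).
  - apply: contra_neq x0 => y0; apply: (realify_inj PhiI).
    by rewrite xy y0 mul0mx map_mx0 mulmx0.
  - exact/(kill _ _ _ xy).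
have [v vE] := PhiI.1 w; exists v; apply/lie_rank_stabilizer1P.
have [x xE] := realify_mx PhiI (y *m Phi).
exists x; split.
- by apply/gRE; exists y.
- apply: contra_neq y0 => x0; apply: (realify_unique PhiI).
  by rewrite -xE x0 mul0mx map_mx0 mulmx0.
- by apply/(kill _ _ _ xE); rewrite vE.
move=> x' /gRE[y' hy' x'E] x'v xx'.
have [||c cr cE] := yc y' hy'.
- by rewrite -vE; apply/(kill _ _ _ x'E).
- exact/(comm _ _ _ _ xE x'E).
exists (complex.Re c); apply/(scale _ _ _ _ _ xE x'E).
by rewrite -realC_Re.
Qed.

(* Phi identifies (V_R, J) with C^m, J being the multiplication by 'i, and
   carries gR + J gR onto a. *)
Definition complex_span_of m n (gR : {vspace 'M[R]_n}) (Phi : 'M[C]_(m, n))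
    (a : 'M[C]_m -> Prop) : Prop :=
  [/\ realification_iso Phi,
      forall c y z, a y -> a z -> a (c *: y + z),
      forall x, x \in gR -> exists2 y, a y & Phi *m emb x = y *m Phi &
      forall y, a y -> exists x1 x2, [/\ x1 \in gR, x2 \in gR &
        y *m Phi = Phi *m emb x1 + 'i *: (Phi *m emb x2)]].

(* Phi Q^-1 Phi^* is the hermitian form on the dual space induced by the
   invariant quadratic form Q on V_R. *)
Lemma hermitian_form_exists m n (gR : {vspace 'M[R]_n}) (Phi : 'M[C]_(m, n)) a :
  compact_linear_lie_algebra gR -> complex_span_of gR Phi a ->
  exists H, [/\ posdefmx H,
    forall x, x \in gR <-> exists2 y, a y /\ y *m H + H *m y ^t* = 0 &
      Phi *m emb x = y *m Phi &
    forall y, a y -> a (H *m y ^t* *m invmx H)].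
Proof.
move=> /compact_lie_invariant_form[Q [QT Qp Qi]] [PhiI aL ag ga].
have Qpd := emb_posdefmx QT Qp; have iQ := posdefmx_inv Qpd.
have Qu := posdefmx_unit Qpd.
pose H := Phi *m invmx (emb Q) *m Phi ^t*.
have Hp : posdefmx H.
  have -> : H = (Phi ^t*) ^t* *m invmx (emb Q) *m Phi ^t* by rewrite trmxCK.
  apply: posdefmx_congr => // u Pu; have [V VE] := realify_mx PhiI (1%:M : 'M[C]_m).
  have : (Phi *m emb V) ^t* *m u = 0 by rewrite trmxCM -mulmxA Pu mulmx0.
  by rewrite VE trmxC1 mul1mx.
have Hu := posdefmx_unit Hp.
have skew x y : x \in gR -> Phi *m emb x = y *m Phi -> y *m H + H *m y ^t* = 0.
  move=> xg xy; rewrite /H !mulmxA -xy -!(mulmxA _ (Phi ^t*)) -trmxCM -xy trmxCM trmxC_emb.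
  rewrite -!mulmxA -mulmxDr [invmx _ *m (_ *m _)]mulmxA [emb x *m _]mulmxA -mulmxDl.
  suff -> : emb x *m invmx (emb Q) + invmx (emb Q) *m emb x^T = 0 by rewrite mul0mx mulmx0.
  have := congr1 (fun z => invmx (emb Q) *m emb z *m invmx (emb Q)) (Qi x xg).
  rewrite map_mx0 mulmx0 mul0mx map_mxD !map_mxM mulmxDr mulmxDl !mulmxA mulVmx // mul1mx.
  by rewrite mulmxK // addrC.
have scaleI (y : 'M[C]_m) : ('i *: y) ^t* = - ('i *: y ^t*).
  by rewrite trmxCZ conjCi scaleNr.
(* The splitting along gR + i gR is that into parts skew-adjoint and self-adjoint for H, so skewness
   of y will force y2 = 0. *)
have span y : a y -> exists y1 y2, [/\ y = y1 + 'i *: y2,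
    exists2 x1, x1 \in gR & Phi *m emb x1 = y1 *m Phi,
    y1 *m H + H *m y1 ^t* = 0, y2 *m H + H *m y2 ^t* = 0 & a y1 /\ a y2].
  move=> ay; have [x1 [x2 [g1 g2 e]]] := ga y ay.
  have [y1 a1 e1] := ag _ g1; have [y2 a2 e2] := ag _ g2.
  exists y1, y2; split=> //.
  - by apply: (realify_unique PhiI); rewrite e e1 e2 mulmxDl scalemxAl.
  - by exists x1.
  - exact: skew e1.
  - exact: skew e2.
exists H; split=> //.
  move=> x; split=> [xg|[y [ay yH] xy]].
    by have [y ay xy] := ag x xg; exists y => //; split=> //; apply: skew xy.
  have [y1 [y2 [yE [x1 g1 e1] h1 h2 _]]] := span y ay.
  have y20 : y2 = 0.
    have h3 : 'i *: (y2 *m H - H *m y2 ^t*) = 0.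
      move: yH; rewrite yE mulmxDl trmxCD scaleI mulmxDr addrACA h1 add0r.
      by rewrite mulmxN -scalemxAl -scalemxAr scalerBr.
    have h4 : y2 *m H - H *m y2 ^t* = 0.
      by move/eqP: h3; rewrite scaler_eq0 (negPf (neq0Ci _)) => /eqP.
    have h5 : y2 *m H = 0.
      have : y2 *m H *+ 2 = 0.
        by rewrite mulr2n; have := congr2 +%R h2 h4; rewrite addr0 addrACA subrr addr0.
      by rewrite -scaler_nat => /eqP; rewrite scaler_eq0 pnatr_eq0 /= => /eqP.
    by rewrite -[y2](mulmxK Hu) h5 mul0mx.
  have -> // : x = x1.
  by apply: (realify_inj PhiI); rewrite xy e1 yE y20 scaler0 addr0.
move=> y ay; have [y1 [y2 [yE _ h1 h2 [a1 a2]]]] := span y ay.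
have e1 : H *m y1 ^t* = - (y1 *m H) by apply/eqP; rewrite -addr_eq0 addrC h1.
have e2 : H *m y2 ^t* = - (y2 *m H) by apply/eqP; rewrite -addr_eq0 addrC h2.
(* The adjoint for H changes the sign of y1 and keeps i y2, so it stays in the complex space [a]. *)
have -> : H *m y ^t* *m invmx H = -1 *: y1 + 'i *: y2.
  rewrite yE trmxCD scaleI mulmxDr mulmxN -scalemxAr e1 e2 scalerN opprK.
  by rewrite mulmxDl mulNmx -scalemxAl !mulmxK // scaleN1r.
have a0 : a 0 by have := aL (-1) _ _ a1 a1; rewrite scaleN1r addNr.
by apply: (aL (-1)) => //; have := aL 'i _ _ a2 a0; rewrite addr0.
Qed.
End Complexification.

Section Realizations.
Variable R : realType.
Local Notation C := R[i].
Local Notation emb := (map_mx (real_complex R)).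
Local Notation Remx := (map_mx (@complex.Re R)).
Local Notation Immx := (map_mx (@complex.Im R)).

Lemma realizes_conj m n (gR : {vspace 'M[R]_n}) (Phi : 'M[C]_(m, n))
    (a a' : 'M[C]_m -> Prop) H g mu :
  realification_iso Phi ->
  (forall x, x \in gR <-> exists2 y, a y /\ y *m H + H *m y ^t* = 0 &
      Phi *m emb x = y *m Phi) ->
  g \in unitmx -> mu != 0 -> g *m H *m g ^t* = mu%:M ->
  (forall y, a y <-> a' (g *m y *m invmx g)) ->
  realizes gR (g *m Phi) (fun y => y ^t* = - y /\ a' y).
Proof.
move=> PhiI gRE gu mu0 gH aa'; split; first exact: realification_iso_mul.
move=> x; split=> [/gRE[y [ay yH] xy]|[Y [Ys aY] xY]].
  exists (g *m y *m invmx g); last by rewrite -[LHS]mulmxA xy !mulmxA mulmxKV.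
  by split; [apply/(trmxC_congr_skew _ gu mu0 gH)|apply/aa'].
have YE : Y = g *m (invmx g *m Y *m g) *m invmx g.
  by rewrite !mulmxA mulmxV // mul1mx mulmxK.
apply/gRE; exists (invmx g *m Y *m g).
  by split; [apply/aa'; rewrite -YE|apply/(trmxC_congr_skew _ gu mu0 gH); rewrite -YE].
by rewrite -!mulmxA -xY !mulmxA mulVmx // mul1mx.
Qed.

Section OfCompact.
Variables (m n : nat) (gR : {vspace 'M[R]_n}) (Phi : 'M[C]_(m, n)).
Hypothesis gRc : compact_linear_lie_algebra gR.

Lemma realizes_sl : complex_span_of gR Phi (fun y => \tr y = 0) ->
  exists Phi' : 'M[C]_(m, n), realizes gR Phi' (fun y => y ^t* = - y /\ \tr y = 0).
Proof.
move=> sp; have [H [Hp gRE _]] := hermitian_form_exists gRc sp.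
have [g gu gH] := posdefmx_normal_form Hp; exists (g *m Phi).
apply: (realizes_conj _ gRE gu (oner_neq0 _) gH); first by case: sp.
by move=> y; rewrite mxtrace_mulC mulmxA mulVmx // mul1mx.
Qed.

Lemma realizes_gl : complex_span_of gR Phi (fun=> True) ->
  exists Phi' : 'M[C]_(m, n), realizes gR Phi' (fun y => y ^t* = - y).
Proof.
move=> sp; have [H [Hp gRE _]] := hermitian_form_exists gRc sp.
have [g gu gH] := posdefmx_normal_form Hp; exists (g *m Phi).
have [||PhiI E] := realizes_conj _ gRE gu (oner_neq0 _) gH (a' := fun=> True).
- by case: sp.
- by move=> y; split.
split=> // x; rewrite E; split=> [[y [ys _] e]|[y ys e]]; by exists y.
Qed.

Section Form.
Variable B : 'M[C]_m.
Hypotheses (Br : map_mx Num.conj B = B) (BtB : B^T *m B = 1%:M).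
Hypotheses (cB : form_commutant_scalar B) (m0 : (0 < m)%N).

Lemma realizes_form : complex_span_of gR Phi (preserves_form B) ->
  exists Phi' : 'M[C]_(m, n), realizes gR Phi' (compact_form B).
Proof.
move=> sp; have [H [Hp gRE adj]] := hermitian_form_exists gRc sp.
have [g [mu [gu mu0 gH gB]]] := form_normal_form Br BtB cB m0 Hp adj.
exists (g *m Phi); apply: (realizes_conj _ gRE gu mu0 gH); first by case: sp.
by move=> y; apply: preserves_form_conj.
Qed.

Lemma realizes_formC :
  complex_span_of gR Phi (fun y => exists b, preserves_form B (y - b%:M)) ->
  exists Phi' : 'M[C]_(m, n), realizes gR Phi' (compact_formC B).
Proof.
move=> sp; have [H [Hp gRE adj]] := hermitian_form_exists gRc sp.
have Hu := posdefmx_unit Hp.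
(* The adjoint is known to preserve B only after subtracting a scalar; the trace, zero on both
   sides, shows that this scalar is 0. *)
have adj' z : preserves_form B z -> preserves_form B (H *m z ^t* *m invmx H).
  move=> hz; have [|b hb] := adj z; first by exists 0; rewrite raddf0 subr0.
  have tz : \tr z = 0 := preserves_form_tr BtB hz.
  have := preserves_form_tr BtB hb; rewrite linearB /= mxtrace_mulC mulmxA mulVmx // mul1mx.
  have -> : \tr (z ^t*) = (\tr z)^*.
    by rewrite /mxtrace rmorph_sum /=; apply: eq_bigr => i _; rewrite !mxE.
  rewrite tz rmorph0 sub0r mxtrace_scalar => /eqP; rewrite oppr_eq0 mulrn_eq0 eqn0Ngt m0 /=.
  by move=> /eqP b0; move: hb; rewrite b0 raddf0 subr0.
have [g [mu [gu mu0 gH gB]]] := form_normal_form Br BtB cB m0 Hp adj'.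
exists (g *m Phi).
apply: (realizes_conj (a' := fun y => exists b, preserves_form B (y - b%:M)) _ gRE gu mu0 gH).
  by case: sp.
have shift y b : g *m (y - b%:M) *m invmx g = g *m y *m invmx g - b%:M.
  by rewrite mulmxBr mulmxBl mul_mx_scalar -scalemxAl mulmxV // scalemx1.
move=> y; split=> -[b hb]; exists b.
  by have := (preserves_form_conj _ gu gB).1 hb; rewrite shift.
by apply/(preserves_form_conj _ gu gB); rewrite shift.
Qed.
End Form.
End OfCompact.

Lemma emb_ext m n (A B : 'M[C]_(m, n)) :
  (forall v : 'cV[R]_n, A *m emb v = B *m emb v) -> A = B.
Proof.
move=> h; apply/matrixP => i j; have /colP/(_ i) := h (delta_mx j 0).
have -> : emb (delta_mx j 0) = delta_mx j 0 :> 'cV[C]_n by rewrite map_delta_mx.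
by rewrite -!colE !mxE.
Qed.

Lemma complex_span_of_iso m n (gR : {vspace 'M[R]_n}) (J : 'M[R]_n)
    (a : {vspace 'M[C]_m}) :
  complex_linear_isomorphic gR J a ->
  exists Phi : 'M[C]_(m, n), complex_span_of gR Phi (fun y => y \in a).
Proof.
move=> [phi [phi_bij phiD phiZ hull_a a_hull]].
have phi0 : phi 0 = 0 by apply: (addrI (phi 0)); rewrite -phiD !addr0.
have phir (k : R) v : phi (k *: v) = k%:C%C *: phi v.
  by rewrite -phiZ /complex_scale /= scale0r addr0.
have phiJ v : phi (J *m v) = 'i *: phi v.
  by rewrite -phiZ /complex_scale /= scale0r add0r scale1r.
pose Phi : 'M[C]_(m, n) := \matrix_(i, j) phi (delta_mx j 0) i 0.
have PhiE v : Phi *m emb v = phi v.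
  have -> : v = \sum_j v j 0 *: delta_mx j 0.
    apply/colP => i; rewrite summxE (bigD1 i) //= big1 => [|j /negPf ji].
      by rewrite !mxE !eqxx mulr1 addr0.
    by rewrite !mxE eq_sym ji mulr0.
  rewrite raddf_sum mulmx_sumr (big_morph phi phiD phi0); apply: eq_bigr => j _ /=.
  rewrite phir embZ -scalemxAr; congr (_ *: _).
  have -> : emb (delta_mx j 0) = delta_mx j 0 :> 'cV[C]_n by rewrite map_delta_mx.
  by apply/colP => i; rewrite -colE !mxE.
have hull x : x \in gR -> x \in complex_hull gR J by move=> xg; apply: (subvP (addvSl _ _)).
exists Phi; split.
- split=> [w|v]; rewrite ?PhiE.
    by have [psi _ psiK] := phi_bij; exists (psi w); rewrite PhiE psiK.
  by rewrite -phi0 => /(bij_inj phi_bij).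
- by move=> c y z ya za; rewrite memvD ?memvZ.
- move=> x /hull/hull_a[y ya e]; exists y => //.
  by apply: emb_ext => v; rewrite -!mulmxA -map_mxM !PhiE.
- move=> y /a_hull[_ /memv_addP[x1 g1 [_ /memv_imgP[x2 g2 ->] ->]] e].
  exists x1, x2; split=> //; apply: emb_ext => v.
  rewrite mulmxDl -scalemxAl -!mulmxA -!map_mxM !PhiE -phiJ -phiD -e.
  by rewrite lfunE /= mulmxDl mulmxA.
Qed.

(** J is multiplication by i pulled back along [Phi]; it commutes with gR because gR acts on C^m by
    complex matrices. *)
Lemma complex_span_of_structure m n (gR : {vspace 'M[R]_n}) (Phi : 'M[C]_(m, n))
    (a : {vspace 'M[C]_m}) : complex_span_of gR Phi (fun y => y \in a) ->
  exists2 J : 'M[R]_n, invariant_complex_structure gR J & complex_linear_isomorphic gR J a.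
Proof.
move=> [PhiI _ ga ag]; have [J JE] := complex_structure_exists PhiI.
exists J.
  split.
    apply: (realify_inj PhiI); rewrite map_mxM mulmxA JE -scalemxAl JE scalerA -expr2 sqrCi.
    by rewrite map_mxN map_mx1 mulmxN mulmx1 scaleN1r.
  move=> x /ga[y _ e]; apply: (realify_inj PhiI).
  by rewrite !map_mxM !mulmxA JE e -scalemxAl e -mulmxA JE scalemxAr.
exists (fun v => Phi *m emb v); split.
- have h w : {v : 'cV[R]_n | Phi *m emb v = w} by apply: cid; apply: PhiI.1.
  exists (fun w => sval (h w)) => [v|w]; last exact: svalP (h w).
  by apply: (realify_inj PhiI); apply: svalP (h _).
- by move=> u v; rewrite map_mxD mulmxDr.
- move=> z v; rewrite /complex_scale map_mxD !embZ map_mxM mulmxDr -!scalemxAr mulmxA JE.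
  by rewrite -scalemxAl scalerA -scalerDl mulrC -complex_rect.
- move=> _ /memv_addP[x1 /ga[y1 ya1 e1] [_ /memv_imgP[x2 /ga[y2 ya2 e2] ->] ->]].
  exists (y1 + 'i *: y2); first by rewrite memvD ?memvZ.
  move=> v; rewrite map_mxM mulmxA lfunE /= map_mxD mulmxDr map_mxM mulmxA JE /=.
  by rewrite e1 -scalemxAl e2 scalemxAl -mulmxDl mulmxA.
- move=> y /ag[x1 [x2 [g1 g2 e]]]; exists (x1 + J *m x2).
    apply: memv_add => //; apply/memv_imgP; exists x2 => //.
    by rewrite lfunE.
  move=> v; rewrite map_mxM mulmxA map_mxD mulmxDr map_mxM mulmxA JE mulmxA e /=.
  by rewrite -scalemxAl.
Qed.

(** In the coordinates (a, b, c) of sl_2, the bracket vanishes exactly when all 2 by 2 minors of the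
    two coordinate vectors do, that is, when they are proportional. *)
Lemma traceless_comm2 (y z : 'M[C]_2) : \tr y = 0 -> \tr z = 0 -> y != 0 ->
  y *m z = z *m y -> exists c, z = c *: y.
Proof.
pose i0 : 'I_2 := @Ordinal 2 0 isT; pose i1 : 'I_2 := @Ordinal 2 1 isT.
have all2 (P : 'I_2 -> Prop) : P i0 -> P i1 -> forall i, P i.
  move=> p0 p1 [[|[|//]] h].
  - by rewrite (_ : Ordinal h = i0) //; apply: val_inj.
  - by rewrite (_ : Ordinal h = i1) //; apply: val_inj.
have sum2 (F : 'I_2 -> C) : \sum_i F i = F i0 + F i1.
  by rewrite !big_ord_recl big_ord0 addr0; congr (F _ + F _); apply: val_inj.
rewrite /mxtrace !sum2 => ty tz y0 /matrixP yz.
have y11 : y i1 i1 = - y i0 i0 by apply/eqP; rewrite -addr_eq0 addrC ty.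
have z11 : z i1 i1 = - z i0 i0 by apply/eqP; rewrite -addr_eq0 addrC tz.
have := yz i0 i0; have := yz i0 i1; have := yz i1 i0; rewrite !mxE !sum2 y11 z11.
set a := y i0 i0; set b := y i0 i1; set c := y i1 i0.
set p := z i0 i0; set q := z i0 i1; set r := z i1 i0 => e10 e01 e00.
have two0 (u : C) : 2 * u = 0 -> u = 0.
  by move/eqP; rewrite mulf_eq0 pnatr_eq0 => /eqP.
have h1 : a * q = b * p.
  apply/eqP; rewrite -subr_eq0; apply/eqP/two0.
  transitivity (a * q + b * - p - (p * b + q * - a)); first by ring.
  by rewrite e01 subrr.
have h2 : a * r = c * p.
  apply/eqP; rewrite -subr_eq0; apply/eqP/two0.
  transitivity (- (c * p + - a * r - (r * a + - p * c))); first by ring.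
  by rewrite e10 subrr oppr0.
have h3 : b * r = q * c by apply: (addrI (a * p)); rewrite e00; ring.
have fin k : p = k * a -> q = k * b -> r = k * c -> exists d, z = d *: y.
  move=> pE qE rE; exists k; apply/matrixP; apply: (all2 _); apply: (all2 _);
    rewrite mxE ?z11 ?y11 //; by rewrite -/p pE mulrN.
have [a0|a0] := eqVneq a 0; last first.
  apply: (fin (p / a)); first by rewrite divfK.
    by apply: (mulfI a0); rewrite h1 mulrA mulrCA divff // mulr1 mulrC.
  by apply: (mulfI a0); rewrite h2 mulrA mulrCA divff // mulr1 mulrC.
have [b0|b0] := eqVneq b 0; last first.
  apply: (fin (q / b)); last 1 first.
  - by apply: (mulfI b0); rewrite h3 mulrA mulrCA divff // mulr1.
  - by apply: (mulfI b0); rewrite -h1 a0 mul0r !mulr0.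
  - by rewrite divfK.
have [c0|c0] := eqVneq c 0; last first.
  apply: (fin (r / c)); last 1 first.
  - by rewrite divfK.
  - by apply: (mulfI c0); rewrite -h2 a0 mul0r !mulr0.
  - by rewrite b0 mulr0; apply: (mulfI c0); rewrite mulr0 mulrC -h3 b0 mul0r.
case/eqP: y0; apply/matrixP; apply: (all2 _); apply: (all2 _);
  by rewrite mxE ?y11 -/a -/b -/c ?a0 ?b0 ?c0 ?oppr0.
Qed.

(** Commuting elements are proportional over C, and skew-hermiticity makes the ratio real. This
    contradicts r > 1 in the smallest cases. *)
Lemma rank_su2 n (gR : {vspace 'M[R]_n}) (Phi : 'M[C]_(2, n)) h r :
  realizes gR Phi h -> (forall y, h y -> y ^t* = - y /\ \tr y = 0) ->
  lie_rank gR r -> (r <= 1)%N.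
Proof.
move=> [PhiI gRE] hy [t [tg tc _] <-]; rewrite leqNgt; apply/negP => t2.
pose x := vpick t; have xt : x \in t := memv_pick t.
have x0 : x != 0 by rewrite vpick0 -dimv_eq0; case: (\dim t) t2.
suff : (t <= <[x]>)%VS by move/dimvS; rewrite dim_vline x0 leqNgt t2.
apply/subvP => x' x't; apply/vlineP.
have [y /hy[ys ty] e] := (gRE x).1 (subvP tg _ xt).
have [y' /hy[ys' ty'] e'] := (gRE x').1 (subvP tg _ x't).
have y0 : y != 0.
  apply: contra_neq x0 => y0; apply: (realify_inj PhiI).
  by rewrite e y0 mul0mx map_mx0 mulmx0.
have xx' : x *m x' = x' *m x by apply/lie_bracket0P/tc.
have [|c cE] := traceless_comm2 ty ty' y0.
  apply: (realify_unique PhiI); rewrite -mulmxA -e' mulmxA -e -mulmxA -map_mxM xx'.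
  by rewrite map_mxM mulmxA e' -mulmxA e mulmxA.
have cr : c^* = c.
  have : (c^* - c) *: y = 0.
    have := ys'; rewrite cE trmxCZ ys scalerN => /oppr_inj e3.
    by rewrite scalerBl e3 subrr.
  by move=> /eqP; rewrite scaler_eq0 (negPf y0) orbF subr_eq0 => /eqP.
exists (complex.Re c); apply: (realify_inj PhiI).
rewrite e' cE embZ -scalemxAr e scalemxAl -realC_Re //.
exact/CrealP.
Qed.
End Realizations.

(** * Ranks and non-simple orthogonal algebras *)

Section OrthogonalRank.
Variable R : realType.
Local Notation C := R[i].
Local Notation emb := (map_mx (real_complex R)).
Local Notation Remx := (map_mx (@complex.Re R)).
Local Notation Immx := (map_mx (@complex.Im R)).

Variables (m n : nat) (gR : {vspace 'M[R]_n}) (Phi : 'M[C]_(m, n)).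
Hypotheses (m0 : (0 < m)%N) (gRE : realizes gR Phi (compact_formC (1%:M : 'M[C]_m))).

Let PhiI := gRE.1.

Variable V : 'M[R]_(n, m).
Hypothesis VE : Phi *m emb V = 1%:M.

(* The orthogonal component of an element of so_m (+) iR, written in V_R. *)
Definition so_part (x : 'M[R]_n) : 'M[R]_m := Remx (Phi *m emb (x *m V)).

Lemma so_part_linear : linear so_part.
Proof.
move=> k u v; rewrite /so_part mulmxDl -scalemxAl map_mxD embZ mulmxDr -scalemxAr.
by rewrite RemxD RemxZ.
Qed.

Definition so_part_hom : 'Hom('M[R]_n, 'M[R]_m) :=
  linfun (HB.pack so_part (GRing.isLinear.Build _ _ _ _ _ so_part_linear) :
    {linear 'M[R]_n -> 'M[R]_m}).

Lemma so_part_homE x : so_part_hom x = so_part x.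
Proof. by rewrite lfunE. Qed.

Lemma Re_imaginary (b : C) : b^* = - b -> complex.Re b = 0.
Proof.
move=> /(congr1 (@complex.Re R)); rewrite ReC_conj; case: b => x y /= /eqP.
by rewrite -addr_eq0 -mulr2n mulrn_eq0 => /eqP.
Qed.

Lemma so_partP x : x \in gR -> exists b, [/\ (so_part x)^T = - so_part x, b^* = - b &
  Phi *m emb x = (emb (so_part x) + b%:M) *m Phi].
Proof.
move=> /(gRE.2 x)[y /(compact_formCP (form1_orth _ _) m0)[z [b [hz bs ->]]] e].
have [z0 zE z0T] := compact_form1_real hz.
have <- : z0 = so_part x; last by exists b; split=> //; rewrite -zE.
rewrite /so_part map_mxM mulmxA e -mulmxA VE mulmx1 zE RemxD embK.
rewrite [X in _ = _ + X](_ : _ = 0) ?addr0 //.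
apply/matrixP => i j; rewrite !mxE; case: eqP => _ //=.
by rewrite mulr1n Re_imaginary.
Qed.

Lemma so_part_mem x z : Phi *m emb x = emb z *m Phi -> z^T = - z ->
  x \in gR /\ so_part x = z.
Proof.
move=> e zT; split.
  apply/gRE.2; exists (emb z) => //; rewrite -[emb z]addr0 -(raddf0 (@scalar_mx C m)).
  by apply: compact_formC_add; rewrite ?rmorph0 ?oppr0 //; apply/compact_form1_emb.
by rewrite /so_part map_mxM mulmxA e -mulmxA VE mulmx1 embK.
Qed.

Lemma center_element : exists zeta, [/\ zeta \in gR, Phi *m emb zeta = 'i *: Phi,
  zeta != 0 & so_part zeta = 0].
Proof.
have [zeta ze] := complex_structure_exists PhiI; exists zeta; split=> //.
- apply/gRE.2; exists (0 + 'i%:M); last by rewrite add0r mul_scalar_mx.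
  apply: compact_formC_add; last exact: conjCi.
  by rewrite -(map_mx0 (real_complex R)); apply/compact_form1_emb; rewrite trmx0 oppr0.
- apply/eqP => z0; move: ze; rewrite z0 map_mx0 mulmx0 => /esym/(congr1 (mulmx^~ (emb V))).
  rewrite -scalemxAl VE mul0mx => /matrixP/(_ (Ordinal m0) (Ordinal m0)).
  by rewrite !mxE eqxx mulr1n mulr1 => /eqP; rewrite (negPf (neq0Ci _)).
rewrite /so_part map_mxM mulmxA ze -scalemxAl VE -(map_mx1 (real_complex R)).
exact: Remx_i.
Qed.

Lemma so_part_comm x x' : x \in gR -> x' \in gR ->
  x *m x' = x' *m x <-> so_part x *m so_part x' = so_part x' *m so_part x.
Proof.
move=> /so_partP[b [_ _ e]] /so_partP[b' [_ _ e']].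
set z := so_part x in e *; set z' := so_part x' in e' *.
have e1 : Phi *m emb (x *m x') = (emb z + b%:M) *m (emb z' + b'%:M) *m Phi.
  by rewrite map_mxM mulmxA e -mulmxA e' mulmxA.
have e2 : Phi *m emb (x' *m x) = (emb z' + b'%:M) *m (emb z + b%:M) *m Phi.
  by rewrite map_mxM mulmxA e' -mulmxA e mulmxA.
have br : (emb z + b%:M) *m (emb z' + b'%:M) - (emb z' + b'%:M) *m (emb z + b%:M) =
   emb (z *m z' - z' *m z).
  by rewrite -[LHS]/(lie_bracket _ _) lie_bracket_scalar /lie_bracket map_mxB !map_mxM.
split=> h.
  apply/eqP; rewrite -subr_eq0; apply/eqP/(@emb_inj R m m); rewrite -br map_mx0.
  by apply/eqP; rewrite subr_eq0; apply/eqP/(realify_unique PhiI); rewrite -e1 -e2 h.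
apply: (realify_inj PhiI); rewrite e1 e2; congr (_ *m _).
by apply/eqP; rewrite -subr_eq0 br h subrr map_mx0.
Qed.

Lemma so_part_kernel zeta x : Phi *m emb zeta = 'i *: Phi -> x \in gR ->
  so_part x = 0 -> x \in <[zeta]>%VS.
Proof.
move=> ze /so_partP[b [_ bs e]] x0; apply/vlineP; exists (complex.Im b).
apply: (realify_inj PhiI); rewrite e x0 map_mx0 add0r mul_scalar_mx embZ -scalemxAr ze.
by rewrite scalerA {1}[b]complex_rect Re_imaginary // add0r mulrC.
Qed.

(** On a commutative subalgebra, [so_part] has kernel of dimension at most 1, inside the center, and
    its image is a torus of so_m. *)
Lemma soC_rank_le r : lie_rank gR r -> (2 * r.-1 <= m)%N.
Proof.
move=> [t [tg tc _] <-]; have [zeta [zg ze z0 zp]] := center_element.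
have dt := limg_ker_dim so_part_hom t.
have d1 : (\dim (t :&: lker so_part_hom) <= 1)%N.
  have : ((t :&: lker so_part_hom)%VS <= <[zeta]>)%VS.
    apply/subvP => x; rewrite memv_cap memv_ker so_part_homE => /andP[xt /eqP x0].
    by apply: so_part_kernel => //; apply: (subvP tg).
  by move/dimvS/leq_trans; apply; rewrite dim_vline leq_b1.
have d2 : (2 * \dim (so_part_hom @: t) <= m)%N.
  apply: (@skew_torus_dim R); split.
    move=> _ /memv_imgP[x /(subvP tg) /so_partP[b [h _ _]] ->].
    by rewrite so_part_homE.
  move=> _ _ /memv_imgP[x xt ->] /memv_imgP[x' xt' ->]; rewrite !so_part_homE.
  apply/so_part_comm; [exact: (subvP tg)|exact: (subvP tg)|exact/lie_bracket0P/tc].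
apply: leq_trans d2; rewrite leq_mul2l /= -dt.
by case: (\dim _) d1 => [|[|]] //= _; rewrite ?add0n ?leq_pred.
Qed.

(** A maximal commutative t contains the center. If it were spanned by [zeta] and x, two independent
    elements of so_m commuting with the part of x would lift into t, giving dimension at least 3. *)
Lemma soC_rank_neq2 : (3 < m)%N -> ~ lie_rank gR 2.
Proof.
move=> m3 [t tmax dt]; have [tg tc _] := tmax.
have [zeta [zg ze z0 zp]] := center_element.
have zt : zeta \in t.
  apply: (maximal_commutative_mem tmax) => // y /(subvP tg) yg.
  by apply: (so_part_comm zg yg).2; rewrite zp mulmx0 mul0mx.
have [x xt xz] : exists2 x, x \in t & x \notin <[zeta]>%VS.
  apply/subvPn; apply/negP => /dimvS; rewrite dt dim_vline.
  by case: (zeta == 0).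
have xg := subvP tg _ xt; have [b [sT _ _]] := so_partP xg.
have tE : (t <= <[zeta]> + <[x]>)%VS.
  have sub : (<[zeta]> + <[x]> <= t)%VS by rewrite subv_add -!memvE zt xt.
  have x0 : x != 0 by apply: contraNneq xz => ->; apply: mem0v.
  rewrite (_ : t = <[zeta]> + <[x]>)%VS //; apply/eqP; rewrite eq_sym eqEdim sub dt /=.
  rewrite dimv_disjoint_sum ?dim_vline ?z0 ?x0 //; apply/eqP; rewrite -subv0.
  apply/subvP => w; rewrite memv_cap => /andP[wz /vlineP[k wE]].
  have [k0|k0] := eqVneq k 0; first by rewrite wE k0 scale0r mem0v.
  case/negP: xz; have -> : x = k^-1 *: w by rewrite wE scalerA mulVf ?scale1r.
  by rewrite memvZ.
have hx := (compact_form1_emb (so_part x)).2 sT.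
have [|y1 [y2 [[h1 h2] [c1 c2] _ indep]]] := so_two_commuting hx (K := [::]) _ m3.
  by split.
have lift y : compact_form 1%:M y -> comm_mx (emb (so_part x)) y ->
    exists2 x', x' \in t & y = emb (so_part x').
  move=> /compact_form1_real[y0 -> y0T] cy.
  have [x' x'E] := realify_mx PhiI (emb y0 *m Phi).
  have [x'g x'p] := so_part_mem x'E y0T; exists x'; last by rewrite x'p.
  apply: (maximal_commutative_mem tmax) => // w /(subvP tE).
  move=> /memv_addP[_ /vlineP[k ->] [_ /vlineP[l ->] ->]].
  have cz : x' *m zeta = zeta *m x'.
    by apply: (so_part_comm x'g zg).2; rewrite zp mulmx0 mul0mx.
  have cx : x' *m x = x *m x'.
    apply: (so_part_comm x'g xg).2; rewrite x'p.
    by apply: (@emb_inj R m m); rewrite !map_mxM cy.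
  by rewrite mulmxDr mulmxDl -!scalemxAr -!scalemxAl cz cx.
have [x1 x1t y1E] := lift _ h1 c1; have [x2 x2t y2E] := lift _ h2 c2.
have dtt := limg_ker_dim so_part_hom t.
have d1 : (0 < \dim (t :&: lker so_part_hom))%N.
  rewrite lt0n dimv_eq0; apply/eqP => h.
  have : zeta \in (t :&: lker so_part_hom)%VS by rewrite memv_cap zt memv_ker so_part_homE zp eqxx.
  by rewrite h memv0 (negPf z0).
have d2 : (2 <= \dim (so_part_hom @: t))%N.
  have fr : free [:: so_part_hom x1; so_part_hom x2].
    rewrite free_cons span_seq1 seq1_free !so_part_homE; apply/andP; split.
      apply/vlineP => -[k kE]; have [|/eqP] := indep 1 (- k%:C%C); last by rewrite oner_eq0.
      by rewrite y1E y2E kE embZ scale1r scaleNr subrr.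
    apply/eqP => p2; have [|_ /eqP] := indep 0 1; last by rewrite oner_eq0.
    by rewrite y2E p2 map_mx0 scaler0 scale0r addr0.
  have <- : \dim <<[:: so_part_hom x1; so_part_hom x2]>>%VS = 2%N by apply/eqP.
  apply: dimvS; rewrite span_cons span_seq1 subv_add -!memvE !memv_img //.
by have := leq_add d1 d2; rewrite dtt dt.
Qed.
End OrthogonalRank.

Section NonSimple.
Variable F : numClosedFieldType.

Lemma sl1_not_simple : ~ simple_lie (sl_alg F 1).
Proof.
case=> nc _; apply: nc => x y; rewrite !mem_sl_alg.
have z (u : 'M[F]_1) : \tr u = 0 -> u = 0.
  by move=> h; apply: mx11_ext; rewrite [RHS]mxE -h trace_mx11.
by move=> /eqP/z-> /eqP/z->; rewrite /lie_bracket mul0mx subrr.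
Qed.

Lemma so_entry m (x : 'M[F]_m) i j : x \in so_alg F m -> x j i = - x i j.
Proof.
rewrite mem_so_alg => /eqP/matrixP/(_ j i); rewrite !mxE => /eqP.
by rewrite addr_eq0 => /eqP.
Qed.

Lemma so_diag m (x : 'M[F]_m) i : x \in so_alg F m -> x i i = 0.
Proof.
by move/so_entry => /(_ i i)/eqP; rewrite -addr_eq0 -mulr2n mulrn_eq0 => /eqP.
Qed.

Lemma so1_not_simple : ~ simple_lie (so_alg F 1).
Proof.
case=> nc _; apply: nc => x y hx hy.
have z (u : 'M[F]_1) : u \in so_alg F 1 -> u = 0.
  by move=> h; apply: mx11_ext; rewrite so_diag // mxE.
by rewrite (z x hx) /lie_bracket mul0mx mulmx0 subrr.
Qed.

Lemma so2_not_simple : ~ simple_lie (so_alg F 2).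
Proof.
case=> nc _; apply: nc => x y hx hy; apply/lie_bracket0P.
pose i0 : 'I_2 := @Ordinal 2 0 isT; pose i1 : 'I_2 := @Ordinal 2 1 isT.
have all2 (P : 'I_2 -> Prop) : P i0 -> P i1 -> forall i, P i.
  move=> p0 p1 [[|[|//]] h].
  - by rewrite (_ : Ordinal h = i0) //; apply: val_inj.
  - by rewrite (_ : Ordinal h = i1) //; apply: val_inj.
have sum2 (f : 'I_2 -> F) : \sum_i f i = f i0 + f i1.
  by rewrite !big_ord_recl big_ord0 addr0; congr (f _ + f _); apply: val_inj.
apply/matrixP; apply: (all2 _); apply: (all2 _); rewrite !mxE !sum2 !so_diag //;
  rewrite ?(so_entry i0 i1 hx) ?(so_entry i0 i1 hy); ring.
Qed.

(* so_4 is the sum of two copies of so_3; the ideal is the self-dual one. *)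
Lemma so4_not_simple : ~ simple_lie (so_alg F 4).
Proof.
pose i0 : 'I_4 := @Ordinal 4 0 isT; pose i1 : 'I_4 := @Ordinal 4 1 isT.
pose i2 : 'I_4 := @Ordinal 4 2 isT; pose i3 : 'I_4 := @Ordinal 4 3 isT.
pose D (x : 'M[F]_4) : 'rV[F]_3 := \row_k
  (if k == 0%N :> nat then x i0 i1 - x i2 i3 else
   if k == 1%N :> nat then x i0 i2 + x i1 i3 else x i0 i3 - x i1 i2).
have Dlin : linear D.
  move=> a u v; apply/rowP => k; rewrite !mxE; case: ifP => _; last case: ifP => _; ring.
pose f : 'Hom('M[F]_4, 'rV[F]_3) :=
  linfun (HB.pack D (GRing.isLinear.Build _ _ _ _ _ Dlin) : {linear 'M[F]_4 -> 'rV[F]_3}).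
have memI x : (x \in lker f) = [&& x i0 i1 == x i2 i3, x i0 i2 == - x i1 i3 & x i0 i3 == x i1 i2].
  rewrite memv_ker lfunE /=; apply/eqP/and3P => [/rowP h|[/eqP e1 /eqP e2 /eqP e3]].
    have := h (@Ordinal 3 0 isT); have := h (@Ordinal 3 1 isT); have := h (@Ordinal 3 2 isT).
    rewrite !mxE /= => /eqP; rewrite subr_eq0 => /eqP-> /eqP; rewrite addr_eq0 => /eqP->.
    by move=> /eqP; rewrite subr_eq0 => /eqP->; rewrite !eqxx.
  apply/rowP => k; rewrite !mxE e1 e2 e3; case: ifP => _; last case: ifP => _; by rewrite ?subrr ?addNr.
clearbody f.
have sum4 (g : 'I_4 -> F) : \sum_i g i = g i0 + g i1 + g i2 + g i3.
  rewrite !big_ord_recl big_ord0 addr0 !addrA.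
  by congr (g _ + g _ + g _ + g _); apply: val_inj.
case=> _ /(_ (so_alg F 4 :&: lker f)%VS)[].
- split; first exact: capvSl.
  move=> x y hx; rewrite !memv_cap => /andP[hy]; rewrite !memI => /and3P[/eqP y1 /eqP y2 /eqP y3].
  apply/andP; split.
    rewrite mem_so_alg /lie_bracket linearB /= !trmx_mul.
    have T (z : 'M[F]_4) : z \in so_alg F 4 -> z^T = - z.
      by rewrite mem_so_alg addrC addr_eq0 => /eqP.
    by rewrite !T // !mulmxN !mulNmx !opprK addrC subrKA subrr.
  have E z i j : z \in so_alg F 4 -> z j i = - z i j by apply: so_entry.
  have e (i j : 'I_4) : lie_bracket x y i j = (\sum_k x i k * y k j) - (\sum_k y i k * x k j).
    by rewrite /lie_bracket !mxE.
  rewrite !e !sum4 !so_diag //.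
  rewrite !(E x i0 i1, E x i0 i2, E x i0 i3, E x i1 i2, E x i1 i3, E x i2 i3) //.
  rewrite !(E y i0 i1, E y i0 i2, E y i0 i3, E y i1 i2, E y i1 i3, E y i2 i3) //.
  by rewrite y1 y2 y3; apply/and3P; split; apply/eqP; ring.
- pose x : 'M[F]_4 := delta_mx i0 i1 - delta_mx i1 i0 + (delta_mx i2 i3 - delta_mx i3 i2).
  move=> I0; have : x \in (so_alg F 4 :&: lker f)%VS.
    rewrite memv_cap memI mem_so_alg !mxE /= !subrr !addr0 !subr0 add0r oppr0 !eqxx !andbT.
    by rewrite /x !linearD /= !linearN /= !trmx_delta addrACA !subrKA !subrr addr0.
  rewrite I0 memv0 => /eqP/matrixP/(_ i0 i1)/eqP.
  by rewrite !mxE /= !subr0 addr0 oner_eq0.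
- move=> IE; pose x : 'M[F]_4 := delta_mx i0 i1 - delta_mx i1 i0.
  have : x \in so_alg F 4.
    by rewrite mem_so_alg /x linearB /= !trmx_delta addrC subrKA subrr.
  rewrite -IE memv_cap memI => /andP[_ /and3P[/eqP + _ _]].
  by rewrite !mxE /= !subr0 => /eqP; rewrite oner_eq0.
Qed.
End NonSimple.

(** * The two types of tautological representations *)

Section Classification.
Variable R : realType.
Local Notation C := R[i].
Local Notation emb := (map_mx (real_complex R)).
Local Notation Remx := (map_mx (@complex.Re R)).
Local Notation Immx := (map_mx (@complex.Im R)).

Lemma mem_so_form m (y : 'M[C]_m) : (y \in so_alg C m) <-> preserves_form 1%:M y.
Proof.
rewrite mem_so_alg /preserves_form mulmx1 mul1mx addrC.
by split=> [/eqP|->].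
Qed.

Lemma mem_sp_form m (y : 'M[C]_(m + m)) : (y \in sp_alg C m) <-> preserves_form (sympl C m) y.
Proof. by rewrite mem_sp_alg /preserves_form; split=> [/eqP|->]. Qed.

Lemma mem_soC m (y : 'M[C]_m) : (y \in (so_alg C m + <[1%:M]>)%VS) <->
  exists b, preserves_form 1%:M (y - b%:M).
Proof.
split=> [/memv_addP[z zs [_ /vlineP[b ->] ->]]|[b /mem_so_form h]].
  by exists b; rewrite scalemx1 addrK; apply/mem_so_form.
rewrite -[y](subrK b%:M); apply: memv_add => //; apply/vlineP; exists b.
by rewrite scalemx1.
Qed.

Lemma complex_span_ext m n (gR : {vspace 'M[R]_n}) (Phi : 'M[C]_(m, n)) (a a' : 'M[C]_m -> Prop) :
  (forall y, a y <-> a' y) -> complex_span_of gR Phi a -> complex_span_of gR Phi a'.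
Proof.
move=> e [PhiI aL ga ag]; split=> //.
- by move=> c y z /e ay /e az; apply/e; apply: aL.
- by move=> x /ga[y /e ay ?]; exists y.
- by move=> y /e/ag.
Qed.

Lemma sympl_real m : map_mx Num.conj (sympl C m) = sympl C m.
Proof. by rewrite /sympl map_block_mx !map_mx0 map_mxN map_mx1. Qed.

Lemma sympl_tr m : (sympl C m)^T = -1 *: sympl C m.
Proof.
rewrite /sympl tr_block_mx !trmx0 trmx1 scale_block_mx !scaler0 !scaleN1r opprK.
by rewrite linearN /= trmx1.
Qed.

Lemma sympl_orth m : (sympl C m)^T *m sympl C m = 1%:M.
Proof.
rewrite sympl_tr -scalemxAl /sympl mulmx_block.
rewrite !(mulmx0, mul0mx, mulmx1, mul1mx, addr0, add0r, mulmxN, mulNmx).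
by rewrite scale_block_mx !scaler0 scaleN1r opprK -scalar_mx_block.
Qed.

(** * The listed algebras have a stabilizer of rank one *)

Section Converse.
Variables (n : nat) (gR : {vspace 'M[R]_n}) (J : 'M[R]_n).
Hypothesis gRc : compact_linear_lie_algebra gR.

Lemma so_stabilizer_rank1 m : m = 3%N \/ m = 5%N ->
  complex_linear_isomorphic gR J (so_alg C m + <[1%:M]>)%VS ->
  exists v, lie_rank (stabilizer gR v) 1.
Proof.
move=> m35 /complex_span_of_iso[Phi /(complex_span_ext (@mem_soC m)) sp].
have [m0 m2] : (0 < m)%N /\ (2 < m)%N by case: m35 => ->.
have [Phi' /realizes_rank_one ->] :=
  realizes_formC gRc (form1_real C m) (form1_orth C m) (commutant_so m2) m0 sp.
by clear sp; case: m35 => ->; [exact: so3C_rank_one|exact: so5C_rank_one].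
Qed.

Lemma sl_stabilizer_rank1 : complex_linear_isomorphic gR J (sl_alg C 3) ->
  exists v, lie_rank (stabilizer gR v) 1.
Proof.
move=> /complex_span_of_iso[Phi sp].
have {}sp : complex_span_of gR Phi (fun y => \tr y = 0).
  by apply: complex_span_ext sp => y; rewrite mem_sl_alg; split=> [/eqP|->].
have [Phi' /realizes_rank_one ->] := realizes_sl gRc sp.
exact: sl3_rank_one.
Qed.

Lemma gl_stabilizer_rank1 : complex_linear_isomorphic gR J (gl_alg C 2) ->
  exists v, lie_rank (stabilizer gR v) 1.
Proof.
move=> /complex_span_of_iso[Phi sp].
have {}sp : complex_span_of gR Phi (fun=> True).
  by apply: complex_span_ext sp => y; rewrite memvf.
have [Phi' /realizes_rank_one ->] := realizes_gl gRc sp.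
exact: gl2_rank_one.
Qed.

Lemma sp_stabilizer_rank1 : complex_linear_isomorphic gR J (sp_alg C 2) ->
  exists v, lie_rank (stabilizer gR v) 1.
Proof.
move=> /complex_span_of_iso[Phi /(complex_span_ext (@mem_sp_form 2)) sp].
have [Phi' /realizes_rank_one ->] :=
  realizes_form gRc (sympl_real 2) (sympl_orth 2) (@commutant_sp C 2) isT sp.
exact: sp4_rank_one.
Qed.
End Converse.

(** [Phi] is the R-component of the isomorphism. Its kernel on real vectors is invariant and proper,
    hence 0 by irreducibility, and n = 2m gives surjectivity. Its kernel on complex vectors
    witnesses reducibility of g. *)
Lemma taut_sum_realization n m (gR : {vspace 'M[R]_n}) (rho : 'Hom('M[C]_n, 'M[C]_m)) :
  irreducible gR -> (0 < m)%N ->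
  representations_isomorphic (complexification gR) id
    (representation_sum rho (dual_representation rho)) ->
  reducible (complexification gR) /\
  exists Phi : 'M[C]_(m, n), realification_iso Phi /\
    {in complexification gR, forall x, Phi *m x = rho x *m Phi}.
Proof.
move=> [n0 irr] m0 [P [Q [PQ QP Pg]]].
have nm : n = (m + m)%N by apply/eqP; rewrite eqn_leq (mulmx1_min PQ) (mulmx1_min QP).
pose Phi := usubmx P.
have PhiQ : Phi *m Q = row_mx 1%:M 0.
  by rewrite /Phi mul_usub_mx PQ scalar_mx_block block_mxEv col_mxKu.
have Phig : {in complexification gR, forall x, Phi *m x = rho x *m Phi}.
  move=> x xg; rewrite {1}/Phi mul_usub_mx Pg // /representation_sum -[P in LHS]vsubmxK.
  by rewrite mul_block_col col_mxKu mul0mx addr0.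
have i0 : 'I_m by exists 0%N.
have Phi0 : Phi != 0.
  apply/eqP => h; move: PhiQ; rewrite h mul0mx => /(congr1 lsubmx).
  rewrite row_mxKl => /matrixP/(_ i0 i0); rewrite !mxE eqxx => /eqP.
  by rewrite eq_sym oner_eq0.
have fE (v : 'cV[C]_n) : (v \in lker (linfun (mulmx Phi : 'cV_n -> 'cV_m))) = (Phi *m v == 0).
  by rewrite memv_ker lfunE.
split.
  exists (lker (linfun (mulmx Phi : 'cV_n -> 'cV_m))); split.
  - move=> x u xg; rewrite !fE mulmxA Phig // => /eqP h.
    by rewrite -mulmxA h mulmx0.
  - move=> h; have : Q *m col_mx 0 (delta_mx i0 0) \in
        lker (linfun (mulmx Phi : 'cV_n -> 'cV_m)).
      by rewrite fE mulmxA PhiQ mul_row_col mulmx0 mul0mx addr0.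
    rewrite h memv0 => /eqP/(congr1 (mulmx P)); rewrite mulmxA PQ mul1mx mulmx0.
    move=> /(congr1 dsubmx); rewrite col_mxKd linear0 => /colP/(_ i0); rewrite !mxE !eqxx => /eqP.
    by rewrite oner_eq0.
  - move=> h; case/eqP: Phi0; apply/matrixP => i j.
    have : (delta_mx j 0 : 'cV[C]_n) \in lker (linfun (mulmx Phi : 'cV_n -> 'cV_m)).
      by rewrite h memvf.
    by rewrite fE -colE => /eqP/colP/(_ i); rewrite !mxE.
pose W : 'M[R]_(m + m, n) := col_mx (Remx Phi) (Immx Phi).
have WE (v : 'cV[R]_n) : Phi *m emb v = emb (Remx Phi *m v) + 'i *: emb (Immx Phi *m v).
  by rewrite {1}(emb_rect Phi) mulmxDl -scalemxAl -!map_mxM.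
have W0 (v : 'cV[R]_n) : (W *m v == 0) = (Phi *m emb v == 0).
  rewrite /W mul_col_mx WE; apply/eqP/eqP.
    move=> h; have := congr1 dsubmx h; have := congr1 usubmx h.
    by rewrite col_mxKu col_mxKd !linear0 => -> ->; rewrite map_mx0 scaler0 addr0.
  have z0 : (0 : 'cV[C]_m) = emb 0 + 'i *: emb 0 by rewrite map_mx0 scaler0 addr0.
  by rewrite {1}z0 => /emb_rect_inj[-> ->]; rewrite col_mx0.
have gE (v : 'cV[R]_n) : (v \in lker (linfun (mulmx W : 'cV_n -> 'cV_(m + m)))) = (Phi *m emb v == 0).
  by rewrite memv_ker lfunE -W0.
have ker0 : lker (linfun (mulmx W : 'cV_n -> 'cV_(m + m))) = 0%VS.
  apply/eqP/negPn/negP => k0; apply: irr.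
  exists (lker (linfun (mulmx W : 'cV_n -> 'cV_(m + m)))); split; last 2 first.
  - by apply/eqP.
  - move=> h; case/eqP: Phi0; apply: (@emb_ext R) => v; rewrite mul0mx.
    by apply/eqP; rewrite -gE h memvf.
  - move=> x u xg; rewrite !gE map_mxM mulmxA Phig ?emb_complexification // => /eqP h.
    by rewrite -mulmxA h mulmx0.
have inj (v : 'cV[R]_n) : Phi *m emb v = 0 -> v = 0.
  by move=> /eqP; rewrite -gE ker0 memv0 => /eqP.
exists Phi; split=> //; split=> // w.
have rW : row_free W.
  rewrite /row_free -mxrank_tr; have : row_free W^T.
    apply: inj_row_free => v vW; apply: trmx_inj; rewrite trmx0; apply: inj.
    by apply/eqP; rewrite -W0 -[W]trmxK -trmx_mul vW trmx0.
  by rewrite /row_free => /eqP->; rewrite nm.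
have /row_freeP[W' WW'] := rW.
exists (W' *m col_mx (Remx w) (Immx w)).
have : W *m (W' *m col_mx (Remx w) (Immx w)) = col_mx (Remx w) (Immx w).
  by rewrite mulmxA WW' mul1mx.
by rewrite WE {1}/W mul_col_mx => /eq_col_mx[-> ->]; rewrite -emb_rect.
Qed.

(** In coordinates where the image of [g, g] is the standard s, let [a] be the image of all of g; it
    normalizes s because brackets of g with [g, g] stay in [g, g]. *)
Lemma taut_sum_span n m k (gR : {vspace 'M[R]_n}) (rho : 'Hom('M[C]_n, 'M[C]_m))
    (s : {vspace 'M[C]_k}) (Phi : 'M[C]_(m, n)) :
  is_lie_algebra gR -> is_representation (complexification gR) rho ->
  realification_iso Phi ->
  {in complexification gR, forall x, Phi *m x = rho x *m Phi} ->
  linear_isomorphic (rho @: derived (complexification gR))%VS s ->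
  exists (Phi' : 'M[C]_(k, n)) (a : 'M[C]_k -> Prop),
    [/\ complex_span_of gR Phi' a, {in s, forall z, a z} &
        forall y z, a y -> z \in s -> y *m z - z *m y \in s].
Proof.
move=> gL rhoR [surj inj] Phig [P [Q [PQ QP iso]]].
set g := complexification gR in rhoR Phig iso *.
have gCL : is_lie_algebra g := complexification_lie gL.
have dg := subvP (derived_sub gCL).
pose a y := exists2 z, z \in g & y = P *m rho z *m Q.
have sa z : z \in s -> exists2 w, w \in derived g & z = P *m rho w *m Q.
  have zE : z = P *m (Q *m z *m P) *m Q by rewrite !mulmxA PQ mul1mx -mulmxA PQ mulmx1.
  rewrite {1}zE => /iso/memv_imgP[w wd e]; exists w => //.
  by rewrite -e -zE.
have PhiP w : w \in g -> P *m rho w *m Q *m (P *m Phi) = P *m Phi *m w.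
  move=> wg; rewrite mulmxA -[P *m _ *m Q *m P]mulmxA QP mulmx1.
  by rewrite -[LHS]mulmxA -Phig // mulmxA.
exists (P *m Phi), a; split.
- split.
  + split=> [w|v].
      by have [v vE] := surj (Q *m w); exists v; rewrite -mulmxA vE mulmxA PQ mul1mx.
    by move=> /(congr1 (mulmx Q)); rewrite !mulmxA QP mul1mx mulmx0 => /inj.
  + move=> c _ _ [y yg ->] [z zg ->]; exists (c *: y + z); first by rewrite memvD ?memvZ.
    by rewrite linearP /= mulmxDr mulmxDl -scalemxAr -scalemxAl.
  + move=> x /emb_complexification xg; exists (P *m rho (emb x) *m Q); first by exists (emb x).
    by rewrite PhiP.
  + move=> _ [z zg ->]; have /complexificationP[x1 [x2 [g1 g2 zE]]] := zg.
    exists x1, x2; split=> //.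
    by rewrite PhiP // zE mulmxDr -scalemxAr.
- by move=> z /sa[w /dg wg ->]; exists w.
move=> _ z [y yg ->] /sa[w wd ->]; have wg := dg _ wd.
have -> : P *m rho y *m Q *m (P *m rho w *m Q) - P *m rho w *m Q *m (P *m rho y *m Q) =
   P *m rho (lie_bracket y w) *m Q.
  rewrite rhoR // /lie_bracket mulmxBr mulmxBl !mulmxA.
  by rewrite -!(mulmxA _ Q P) QP !mulmx1.
by apply/iso/memv_img; apply: lie_bracket_derived.
Qed.

(** An element of [a] outside s has a nonzero scalar part, and removing its part in s leaves that
    scalar in [a], hence all scalars. *)
Lemma span_dichotomy n k (gR : {vspace 'M[R]_n}) (s : {vspace 'M[C]_k})
    (Phi : 'M[C]_(k, n)) (a : 'M[C]_k -> Prop) :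
  complex_span_of gR Phi a -> {in s, forall z, a z} ->
  (forall y, a y -> exists c, y - c%:M \in s) ->
  complex_span_of gR Phi (fun y => y \in s) \/
  complex_span_of gR Phi (fun y => exists c, y - c%:M \in s).
Proof.
move=> sp sa as_; have aL : forall c y z, a y -> a z -> a (c *: y + z) by case: sp.
have [h|h] := pselect (forall y, a y -> y \in s); [left|right].
  by apply: complex_span_ext sp => y; split; [apply: h|apply: sa].
apply: complex_span_ext sp => y; split; first exact: as_.
have [y1 ay1 y1s] : exists2 y1, a y1 & y1 \notin s.
  apply: contrapT => h'; apply: h => y1 ay1; apply: contrapT => y1s; apply: h'.
  by exists y1 => //; apply/negP.
have [c1 y1c] := as_ _ ay1.
have c10 : c1 != 0.
  by apply: contraNneq y1s => c0; move: y1c; rewrite c0 raddf0 subr0.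
have a1 : a c1%:M.
  have -> : c1%:M = -1 *: (y1 - c1%:M) + y1 by rewrite scaleN1r opprB subrK.
  by apply: aL => //; apply: sa.
move=> [c yc]; have -> : y = (c / c1) *: c1%:M + (y - c%:M).
  by rewrite scale_scalar_mx divfK // addrC subrK.
by apply: aL => //; apply: sa.
Qed.

(** * Irreducible V: the transported quadratic form *)

Section RealType.
Variables (n k : nat) (gR : {vspace 'M[R]_n}) (Q : 'M[R]_n).
Variables (T : 'M[C]_(k, n)) (T' : 'M[C]_(n, k)) (s : {vspace 'M[C]_k}).
Hypotheses (QT : Q^T = Q) (Qp : forall v : 'cV_n, v != 0 -> 0 < (v^T *m Q *m v) 0 0).
Hypothesis Qi : {in gR, forall x, x^T *m Q + Q *m x = 0}.
Hypotheses (TT' : T *m T' = 1%:M) (T'T : T' *m T = 1%:M).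
Hypothesis sg : forall z, z \in s -> T' *m z *m T \in complexification gR.

Let S := T'^T *m emb Q *m T'.

Let ST : S^T = S.
Proof. by rewrite /S !trmx_mul trmxK map_trmx QT mulmxA. Qed.

Let Su : S \in unitmx.
Proof.
have Qu := posdefmx_unit (emb_posdefmx QT Qp).
have : S *m (T *m invmx (emb Q) *m T^T) = 1%:M.
  rewrite /S !mulmxA -[_ *m T' *m T]mulmxA T'T mulmx1 mulmxK // -trmx_mul TT' trmx1.
  by [].
by case/mulmx1_unit.
Qed.

Let sS z : z \in s -> z^T *m S + S *m z = 0.
Proof.
move=> /sg/(real_skew_complexification Qi) h.
have := congr1 (fun X => T'^T *m X *m T') h.
rewrite mulmx0 mul0mx mulmxDr mulmxDl !trmx_mul !mulmxA.
rewrite -[T'^T *m T^T]trmx_mul TT' trmx1 mul1mx -[_ *m T *m T']mulmxA TT' mulmx1.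
exact.
Qed.

Lemma real_type_no_rank_one i j : i != j -> delta_mx i j \notin s.
Proof. by move=> ij; apply/negP => /sS/(no_rank_one_form ST ij); rewrite Su. Qed.

(** By Schur's lemma the transported form S is a scalar, so skewness for Q becomes ordinary
    skewness, that is, membership in s and hence in g. *)
Lemma real_type_so : (2 < k)%N -> (forall z, z^T = - z -> z \in s) ->
  (forall z, z \in s -> z^T = - z) ->
  forall x, x^T *m Q + Q *m x = 0 -> x \in gR.
Proof.
move=> k2 so_s s_so x xQ.
have [z|c SE] := form_intertwiner (T := S) (form1_orth C k) (commutant_so k2).
  move=> hz; apply: sS; apply: so_s; move: hz; rewrite /preserves_form mulmx1 mul1mx.
  by move=> /eqP; rewrite addr_eq0 => /eqP.
rewrite scalemx1 in SE.
have k0 : (0 < k)%N by case: (k) k2.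
have c0 : c != 0.
  apply/eqP => c0; have := Su; rewrite SE c0 raddf0 => /(fun h => mulmxV h).
  rewrite mul0mx => /matrixP/(_ (Ordinal k0) (Ordinal k0)); rewrite !mxE eqxx => /eqP.
  by rewrite eq_sym oner_eq0.
have QE : emb Q = c *: (T^T *m T).
  have <- : T^T *m S *m T = emb Q.
    rewrite /S !mulmxA -trmx_mul T'T trmx1 mul1mx -mulmxA T'T mulmx1.
    by [].
  by rewrite SE mul_mx_scalar -scalemxAl.
pose z := T *m emb x *m T'.
have zs : z \in s.
  apply: so_s; apply/eqP; rewrite -addr_eq0; apply/eqP/(scalerI c0); rewrite scaler0.
  have : emb x^T *m emb Q + emb Q *m emb x = 0 by rewrite -!map_mxM -map_mxD xQ map_mx0.
  rewrite QE => /(congr1 (fun X => T'^T *m X *m T')); rewrite mulmx0 mul0mx.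
  rewrite -scalemxAl -scalemxAr -scalerDr -scalemxAr -scalemxAl mulmxDr mulmxDl.
  move=> <-; congr (_ *: _); rewrite /z !trmx_mul !mulmxA map_trmx.
  rewrite -[T'^T *m T^T]trmx_mul TT' trmx1 mul1mx; congr (_ + _).
  by rewrite -[_ *m T *m T']mulmxA TT' mulmx1.
have := sg zs; rewrite /z !mulmxA T'T mul1mx -mulmxA T'T mulmx1.
exact: complexification_real.
Qed.
End RealType.

(** The complex positive root and its conjugate are both positive roots of the real matrix Q, so
    uniqueness makes the root real. *)
Lemma real_sqrt n (Q : 'M[R]_n) : Q^T = Q ->
  (forall v : 'cV_n, v != 0 -> 0 < (v^T *m Q *m v) 0 0) ->
  exists p : 'M[R]_n, [/\ p \in unitmx, p^T = p & p *m p = Q].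
Proof.
move=> QT Qp; have [p pp pE] := posdefmx_sqrt (emb_posdefmx QT Qp).
have pr : map_mx Num.conj p = p.
  apply: posdefmx_sqrt_unique => //; first exact: posdefmx_conj.
  by rewrite -map_mxM pE conj_emb.
have [q qE] : exists q, p = emb q by exists (Remx p); apply: conj_fixed.
exists q; split.
- by have := posdefmx_unit pp; rewrite qE map_unitmx.
- by apply: (@emb_inj R n n); rewrite -trmxC_emb -qE pp.1.
- by apply: (@emb_inj R n n); rewrite map_mxM -qE.
Qed.

Section FullOrthogonal.
Variables (n : nat) (gR : {vspace 'M[R]_n}) (p : 'M[R]_n).
Hypotheses (pu : p \in unitmx) (pT : p^T = p).
Hypothesis gRE : forall x, x \in gR <-> x^T *m (p *m p) + p *m p *m x = 0.

Let conj_mem x : x \in gR <-> (p *m x *m invmx p)^T = - (p *m x *m invmx p).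
Proof.
set y := p *m x *m invmx p.
have e : x^T *m (p *m p) + p *m p *m x = p *m (y^T + y) *m p.
  by rewrite /y !trmx_mul trmx_inv pT mulmxDr mulmxDl !mulmxA mulmxV // mul1mx mulmxKV.
rewrite gRE e; split=> [h|->]; last by rewrite addNr mulmx0 mul0mx.
apply/eqP; rewrite -addr_eq0; apply/eqP.
by rewrite -[_ + _](mulKmx pu) -[p *m _](mulmxK pu) h mul0mx mulmx0.
Qed.

Let conj_comm x x' : x *m x' = x' *m x <->
  p *m x *m invmx p *m (p *m x' *m invmx p) = p *m x' *m invmx p *m (p *m x *m invmx p).
Proof.
have e u v : p *m u *m invmx p *m (p *m v *m invmx p) = p *m (u *m v) *m invmx p.
  by rewrite !mulmxA mulmxKV.
rewrite !e; split=> [->//|/(congr1 (fun z => invmx p *m z *m p))].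
by rewrite !mulmxA !mulVmx // !mul1mx !mulmxKV.
Qed.

(** Conjugation by p, the root of the form, turns gR into so_n. The image w of v is real, so
    [[:: w]] is closed under conjugation and 1 + 3 < n suffices. *)
Lemma full_so_no_rank_one v : (4 < n)%N -> ~ lie_rank (stabilizer gR v) 1.
Proof.
move=> n4 /lie_rank_stabilizer1P[x [xg x0 xv xc]].
pose h := compact_form (1%:M : 'M[C]_n); pose w := emb (p *m v).
have back (z : 'M[R]_n) : p *m (invmx p *m z *m p) *m invmx p = z.
  by rewrite !mulmxA mulmxV // mul1mx mulmxK.
suff : rank_one_at h w.
  apply: two_commutingP => z hz zw; apply: so_two_commuting => //; split.
    by move=> u; rewrite inE => /eqP->; exists 0; rewrite scale0r.
  by move=> u; rewrite inE => /eqP->; rewrite conj_emb inE.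
exists (emb (p *m x *m invmx p)); split.
- by apply/compact_form1_emb/conj_mem.
- apply: contra_neq x0; rewrite -(map_mx0 (real_complex R)) => /emb_inj h0.
  by rewrite -[x](mulKmx pu) -[p *m x](mulmxKV pu) h0 mul0mx mulmx0.
- by rewrite /w -map_mxM mulmxA mulmxKV // -mulmxA xv mulmx0 map_mx0.
move=> _ /compact_form1_real[z -> zT] zw cz.
pose x' := invmx p *m z *m p.
have x'g : x' \in gR by apply/conj_mem; rewrite back.
have x'v : x' *m v = 0.
  move: zw; rewrite /w -map_mxM -(map_mx0 (real_complex R)) => /emb_inj h0.
  by rewrite /x' -!mulmxA h0 mulmx0.
have cx : x *m x' = x' *m x.
  by apply/conj_comm; rewrite back; apply: (@emb_inj R n n); rewrite !(map_mxM _ _ z) !(map_mxM _ z).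
have [c cE] := xc _ x'g x'v cx.
exists c%:C%C; first by apply/complex_realP; exists c.
by rewrite -embZ -[z]back -/x' cE -scalemxAr -scalemxAl.
Qed.

Lemma full_so_rank r : lie_rank gR r -> (2 * r <= n)%N.
Proof.
move=> [t [tg tc _] <-]; pose f := sandwich p (invmx p).
have fE x : f x = p *m x *m invmx p by rewrite sandwichE.
have <- : \dim (f @: t) = \dim t.
  apply: limg_dim_eq; apply/eqP; rewrite -subv0; apply/subvP => x.
  rewrite memv_cap memv_ker fE memv0 => /andP[_ /eqP h0].
  by rewrite -[x](mulKmx pu) -[p *m x](mulmxKV pu) h0 mul0mx mulmx0.
apply: (@skew_torus_dim R); split.
  by move=> _ /memv_imgP[x /(subvP tg) xg ->]; rewrite fE; apply/conj_mem.
move=> _ _ /memv_imgP[x xt ->] /memv_imgP[x' xt' ->]; rewrite !fE.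
by apply/(conj_comm x x').1/lie_bracket0P; apply: tc.
Qed.
End FullOrthogonal.
End Classification.

Section Roots.
Variable F : fieldType.

Lemma delta_mx_sl m (i j : 'I_m) : i != j -> delta_mx i j \in sl_alg F m.
Proof.
move=> ij; rewrite mem_sl_alg; apply/eqP/big1 => l _; rewrite mxE.
by case: (eqVneq l i) => //= ->; rewrite (negbTE ij).
Qed.

Lemma delta_mx_sp m (i : 'I_m) : delta_mx (lshift m i) (rshift m i) \in sp_alg F m.
Proof.
rewrite mem_sp_alg delta_mx_ushift delta_mx_rshift -[X in col_mx _ X]row_mx0.
rewrite -[col_mx _ _]/(block_mx _ _ _ _) /symplectic_form tr_block_mx !trmx0 !mulmx_block.
rewrite !(mulmx0, mul0mx, mulmx1, mul1mx, addr0, add0r, mulmxN, mulNmx, oppr0).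
rewrite trmx_delta add_block_mx !addr0 subrr.
by apply/eqP/block_mx0.
Qed.

(** The coincidence of sl_2 with sp_2, through which the algebra sp_2 with scalars turns up in the
    list as gl_2. *)
Lemma traceless_sp1 (y : 'M[F]_(1 + 1)) : \tr y = 0 -> y \in sp_alg F 1.
Proof.
have t1 (z : 'M[F]_1) : z^T = z by rewrite [z]mx11_scalar tr_scalar_mx.
rewrite -[y]submxK mxtrace_block mem_sp_alg /symplectic_form tr_block_mx !mulmx_block => h.
rewrite !(mulmx0, mul0mx, mulmx1, mul1mx, addr0, add0r, mulmxN, mulNmx) !t1.
have -> : drsubmx y = - ulsubmx y.
  rewrite [drsubmx y]mx11_scalar [ulsubmx y]mx11_scalar -raddfN /=.
  congr (_%:M); apply/eqP; rewrite -addr_eq0 addrC; apply/eqP.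
  by move: h; rewrite /mxtrace !big_ord1.
by rewrite add_block_mx opprK addNr !subrr; apply/eqP/block_mx0.
Qed.

End Roots.

Section Taut.
Variable R : realType.
Local Notation C := R[i].
Local Notation emb := (map_mx (real_complex R)).
Local Notation Remx := (map_mx (@complex.Re R)).
Local Notation Immx := (map_mx (@complex.Im R)).

Lemma real_taut_absurd n m r (gR : {vspace 'M[R]_n}) (rho : 'Hom('M[C]_n, 'M[C]_m)) :
  compact_linear_lie_algebra gR -> (0 < n)%N -> lie_rank gR r -> (1 < r)%N ->
  representations_isomorphic (complexification gR) id rho ->
  classical (rho @: derived (complexification gR))%VS ->
  ~ exists v, lie_rank (stabilizer gR v) 1.
Proof.
move=> gRc n0 rk r1 [P [Q [PQ QP Pg]]] [simp [k iso]] [v rkv].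
have [F [FT Fp Fi]] := compact_lie_invariant_form gRc.
have dg := subvP (derived_sub (complexification_lie gRc.1)).
have setup k' (s : {vspace 'M[C]_k'}) :
    linear_isomorphic (rho @: derived (complexification gR))%VS s ->
    exists (T : 'M[C]_(k', n)) (T' : 'M[C]_(n, k')),
    [/\ T *m T' = 1%:M, T' *m T = 1%:M, simple_lie s, k' = n &
     forall z, z \in s -> T' *m z *m T \in complexification gR].
  move=> iso'; have ss := simple_lie_iso iso' simp; case: iso' => P1 [Q1 [PQ1 QP1 h]].
  have TT' : P1 *m P *m (Q *m Q1) = 1%:M by rewrite mulmxA -(mulmxA P1) PQ mulmx1.
  have T'T : Q *m Q1 *m (P1 *m P) = 1%:M by rewrite mulmxA -(mulmxA Q) QP1 mulmx1.
  exists (P1 *m P), (Q *m Q1); split=> //.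
    by apply/eqP; rewrite eqn_leq (mulmx1_min TT') (mulmx1_min T'T).
  move=> z zs; have /h/memv_imgP[w wd e] : P1 *m (Q1 *m z *m P1) *m Q1 \in s.
    by rewrite !mulmxA PQ1 mul1mx -mulmxA PQ1 mulmx1.
  have -> : Q *m Q1 *m z *m (P1 *m P) = Q *m (Q1 *m z *m P1) *m P by rewrite !mulmxA.
  have wg := dg _ wd.
  by rewrite e -[Q *m rho w *m P]mulmxA -(Pg _ wg) mulmxA QP mul1mx.
case: iso => /setup[T [T' [TT' T'T ss kn sg]]].
- have no := real_type_no_rank_one FT Fp Fi TT' T'T sg.
  case: k {T T' TT' T'T sg setup} kn ss no => [|[|k]] kn ss no; first by rewrite -kn in n0.
    by case: (@sl1_not_simple C).
  have ne : (ord0 : 'I_k.+2) != ord_max by [].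
  by have := no _ _ ne; rewrite delta_mx_sl.
- have k2 : (2 < k)%N.
    case: k kn ss {T T' TT' T'T sg} => [|[|[|k]]] kn ss //; first by rewrite -kn in n0.
      by case: (@so1_not_simple C).
    by case: (@so2_not_simple C).
  have sof z : z \in so_alg C k <-> z^T = - z.
    by rewrite mem_so_alg addrC addr_eq0; split=> [/eqP|->].
  have full := real_type_so FT Fp Fi TT' T'T sg k2 (fun z => (sof z).2) (fun z => (sof z).1).
  have [p [pu pT pE]] := real_sqrt FT Fp.
  have gRE x : x \in gR <-> x^T *m (p *m p) + p *m p *m x = 0.
    by rewrite pE; split=> [/Fi|/full].
  have := full_so_rank pu pT gRE rk; rewrite -kn => rle.
  (* The rank bound 2 r <= k with r > 1 already gives k >= 4; excluding 4 leaves k > 4. *)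
  have k4 : k != 4%N by apply/eqP => k4; move: ss; rewrite k4; exact: so4_not_simple.
  apply: (full_so_no_rank_one pu pT gRE _ rkv); rewrite -kn.
  by move: k2 k4 rle r1; clear; lia.
- have no := real_type_no_rank_one FT Fp Fi TT' T'T sg.
  case: k {T T' TT' T'T sg setup} kn ss no => [|k] kn ss no; first by rewrite -kn in n0.
  have ne : lshift k.+1 (ord0 : 'I_k.+1) != rshift k.+1 (ord0 : 'I_k.+1).
    by rewrite eq_lrshift.
  by have := no _ _ ne; rewrite delta_mx_sp.
Qed.

(** * Dimensions compatible with a stabilizer of rank one *)

Section ComplexType.
Variables (n r k : nat) (gR : {vspace 'M[R]_n}).
Hypotheses (gRc : compact_linear_lie_algebra gR) (irr : irreducible gR).
Hypotheses (rk : lie_rank gR r) (r1 : (1 < r)%N).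
Hypothesis ex_v : exists v, lie_rank (stabilizer gR v) 1.

Lemma no_two_commuting m (Phi : 'M[C]_(m, n)) h : realizes gR Phi h ->
  ~ forall x w, h x -> x *m w = 0 -> two_commuting h [:: w] x.
Proof.
move=> /realizes_rank_one/iffLR/(_ ex_v)[w rw] hc.
by apply: two_commutingP rw => x; apply: hc.
Qed.

(** Above 3 there is room for a commuting pair, k = 2 gives su_2 of rank 1 against r > 1, and sl_1
    is not simple. *)
Lemma span_sl_dim (Phi : 'M[C]_(k, n)) : (0 < k)%N -> simple_lie (sl_alg C k) ->
  complex_span_of gR Phi (fun y => y \in sl_alg C k) -> k = 3%N.
Proof.
move=> k0 ss sp.
have {}sp : complex_span_of gR Phi (fun y => \tr y = 0).
  by apply: complex_span_ext sp => y; rewrite mem_sl_alg; split=> [/eqP|->].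
have [Phi' re] := realizes_sl gRc sp.
have [k3|k3|//] := ltngtP k 3; last first.
  by case: (no_two_commuting re) => x w [xs xt]; apply: sl_two_commuting.
clear sp; case: k k0 k3 ss Phi Phi' re => [|[|[|k']]] // _ _ ss Phi Phi' re.
  by case: (@sl1_not_simple C).
by have := rank_su2 re (fun y h => h) rk; rewrite leqNgt r1.
Qed.

Lemma span_gl_dim (Phi : 'M[C]_(k, n)) : complex_span_of gR Phi (fun=> True) -> (k <= 2)%N.
Proof.
move=> /(realizes_gl gRc)[Phi' re]; rewrite leqNgt; apply/negP => k2.
by case: (no_two_commuting re) => x w; apply: gl_two_commuting.
Qed.

(** Without scalars gR acts by real matrices on C^k, so the vectors mapped into R^k form an
    invariant real subspace, against irreducibility. *)
Lemma span_so_absurd (Phi : 'M[C]_(k, n)) : (2 < k)%N ->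
  ~ complex_span_of gR Phi (fun y => y \in so_alg C k).
Proof.
move=> k2 /(complex_span_ext (@mem_so_form R k)) sp.
have k0 : (0 < k)%N by case: (k) k2.
have [Psi [[surj inj] re]] :=
  realizes_form gRc (form1_real C k) (form1_orth C k) (commutant_so k2) k0 sp.
have ME (v : 'cV[R]_n) : Psi *m emb v = emb (Remx Psi *m v) + 'i *: emb (Immx Psi *m v).
  by rewrite {1}(emb_rect Psi) mulmxDl -scalemxAl -!map_mxM.
have fE (v : 'cV[R]_n) : (v \in lker (linfun (mulmx (Immx Psi) : 'cV_n -> 'cV_k))) =
    (Immx Psi *m v == 0).
  by rewrite memv_ker lfunE.
have realP (v : 'cV[R]_n) (u : 'cV[R]_k) : Psi *m emb v = emb u -> Immx Psi *m v = 0.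
  have -> : emb u = emb u + 'i *: emb 0 by rewrite map_mx0 scaler0 addr0.
  by rewrite ME => /emb_rect_inj[].
have e0 : (delta_mx (Ordinal k0) 0 : 'cV[R]_k) != 0.
  by apply/eqP => /colP/(_ (Ordinal k0)); rewrite !mxE !eqxx => /eqP; rewrite oner_eq0.
case: irr => _; apply; exists (lker (linfun (mulmx (Immx Psi) : 'cV_n -> 'cV_k))); split.
- move=> x u /re[y /compact_form1_real[z -> _] e]; rewrite !fE => /eqP u0.
  apply/eqP; apply: (realP _ (z *m (Remx Psi *m u))).
  by rewrite map_mxM mulmxA e -mulmxA ME u0 map_mx0 scaler0 addr0 -map_mxM.
- move=> h; have [v vE] := surj (emb (delta_mx (Ordinal k0) 0)).
  have : v \in lker (linfun (mulmx (Immx Psi) : 'cV_n -> 'cV_k)) by rewrite fE (realP _ _ vE).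
  rewrite h memv0 => /eqP v0; move: vE; rewrite v0 map_mx0 mulmx0 -(map_mx0 (real_complex R)).
  by move=> /emb_inj/esym/eqP; rewrite (negbTE e0).
- move=> h; have [v vE] := surj ('i *: emb (delta_mx (Ordinal k0) 0)).
  have : v \in lker (linfun (mulmx (Immx Psi) : 'cV_n -> 'cV_k)) by rewrite h memvf.
  have -> : (v \in lker (linfun (mulmx (Immx Psi) : 'cV_n -> 'cV_k))) = (Immx Psi *m v == 0).
    exact: fE.
  move: vE; rewrite ME -[RHS]add0r -(map_mx0 (real_complex R)) => /emb_rect_inj[_ ->].
  by rewrite (negbTE e0).
Qed.

(** Only k = 3 and k = 5 remain. The upper bound on the rank gives r = 2 for k = 3 and r <= 3 for k
    = 5, where [soC_rank_neq2] excludes r = 2. *)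
Lemma span_soC_dim (Phi : 'M[C]_(k, n)) : (2 < k)%N -> k != 4%N ->
  complex_span_of gR Phi (fun y => exists b, y - b%:M \in so_alg C k) ->
  (r = 2%N \/ r = 3%N) /\ k = (2 * r - 1)%N.
Proof.
move=> k2 k4 sp.
have {}sp : complex_span_of gR Phi (fun y => exists b, preserves_form 1%:M (y - b%:M)).
  by apply: complex_span_ext sp => y; split=> -[b /mem_so_form h]; exists b.
have k0 : (0 < k)%N by case: (k) k2.
have [Psi re] :=
  realizes_formC gRc (form1_real C k) (form1_orth C k) (commutant_so k2) k0 sp.
have [V VE] := realify_mx re.1 1%:M.
have rle := soC_rank_le k0 re VE rk.
have k5 : (k <= 5)%N.
  rewrite leqNgt; apply/negP => k5.
  by case: (no_two_commuting re) => x w; apply: soC_two_commuting.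
have r2 : (3 < k)%N -> r != 2%N.
  by move=> k3; apply/eqP => rE; apply: (soC_rank_neq2 k0 re VE k3); rewrite -rE.
have [k3|k3] := leqP k 3; last have := r2 k3.
  by move: k2 k3 rle r1; clear; lia.
by move: k2 k3 k4 k5 rle r1; clear; lia.
Qed.

Lemma span_sp_dim (Phi : 'M[C]_(k + k, n)) : (0 < k)%N ->
  complex_span_of gR Phi (fun y => y \in sp_alg C k) -> k = 2%N.
Proof.
move=> k0 /(complex_span_ext (@mem_sp_form R k)) sp.
have kk0 : (0 < k + k)%N by rewrite addn_gt0 k0.
have [Psi re] := realizes_form gRc (sympl_real R k) (sympl_orth R k) (@commutant_sp C k) kk0 sp.
have [k2|k2|//] := ltngtP k 2; last first.
  case: (no_two_commuting re) => x w.
  have k4 : (4 < k + k)%N by move: k2; clear; lia.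
  apply: (sp_two_commuting (sympl_real R k) (sympl_orth R k) (sympl_tr R k)) => //.
  by rewrite mulN1r opprK.
clear sp; have k1 : k = 1%N by move: k0 k2; clear; lia.
have htr y : compact_form (sympl C k) y -> y ^t* = - y /\ \tr y = 0.
  by move=> [ys /(preserves_form_tr (sympl_orth R k))].
move: Psi re htr; rewrite k1 => Psi re htr.
by have := rank_su2 re htr rk; rewrite leqNgt r1.
Qed.

Lemma span_spC_dim (Phi : 'M[C]_(k + k, n)) : (0 < k)%N ->
  complex_span_of gR Phi (fun y => exists b, y - b%:M \in sp_alg C k) -> k = 1%N.
Proof.
move=> k0 sp.
have {}sp : complex_span_of gR Phi (fun y => exists b, preserves_form (sympl C k) (y - b%:M)).
  by apply: complex_span_ext sp => y; split=> -[b /mem_sp_form h]; exists b.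
have kk0 : (0 < k + k)%N by rewrite addn_gt0 k0.
have [Psi re] := realizes_formC gRc (sympl_real R k) (sympl_orth R k) (@commutant_sp C k) kk0 sp.
have [k1|k1] := leqP k 1; first by apply/eqP; rewrite eqn_leq k1.
case: (no_two_commuting re) => x w.
have k4 : (2 < k + k)%N by move: k1; clear; lia.
apply: (spC_two_commuting (sympl_real R k) (sympl_orth R k) (sympl_tr R k)) => //.
by rewrite mulN1r opprK.
Qed.

End ComplexType.

Lemma normalizes_form k (s : {vspace 'M[C]_k}) (B y : 'M[C]_k) :
  B^T *m B = 1%:M -> form_commutant_scalar B ->
  (forall z, (z \in s) <-> preserves_form B z) ->
  (forall z, z \in s -> y *m z - z *m y \in s) -> exists c, y - c%:M \in s.
Proof.
move=> BtB cB sB ys; have [|c h] := @form_normalizer _ _ B y BtB cB.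
  by move=> z /sB/ys/sB.
by exists c; apply/sB.
Qed.

Lemma complex_type_classification n m r (gR : {vspace 'M[R]_n})
    (rho : 'Hom('M[C]_n, 'M[C]_m)) (Phi : 'M[C]_(m, n)) :
  compact_linear_lie_algebra gR -> irreducible gR -> lie_rank gR r -> (1 < r)%N ->
  (0 < m)%N -> is_representation (complexification gR) rho ->
  realification_iso Phi ->
  {in complexification gR, forall x, Phi *m x = rho x *m Phi} ->
  classical (rho @: derived (complexification gR))%VS ->
  (exists v, lie_rank (stabilizer gR v) 1) ->
  exists2 J : 'M[R]_n, invariant_complex_structure gR J &
     [\/ (r = 2%N \/ r = 3%N) /\
           complex_linear_isomorphic gR J (so_alg C (2 * r - 1) + <[1%:M]>)%VS,
         complex_linear_isomorphic gR J (sl_alg C 3),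
         complex_linear_isomorphic gR J (gl_alg C 2) |
         complex_linear_isomorphic gR J (sp_alg C 2)].
Proof.
move=> gRc irr rk r1 m0 rhoR PhiI Phig [simp [k iso]] ex_v.
have setup k' (s : {vspace 'M[C]_k'}) :
    linear_isomorphic (rho @: derived (complexification gR))%VS s ->
    [/\ (0 < k')%N, simple_lie s & exists (Psi : 'M[C]_(k', n)) (a : 'M[C]_k' -> Prop),
      [/\ complex_span_of gR Psi a, {in s, forall z, a z} &
        forall y z, a y -> z \in s -> y *m z - z *m y \in s]].
  move=> iso'; split; last exact: taut_sum_span gRc.1 rhoR PhiI Phig iso'.
    by case: iso' => P [Q [_ QP _]]; apply: leq_trans m0 (mulmx1_min QP).
  exact: simple_lie_iso iso' simp.
case: iso => /setup[k0 ss [Psi [a [sp sa as_]]]].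
(* Every matrix is a traceless one plus a scalar, so normalizing s is no constraint here. *)
- have sn y : a y -> exists c, y - c%:M \in sl_alg C k.
    move=> _; exists (\tr y / k%:R); rewrite mem_sl_alg raddfB /= mxtrace_scalar.
    by rewrite -[_ *+ k]mulr_natr divfK ?subrr // pnatr_eq0 -lt0n.
  have [{}sp|{}sp] := span_dichotomy sp sa sn.
    have k3 := span_sl_dim gRc rk r1 ex_v k0 ss sp; subst k.
    have [J Js Ji] := complex_span_of_structure sp.
    by exists J => //; apply: Or42.
  have {}sp : complex_span_of gR Psi (fun=> True).
    apply: complex_span_ext sp => y; split=> // _.
    exists (\tr y / k%:R); rewrite mem_sl_alg raddfB /= mxtrace_scalar.
    by rewrite -[_ *+ k]mulr_natr divfK ?subrr // pnatr_eq0 -lt0n.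
  have k2 := span_gl_dim gRc ex_v sp.
  have k1 : k != 1%N by apply/eqP => k1; move: ss; rewrite k1; exact: sl1_not_simple.
  have kE : k = 2%N by move: k0 k1 k2; clear; lia.
  subst k.
  have {}sp : complex_span_of gR Psi (fun y => y \in gl_alg C 2).
    by apply: complex_span_ext sp => y; rewrite memvf.
  have [J Js Ji] := complex_span_of_structure sp.
  by exists J => //; apply: Or43.
- have k1 : k != 1%N by apply/eqP => k1; move: ss; rewrite k1; exact: so1_not_simple.
  have k2 : k != 2%N by apply/eqP => k2; move: ss; rewrite k2; exact: so2_not_simple.
  have k4 : k != 4%N by apply/eqP => k4; move: ss; rewrite k4; exact: so4_not_simple.
  have {k1 k2} k2 : (2 < k)%N by move: k0 k1 k2; clear; lia.
  have sn y : a y -> exists c, y - c%:M \in so_alg C k.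
    move=> ay; apply: (normalizes_form (form1_orth C k) (commutant_so k2)).
      exact: mem_so_form.
    by move=> z; apply: as_.
  have [{}sp|{}sp] := span_dichotomy sp sa sn.
    by case: (span_so_absurd gRc irr k2 sp).
  have [r23 kE] := span_soC_dim gRc rk r1 ex_v k2 k4 sp.
  clear sa as_ sn ss setup; subst k.
  have {}sp : complex_span_of gR Psi (fun y => y \in (so_alg C (2 * r - 1) + <[1%:M]>)%VS).
    apply: complex_span_ext sp => y; rewrite mem_soC.
    by split=> -[b /mem_so_form h]; exists b.
  have [J Js Ji] := complex_span_of_structure sp.
  by exists J => //; apply: Or41.
- have sn y : a y -> exists c, y - c%:M \in sp_alg C k.
    move=> ay; apply: (normalizes_form (sympl_orth R k) (@commutant_sp C k)).
      exact: mem_sp_form.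
    by move=> z; apply: as_.
  have [{}sp|{}sp] := span_dichotomy sp sa sn.
    have kE : k = 2%N by apply: (span_sp_dim gRc rk r1 ex_v _ sp); case: (k) k0.
    clear setup; subst k.
    have [J Js Ji] := complex_span_of_structure sp.
    by exists J => //; apply: Or44.
  have kE : k = 1%N by apply: (span_spC_dim gRc ex_v _ sp); case: (k) k0.
  clear setup; subst k.
  (* For k = 1 the algebra sp_2 is sl_2, which together with the scalars fills gl_2. *)
  have {}sp : complex_span_of gR (Psi : 'M[C]_(2, n)) (fun y => y \in gl_alg C 2).
    apply: complex_span_ext sp => y; rewrite memvf; split=> // _.
    exists (\tr y / 2); apply: traceless_sp1; rewrite raddfB /= mxtrace_scalar.
    by rewrite -[_ *+ _]mulr_natr divfK ?subrr // pnatr_eq0.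
  have [J Js Ji] := complex_span_of_structure sp.
  by exists J => //; apply: Or43.
Qed.
End Taut.

Theorem mainTheorem3 (R : realType) (n r : nat) (gR : {vspace 'M[R]_n})
    (gR_compact : compact_linear_lie_algebra gR)
    (gR_sl : (gR <= sl_alg R n)%VS)
    (gR_irr : irreducible gR)
    (gR_rank : lie_rank gR r)
    (r_gt1 : (1 < r)%N)
    (gR_simple : simple_lie (derived gR))
    (m : nat) (rho : 'Hom('M[R[i]]_n, 'M[R[i]]_m))
    (rho_rep : is_representation (complexification gR) rho)
    (rho_faithful : faithful (complexification gR) rho)
    (rho_irr : irreducible (rho @: complexification gR)%VS)
    (taut : representations_isomorphic (complexification gR) id rho \/
            representations_isomorphic (complexification gR) id
              (representation_sum rho (dual_representation rho)))
    (rho_classical : classical (rho @: derived (complexification gR))%VS) :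
  (exists v : 'cV[R]_n, lie_rank (stabilizer gR v) 1) <->
  (reducible (complexification gR) /\
   exists2 J : 'M[R]_n, invariant_complex_structure gR J &
     [\/ (r = 2%N \/ r = 3%N) /\
           complex_linear_isomorphic gR J
             (so_alg R[i] (2 * r - 1) + <[1%:M]>)%VS,
         complex_linear_isomorphic gR J (sl_alg R[i] 3),
         complex_linear_isomorphic gR J (gl_alg R[i] 2) |
         complex_linear_isomorphic gR J (sp_alg R[i] 2)]).
Proof.
split=> [ex_v|[_ [J _ [[r23 ji]|ji|ji|ji]]]].
- case: taut => [real_taut|sum_taut].
    by case: (real_taut_absurd gR_compact gR_irr.1 gR_rank r_gt1 real_taut rho_classical).
  have [red [Phi [PhiI Phig]]] := taut_sum_realization gR_irr rho_irr.1 sum_taut.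
  split=> //; exact: (complex_type_classification gR_compact gR_irr gR_rank r_gt1
    rho_irr.1 rho_rep PhiI Phig rho_classical ex_v).
- apply: (so_stabilizer_rank1 gR_compact _ ji).
  by case: r23 => ->; [left|right].
- exact: sl_stabilizer_rank1 ji.
- exact: gl_stabilizer_rank1 ji.
- exact: sp_stabilizer_rank1 ji.
Qed.
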